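(* Assume: (A1) $\sup_{i,j}\|X_{ij}\|=O(\sqrt{p_n})$; (A2) the unknown parameter $\beta_n$ belongs to a compact subset $\mathcal{B}\subseteq\mathbb{R}^{p_n}$, the true value $\beta_{n0}$ lies in the interior of $\mathcal{B}$, and there are constants $b_1,b_2$ (not depending on $n$) with $0<b_1\le\pi_{ij}(\beta_{n0})\le b_2<1$ for all $i,j$; (A3) there are positive constants $b_3,b_4$ with $b_3\le\lambda_{\min}\big(n^{-1}\sum_{i=1}^nX_i^TX_i\big)\le\lambda_{\max}\big(n^{-1}\sum_{i=1}^nX_i^TX_i\big)\le b_4$; (A4) the common true correlation matrix $R_0$ has eigenvalues bounded away from $0$ and $+\infty$, and the estimated working correlation matrix $\widehat R$ satisfies $\|\widehat R^{-1}-\overline R^{-1}\|=O_p(\sqrt{p_n/n})$, where $\overline R$ is a constant positive definite matrix with eigenvalues bounded away from $0$ and $+\infty$ ($\overline R$ is not required to equal $R_0$). Let $\widehat\beta_n$ be the GEE estimator, i.e. a root of $S_n(\beta_n)=0$ with $\|\widehat\beta_n-\beta_{n0}\|=O_p(\sqrt{p_n/n})$. Let $L_n$ be an $l\times p_n$ matrix, with $l$ fixed, such that $L_n\Sigma_nL_n^T$ is invertible. If $n^{-1}p_n^3=o(1)$, then $$(L_n\Sigma_nL_n^T)^{-1/2}L_n(\widehat\beta_n-\beta_{n0})\to N_l(0,I_l)\quad\text{in distribution.}$$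
   Context: Setting: the number of clusters $n\to\infty$, the cluster size $m<\infty$ is a fixed integer, and the number of covariates $p_n\to\infty$ as $n\to\infty$. For each $n$, each cluster $i=1,\dots,n$ and each $j=1,\dots,m$, one observes a binary response $Y_{ij}\in\{0,1\}$ and a covariate vector $X_{ij}\in\mathbb{R}^{p_n}$ (covariates are treated as fixed: all moments and probabilities are conditional on them; dependence on $n$ is suppressed). $Y_i=(Y_{i1},\dots,Y_{im})^T$, and $X_i=(X_{i1},\dots,X_{im})^T$ is the $m\times p_n$ matrix with rows $X_{ij}^T$. $Y_1,\dots,Y_n$ are independent; components of one $Y_i$ may be dependent. For $\beta\in\mathbb{R}^{p_n}$ let $\pi_{ij}(\beta)=\exp(X_{ij}^T\beta)/[1+\exp(X_{ij}^T\beta)]$ and $\pi_i(\beta)=(\pi_{i1}(\beta),\dots,\pi_{im}(\beta))^T$. The true parameter $\beta_{n0}$ satisfies $E(Y_{ij})=\pi_{ij}(\beta_{n0})$, hence $\mathrm{Var}(Y_{ij})=\pi_{ij}(\beta_{n0})(1-\pi_{ij}(\beta_{n0}))$. All $Y_i$ have the same $m\times m$ true correlation matrix $R_0$. $A_i(\beta)$ is the $m\times m$ diagonal matrix with $j$th diagonal entry $A_{ij}(\beta)=\pi_{ij}(\beta)(1-\pi_{ij}(\beta))$. $\widehat R$ is an estimated $m\times m$ working correlation matrix (random, and not depending on the argument $\beta_n$ of the estimating function). Define $$S_n(\beta_n)=\sum_{i=1}^nX_i^TA_i^{1/2}(\beta_n)\widehat R^{-1}A_i^{-1/2}(\beta_n)\big(Y_i-\pi_i(\beta_n)\big),$$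 $$\overline M_n(\beta_n)=\sum_{i=1}^nX_i^TA_i^{1/2}(\beta_n)\overline R^{-1}R_0\overline R^{-1}A_i^{1/2}(\beta_n)X_i,\qquad \overline H_n(\beta_n)=\sum_{i=1}^nX_i^TA_i^{1/2}(\beta_n)\overline R^{-1}A_i^{1/2}(\beta_n)X_i,$$ $$\Sigma_n=\overline H_n^{-1}(\beta_{n0})\overline M_n(\beta_{n0})\overline H_n^{-1}(\beta_{n0}).$$ $N_l(0,I_l)$ is the $l$-dimensional standard normal distribution. $\|\cdot\|$ is the Euclidean norm for vectors and the Frobenius norm for matrices; $\lambda_{\min},\lambda_{\max}$ denote smallest and largest eigenvalues. *)

(* Defs.v *)
From HB Require Import structures.
From mathcomp Require Import all_boot all_order all_algebra.
From mathcomp Require Import all_classical all_reals all_analysis.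

Set Implicit Arguments.
Unset Strict Implicit.
Unset Printing Implicit Defensive.

Import Order.TTheory GRing.Theory Num.Theory.
Import numFieldNormedType.Exports.

Local Open Scope classical_set_scope.
Local Open Scope ring_scope.

(* The norm carried by matrices in MathComp-Analysis is the max norm.  On a
   column or row vector, [fnorm] is the Euclidean norm. *)
Definition fnorm (R : realType) (a b : nat) (A : 'M[R]_(a, b)) : R :=
  Num.sqrt (\sum_i \sum_j A i j ^+ 2).

(* Only meaningful for symmetric matrices of positive dimension, whose set of
   real eigenvalues is finite and nonempty. *)
Definition lambda_min (R : realType) (k : nat) (A : 'M[R]_k) : R :=
  inf [set a | eigenvalue A a].

Definition lambda_max (R : realType) (k : nat) (A : 'M[R]_k) : R :=
  sup [set a | eigenvalue A a].

Definition possemidef (R : realType) (k : nat) (A : 'M[R]_k) : Prop :=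
  A^T = A /\ forall v : 'cV[R]_k, 0 <= (v^T *m A *m v) 0 0.

Definition posdef (R : realType) (k : nat) (A : 'M[R]_k) : Prop :=
  A^T = A /\ forall v : 'cV[R]_k, v != 0 -> 0 < (v^T *m A *m v) 0 0.

(* The positive semidefinite square root; the default value 0 is only returned
   when A is not positive semidefinite. *)
Definition sqrtmx (R : realType) (k : nat) (A : 'M[R]_k) : 'M[R]_k :=
  xget 0 [set B | possemidef B /\ B *m B = A].

Definition measurable_mx (R : realType) (d : measure_display)
    (T : measurableType d) (a b : nat) (Z : T -> 'M[R]_(a, b)) : Prop :=
  forall i j, measurable_fun [set: T] (fun w => Z w i j).

Definition tuple_of_cV (R : realType) (k : nat) (v : 'cV[R]_k) : k.-tuple R :=
  [tuple v i 0 | i < k].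

(* The sigma-algebra on tuples is the product of the Borel sigma-algebras. *)
Definition independent_vectors (R : realType) (d : measure_display)
    (T : measurableType d) (P : probability T R) (I : finType) (k : nat)
    (Z : I -> T -> 'cV[R]_k) : Prop :=
  forall (J : {set I}) (B : I -> set (k.-tuple R)),
    (forall i, measurable (B i)) ->
    P [set w | forall i, i \in J -> B i (tuple_of_cV (Z i w))] =
    (\prod_(i in J) P [set w | B i (tuple_of_cV (Z i w))])%E.

Definition correlation (R : realType) (d : measure_display)
    (T : measurableType d) (P : probability T R) (U V : T -> R) : R :=
  fine (covariance P U V) /
  (Num.sqrt (fine 'V_P[U]) * Num.sqrt (fine 'V_P[V])).

Definition corrmx (R : realType) (d : measure_display)
    (T : measurableType d) (P : probability T R) (k : nat)
    (Z : T -> 'cV[R]_k) : 'M[R]_k :=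
  \matrix_(i, j) correlation P (fun w => Z w i 0) (fun w => Z w j 0).

Definition bigOp (R : realType) (d : nat -> measure_display)
    (T : forall n, measurableType (d n)) (P : forall n, probability (T n) R)
    (U : forall n, T n -> R) (r : nat -> R) : Prop :=
  forall e : R, 0 < e -> exists2 M : R, 0 < M &
    \forall n \near \oo, (P n [set w | (M * r n < `|U n w|)%R] <= e%:E)%E.

Definition with_prob_to1 (R : realType) (d : nat -> measure_display)
    (T : forall n, measurableType (d n)) (P : forall n, probability (T n) R)
    (E : forall n, set (T n)) : Prop :=
  P n (E n) @[n --> \oo] --> 1%E.

(* N(0, 1) lives on the alias [measurableTypeR R] of R, with the same Borel
   sets. *)
Definition cons_pair (R : realType) (k : nat)
    (x : measurableTypeR R * k.-tuple R) : k.+1.-tuple R :=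
  [tuple of x.1 :: x.2].

Lemma measurable_cons_pair (R : realType) (k : nat) :
  measurable_fun [set: measurableTypeR R * k.-tuple R] (@cons_pair R k).
Proof.
apply: (@measurable_cons _ _ (measurableTypeR R * k.-tuple R)%type R fst k snd).
  exact: measurable_fst.
exact: measurable_snd.
Qed.

HB.instance Definition _ (R : realType) (k : nat) :=
  isMeasurableFun.Build _ _ _ _ (@cons_pair R k) (@measurable_cons_pair R k).

(* N_k(0, I_k), as the k-fold product of N(0, 1). *)
Fixpoint std_normal (R : realType) (k : nat) : probability (k.-tuple R) R :=
  match k with
  | 0 => \d_([tuple] : 0.-tuple R)
  | k'.+1 => distribution (normal_prob 0 1 \x std_normal R k')%E (@cons_pair R k')
  end.

Definition joint_cdf (R : realType) (k : nat) (mu : probability (k.-tuple R) R)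
    (t : 'cV[R]_k) : \bar R :=
  mu [set y | forall i, tnth y i <= t i 0].

Definition cvg_in_distribution (R : realType) (d : nat -> measure_display)
    (T : forall n, measurableType (d n)) (P : forall n, probability (T n) R)
    (k : nat) (Z : forall n, T n -> 'cV[R]_k)
    (mu : probability (k.-tuple R) R) : Prop :=
  forall t : 'cV[R]_k, {for t, continuous (joint_cdf mu)} ->
    P n [set w | forall i, Z n w i 0 <= t i 0] @[n --> \oo] --> joint_cdf mu t.

(* The i-th cluster has design matrix [X i], whose j-th row is X_ij^T. *)

Definition logistic (R : realType) (x : R) : R := expR x / (1 + expR x).

Definition gee_pi (R : realType) (m p : nat) (Xi : 'M[R]_(m, p))
    (beta : 'cV[R]_p) : 'cV[R]_m :=
  \col_j logistic ((Xi *m beta) j 0).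

Definition gee_var (R : realType) (m p : nat) (Xi : 'M[R]_(m, p))
    (beta : 'cV[R]_p) (j : 'I_m) : R :=
  gee_pi Xi beta j 0 * (1 - gee_pi Xi beta j 0).

(* A_i^{1/2}(beta) and A_i^{-1/2}(beta), A_i(beta) being diagonal. *)
Definition gee_Ahalf (R : realType) (m p : nat) (Xi : 'M[R]_(m, p))
    (beta : 'cV[R]_p) : 'M[R]_m :=
  diag_mx (\row_j Num.sqrt (gee_var Xi beta j)).

Definition gee_Ahalfinv (R : realType) (m p : nat) (Xi : 'M[R]_(m, p))
    (beta : 'cV[R]_p) : 'M[R]_m :=
  diag_mx (\row_j (Num.sqrt (gee_var Xi beta j))^-1).

Definition gee_S (R : realType) (n m p : nat) (X : 'I_n -> 'M[R]_(m, p))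
    (y : 'I_n -> 'cV[R]_m) (Rhat : 'M[R]_m) (beta : 'cV[R]_p) : 'cV[R]_p :=
  \sum_i (X i)^T *m gee_Ahalf (X i) beta *m invmx Rhat
         *m gee_Ahalfinv (X i) beta *m (y i - gee_pi (X i) beta).

Definition gee_M (R : realType) (n m p : nat) (X : 'I_n -> 'M[R]_(m, p))
    (R0 Rbar : 'M[R]_m) (beta : 'cV[R]_p) : 'M[R]_p :=
  \sum_i (X i)^T *m gee_Ahalf (X i) beta *m invmx Rbar *m R0 *m invmx Rbar
         *m gee_Ahalf (X i) beta *m X i.

Definition gee_H (R : realType) (n m p : nat) (X : 'I_n -> 'M[R]_(m, p))
    (Rbar : 'M[R]_m) (beta : 'cV[R]_p) : 'M[R]_p :=
  \sum_i (X i)^T *m gee_Ahalf (X i) beta *m invmx Rbar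
         *m gee_Ahalf (X i) beta *m X i.

Definition gee_Sigma (R : realType) (n m p : nat) (X : 'I_n -> 'M[R]_(m, p))
    (R0 Rbar : 'M[R]_m) (beta : 'cV[R]_p) : 'M[R]_p :=
  invmx (gee_H X Rbar beta) *m gee_M X R0 Rbar beta *m
  invmx (gee_H X Rbar beta).

(* Main.v *)
Require Import Defs.
From HB Require Import structures.
From mathcomp Require Import all_boot all_order all_algebra.
From mathcomp Require Import all_classical all_reals all_analysis.
From mathcomp Require Import measurable_realfun ring lra.
From mathcomp Require complex.
Import Order.TTheory GRing.Theory Num.Theory.
Import numFieldNormedType.Exports.
Local Open Scope classical_set_scope.
Local Open Scope ring_scope.

(** The estimating equation is linearised around the true parameter, and the
leading term is asymptotically normal because it is a sum of many small
independent terms.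

Linearisation. Write W = (L Sigma L^T)^(-1/2) L, let H and M be the matrices
with Sigma = H^-1 M H^-1, and put V = W H^-1. Then V M V^T = 1, and since M is
at least a constant times n, every row of V has squared norm O(1/n)
([studentized], [gee_M_lower]). As W = V H, the claim concerns
V H (betahat - beta0). Let a(th) = 1 / (e^(th/2) + e^(-th/2)) be the standard
deviation of a logistic response and r(th, y) = (y - pi(th)) / a(th) its Pearson
residual ([binsd], [pearson]). The score is the sum over i, j, k of
x_ij a(th_ij) (Rhat^-1)_jk r(th_ik, y_ik). Expanding a * r to second order at
beta0 and replacing Rhat by Rbar turns the equation S(betahat) = 0 into
V S(beta0) = V H (betahat - beta0) plus errors of two kinds
([linearization]): sums of centred independent variables multiplied by an
estimation error, which are controlled by their second moments ([noise_mean]),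
and the quadratic Taylor remainder, which is controlled by the Gram matrix of
the covariates. All of them are O(sqrt (p^3 / n)) ([remainder_le]).

Central limit theorem. The responses are binary, so the expectation of a
function of them is a finite sum against a product weight ([pexp],
[allbits_pred]). Let W now be a sum of small independent centred vectors with
total covariance 1, and Phi the distribution function of N(0, 1). For real u put
z_a(u) = tau_a cosh u - sinh u W_a and F(u) = E prod_a Phi(z_a(u)). Then F(0) is
prod_a Phi(tau_a), the distribution function of N(0, I) at tau
([joint_cdf_std_normal]), whereas for large u the product is close to the
indicator of the event that W_a <= tau_a for all a. Because Phi'' = - id * Phi',
the derivative of F is exactly the defect of Stein's identity
E W_a g(W) = E d_a g(W), and a leave-one-out expansion bounds that defect by the
size of the largest summand ([stein_bound], [smooth_clt], [cdf_clt]).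

For a fixed sample size [gee_cdf_bound] puts the two parts together on an event
of probability close to 1; the theorem lets n tend to infinity. *)

Set Implicit Arguments.
Unset Strict Implicit.
Unset Printing Implicit Defensive.

(** * Real symmetric matrices *)

Section Spectral.
Import complex.
Variable R : realType.
Local Notation C := (complex R).
Local Notation toC := (real_complex R).
Local Open Scope sesquilinear_scope.

Lemma poly_interpolation (F : fieldType) (s : seq F) (f : F -> F) :
  exists q : {poly F}, {in s, forall x, q.[x] = f x}.
Proof.
elim: s => [|x s [q hq]]; first by exists 0.
have [xs|xs] := boolP (x \in s).
  by exists q => y; rewrite in_cons => /predU1P[->|]; exact: hq.
pose w : {poly F} := \prod_(z <- s) ('X - z%:P).
have wx : w.[x] != 0 by rewrite -/(root w x) root_prod_XsubC.
exists (q + ((f x - q.[x]) / w.[x]) *: w) => y.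
rewrite in_cons hornerD hornerZ => /predU1P[->|ys].
  by rewrite divfK// addrC subrK.
have /rootP -> : root w y by rewrite root_prod_XsubC.
by rewrite mulr0 addr0 hq.
Qed.

(** Spectral calculus of a real symmetric matrix, read off from its unitary
diagonalisation over R[i]: [w v i] is the squared modulus of the i-th coordinate
of [v] in the eigenbasis. Only polynomials in [A] appear, because they keep real
entries whereas the diagonalising matrix need not be real. *)
Lemma symmetric_spectral k (A : 'M[R]_k.+1) : A^T = A ->
  exists (mu : 'I_k.+1 -> R) (w : 'cV[R]_k.+1 -> 'I_k.+1 -> R),
  [/\ forall i, eigenvalue A (mu i),
      forall v i, 0 <= w v i,
      forall (q : {poly R}) v,
        (v^T *m horner_mx A q *m v) 0 0 = \sum_i q.[mu i] * w v i &
      forall q1 q2 : {poly R}, (forall i, q1.[mu i] = q2.[mu i]) ->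
        horner_mx A q1 = horner_mx A q2].
Proof.
move=> As; pose Ac := map_mx toC A.
have Acreal : Ac \is a mxOver Num.real.
  by apply/mxOverP => i j; rewrite !mxE; apply/complex_realP; exists (A i j).
have Acsym : Ac \is symmetricmx.
  apply/is_hermitianmxP; rewrite expr0 scale1r map_mx_id //; by rewrite /Ac -[in LHS]As map_trmx.
have Aherm : Ac \is hermsymmx by exact: realsym_hermsym.
have AE := orthomx_spectralP (hermitian_normalmx Aherm).
have dreal := hermitian_spectral_diag_real Aherm.
set U := spectralmx Ac in AE; set d := spectral_diag Ac in AE dreal.
have Uu : U \is unitarymx by exact: spectral_unitarymx.
have Uunit : U \in unitmx by exact: unitarymx_unit.
pose mu i := complex.Re (d 0 i).
have muE i : toC (mu i) = d 0 i by apply: RRe_real; exact: (mxOverP dreal).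
pose w (v : 'cV[R]_k.+1) i := complex.Re (`|(U *m map_mx toC v) i 0| ^+ 2).
have wE v i : toC (w v i) = `|(U *m map_mx toC v) i 0| ^+ 2.
  by apply: RRe_real; rewrite realX// normr_real.
have hornerC q : map_mx toC (horner_mx A q) =
    invmx U *m diag_mx (map_mx (horner (map_poly toC q)) d) *m U.
  rewrite map_horner_mx -/Ac [in LHS]AE -horner_mx_diag.
  by rewrite -[X in _ *m _ *m X]invmxK horner_mx_uconj ?unitmx_inv // invmxK.
have evalE q i : (map_poly toC q).[d 0 i] = toC q.[mu i].
  by rewrite -muE horner_map.
exists mu, w; split.
- move=> i; rewrite -(eigenvalue_map toC) [X in eigenvalue _ X]muE; apply/eigenvalueP.
  exists (row i U).
    rewrite -/Ac AE !mulmxA -row_mul mulmxV// -row_mul mul1mx.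
    apply/rowP => j; rewrite !mxE (bigD1 i)//= big1 ?addr0.
      by rewrite !mxE eqxx mulr1n.
    by move=> l li; rewrite !mxE eq_sym (negPf li) mulr0n mul0r.
  apply: contraTneq Uunit => rU0; rewrite -row_free_unit -kermx_eq0.
  apply/negP => /eqP ker0.
  have : ((delta_mx 0 i : 'rV[C]_k.+1) <= kermx U)%MS.
    by rewrite sub_kermx -rowE rU0.
  by rewrite ker0 submx0 => /eqP/rowP/(_ i)/eqP; rewrite !mxE !eqxx oner_eq0.
- by move=> v i; rewrite -ler0c wE exprn_ge0.
- move=> q v; apply: (@complexI R).
  transitivity ((map_mx toC (v^T *m horner_mx A q *m v)) 0 0); first by rewrite [RHS]mxE.
  rewrite !map_mxM hornerC invmx_unitary // -[map_mx _ v^T]map_trmx.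
  set z := map_mx toC v.
  have zE : z^T *m U^t* = (U *m z)^t*.
    rewrite trmx_mul map_mxM; congr (_ *m _).
    by apply/matrixP => i j; rewrite !mxE; apply/esym; exact: conjc_real.
  rewrite !mulmxA zE -!mulmxA mxE rmorph_sum; apply: eq_bigr => i _.
  rewrite rmorphM /= wE normCK mul_diag_mx !mxE evalE.
  by rewrite mulrCA [X in _ * X = _]mulrC.
- move=> q1 q2 q12; apply: (map_mx_inj (f := toC)); rewrite !hornerC.
  suff -> : map_mx (horner (map_poly toC q1)) d = map_mx (horner (map_poly toC q2)) d by [].
  by apply/rowP => i; rewrite !mxE !evalE q12.
Qed.

(** [inf] and [sup] return a default value on unbounded sets, so [lambda_min] and
[lambda_max] compare with the eigenvalues only once the spectrum is known to be
bounded. *)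
Lemma symmetric_eigenvalues_bounded k (A : 'M[R]_k.+1) : A^T = A ->
  has_lbound [set a | eigenvalue A a] /\ has_ubound [set a | eigenvalue A a].
Proof.
move=> As; have [mu [w [_ w0 horner_w _]]] := symmetric_spectral As.
suff bnd a : eigenvalue A a -> `|a| <= \sum_i `|mu i|.
  split.
    exists (- \sum_i `|mu i|) => a /= /bnd; exact: lerNnormlW.
  by exists (\sum_i `|mu i|) => a /= /bnd; apply: le_trans; exact: ler_norm.
case/eigenvalueP => u uA u0.
have := horner_w 1 u^T; rewrite rmorph1 mulmx1 trmxK.
have := horner_w 'X u^T; rewrite horner_mx_X trmxK uA -scalemxAl mxE.
have u2 : 0 < (u *m u^T) 0 0.
  have [j uj] := rV0Pn _ u0.
  rewrite mxE (bigD1 j)//= ltr_wpDr//.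
    by apply: sumr_ge0 => i _; rewrite mxE -expr2 sqr_ge0.
  by rewrite mxE -expr2 exprn_even_gt0.
move=> au uE; rewrite -(ler_pM2r u2) -{1}(gtr0_norm u2) -normrM au uE.
rewrite (le_trans (ler_norm_sum _ _ _))// mulr_sumr; apply: ler_sum => i _.
rewrite hornerX hornerC mul1r normrM (ger0_norm (w0 _ _)) ler_wpM2r//.
by rewrite (bigD1 i)//= lerDl sumr_ge0.
Qed.

Lemma lambda_min_le k (A : 'M[R]_k) (v : 'cV[R]_k) : A^T = A ->
  lambda_min A * \sum_i v i 0 ^+ 2 <= (v^T *m A *m v) 0 0.
Proof.
case: k A v => [|k] A v As.
  by rewrite big_ord0 mulr0 mxE big_ord0.
have [mu [w [mu_eig w0 horner_w _]]] := symmetric_spectral As.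
have := horner_w 1 v; rewrite rmorph1 mulmx1.
have := horner_w 'X v; rewrite horner_mx_X => -> vv.
have -> : \sum_i v i 0 ^+ 2 = (v^T *m v) 0 0.
  by rewrite mxE; apply: eq_bigr => i _; rewrite mxE expr2.
rewrite vv mulr_sumr; apply: ler_sum => i _; rewrite hornerC hornerX mul1r.
by rewrite ler_wpM2r//; apply: ge_inf; [case: (symmetric_eigenvalues_bounded As)|exact: mu_eig].
Qed.

Lemma le_lambda_max k (A : 'M[R]_k) (v : 'cV[R]_k) : A^T = A ->
  (v^T *m A *m v) 0 0 <= lambda_max A * \sum_i v i 0 ^+ 2.
Proof.
case: k A v => [|k] A v As.
  by rewrite big_ord0 mulr0 mxE big_ord0.
have [mu [w [mu_eig w0 horner_w _]]] := symmetric_spectral As.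
have := horner_w 1 v; rewrite rmorph1 mulmx1.
have := horner_w 'X v; rewrite horner_mx_X => -> vv.
have -> : \sum_i v i 0 ^+ 2 = (v^T *m v) 0 0.
  by rewrite mxE; apply: eq_bigr => i _; rewrite mxE expr2.
rewrite vv mulr_sumr; apply: ler_sum => i _; rewrite hornerC hornerX mul1r.
by rewrite ler_wpM2r//; apply: ub_le_sup; [case: (symmetric_eigenvalues_bounded As)|exact: mu_eig].
Qed.

(** The root is a polynomial in [A] that interpolates the square root on the
spectrum: as a real polynomial in [A] it is real and symmetric. *)
Lemma sqrtmx_exists k (A : 'M[R]_k) : possemidef A ->
  exists B : 'M[R]_k, possemidef B /\ B *m B = A.
Proof.
case: k A => [|k] A [As A0].
  exists 0; split; last by apply/matrixP => -[].
  by split=> [|v]; rewrite ?trmx0// mulmx0 mul0mx mxE.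
have [mu [w [mu_eig w0 horner_w horner_eq]]] := symmetric_spectral As.
have [q hq] := poly_interpolation [seq mu i | i <- enum 'I_k.+1] Num.sqrt.
have qE i : q.[mu i] = Num.sqrt (mu i).
  by apply: hq; apply: map_f; rewrite mem_enum.
have mu0 i : 0 <= mu i.
  have /eigenvalueP [u uA u0] := mu_eig i.
  have := A0 u^T; rewrite trmxK uA -scalemxAl mxE.
  rewrite pmulr_lge0//.
  have [j uj] := rV0Pn _ u0.
  rewrite mxE (bigD1 j)//= ltr_wpDr//.
    by apply: sumr_ge0 => l _; rewrite mxE -expr2 sqr_ge0.
  by rewrite mxE -expr2 exprn_even_gt0.
exists (horner_mx A q); split; [split|].
- have trH : forall r : {poly R}, (horner_mx A r)^T = horner_mx A r.
    elim/poly_ind => [|r c ih]; first by rewrite rmorph0 trmx0.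
    rewrite rmorphD rmorphM /= horner_mx_X horner_mx_C.
    rewrite linearD /= trmx_mul ih As tr_scalar_mx; congr (_ + _).
    exact: comm_mx_horner.
  exact: trH.
- by move=> v; rewrite horner_w sumr_ge0// => i _; rewrite mulr_ge0// qE sqrtr_ge0.
- rewrite -[_ *m _]/(_ * _) -rmorphM /= -[RHS]horner_mx_X; apply: horner_eq => i.
  by rewrite hornerM hornerX qE -expr2 sqr_sqrtr.
Qed.

Lemma sqrtmxP k (A : 'M[R]_k) : possemidef A ->
  possemidef (sqrtmx A) /\ sqrtmx A *m sqrtmx A = A.
Proof.
move=> /sqrtmx_exists[B BP]; rewrite /sqrtmx.
by case: xgetP => [D _ DP//|/(_ B)]; case.
Qed.
End Spectral.

(** * Finite product laws *)

Section ProductExpectation.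
Variables (R : realType) (I S : finType) (q : I -> S -> R).
Hypotheses (q_ge0 : forall i s, 0 <= q i s) (q_sum1 : forall i, \sum_s q i s = 1).

(** The expectation of [f] under the product of the laws [q i]. *)
Definition pexp (f : {ffun I -> S} -> R) : R :=
  \sum_(y : {ffun I -> S}) (\prod_i q i (y i)) * f y.

Definition resample (y : {ffun I -> S}) i s : {ffun I -> S} :=
  [ffun j => if j == i then s else y j].

Lemma pexpZ c f : pexp (fun y => c * f y) = c * pexp f.
Proof. by rewrite /pexp mulr_sumr; apply: eq_bigr => y _; rewrite mulrCA. Qed.

Lemma pexpD f g : pexp (fun y => f y + g y) = pexp f + pexp g.
Proof. by rewrite /pexp -big_split; apply: eq_bigr => y _; rewrite mulrDr. Qed.

Lemma pexpB f g : pexp (fun y => f y - g y) = pexp f - pexp g.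
Proof. by rewrite /pexp -sumrB; apply: eq_bigr => y _; rewrite mulrBr. Qed.

Lemma pexp_sum (J : Type) (r : seq J) (Q : pred J) (f : J -> {ffun I -> S} -> R) :
  pexp (fun y => \sum_(j <- r | Q j) f j y) = \sum_(j <- r | Q j) pexp (f j).
Proof. by rewrite /pexp exchange_big; apply: eq_bigr => y _; rewrite mulr_sumr. Qed.

Lemma eq_pexp f g : f =1 g -> pexp f = pexp g.
Proof. by move=> fg; apply: eq_bigr => y _; rewrite fg. Qed.

Lemma pexp_cst c : pexp (fun=> c) = c.
Proof.
rewrite /pexp -mulr_suml -(bigA_distr_bigA q).
by rewrite big1 ?mul1r.
Qed.

Lemma le_pexp f g : (forall y, f y <= g y) -> pexp f <= pexp g.
Proof.
move=> fg; apply: ler_sum => y _; rewrite ler_wpM2l// prodr_ge0//.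
Qed.

Lemma ler_norm_pexp f : `|pexp f| <= pexp (fun y => `|f y|).
Proof.
rewrite ler_norml -mulN1r -pexpZ !le_pexp// => y; rewrite ?mulN1r ?ler_norm//.
by rewrite lerNl -normrN ler_norm.
Qed.

(** Redrawing coordinate [i] independently does not change the product law. This
is the form in which independence is used below. *)
Lemma pexp_resample i f :
  pexp f = pexp (fun y => \sum_s q i s * f (resample y i s)).
Proof.
pose wt (y : {ffun I -> S}) := \prod_j q j (y j).
pose swap (p : {ffun I -> S} * S) := (resample p.1 i p.2, p.1 i).
have swapK : involutive swap.
  move=> [y s]; rewrite /swap /= ffunE eqxx; congr (_, _).
  by apply/ffunP => j; rewrite !ffunE; case: eqP => [->|].
have wt_swap y s : wt y * q i s = wt (resample y i s) * q i (y i).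
  rewrite /wt (bigD1 i)//= [in RHS](bigD1 i)//= ffunE eqxx.
  rewrite mulrAC [RHS]mulrAC [q i (y i) * _]mulrC; congr (_ * _).
  by apply: eq_bigr => j /negPf ji; rewrite ffunE ji.
transitivity (\sum_(p : {ffun I -> S} * S) wt p.1 * q i p.2 * f p.1).
  rewrite -(pair_bigA _ (fun y s => wt y * q i s * f y)) /=.
  by apply: eq_bigr => y _; rewrite -mulr_suml -mulr_sumr q_sum1 mulr1.
rewrite (reindex_inj (inv_inj swapK)) /= -(pair_bigA _
  (fun y s => wt (resample y i s) * q i (y i) * f (resample y i s))) /=.
apply: eq_bigr => y _; rewrite mulr_sumr; apply: eq_bigr => s _.
by rewrite -wt_swap mulrA.
Qed.

Lemma pexp_centered_mul i (phi : S -> R) g :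
    \sum_s q i s * phi s = 0 -> (forall y s, g (resample y i s) = g y) ->
  pexp (fun y => phi (y i) * g y) = 0.
Proof.
move=> phi0 gi; rewrite (pexp_resample i) -[RHS](pexp_cst 0); apply: eq_pexp => y.
under eq_bigr do rewrite ffunE eqxx gi mulrA.
by rewrite -mulr_suml phi0 mul0r.
Qed.

(** The cross terms vanish, as the summands are centred and independent. *)
Lemma pexp_sqr_sum (phi : I -> S -> R) (kappa : I -> R) (b : R) :
    (forall i, \sum_s q i s * phi i s = 0) -> (forall i s, phi i s ^+ 2 <= b) ->
  pexp (fun y => (\sum_i phi i (y i) * kappa i) ^+ 2) <= b * \sum_i kappa i ^+ 2.
Proof.
move=> phi0 phib.
under eq_pexp do rewrite expr2 mulr_sumr.
rewrite pexp_sum mulr_sumr; apply: ler_sum => i _.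
under eq_pexp do rewrite (bigD1 i)//= mulrDl.
rewrite pexpD [X in _ + X](_ : _ = 0) ?addr0; last first.
  under eq_pexp do rewrite mulrC -mulrA.
  apply: (@pexp_centered_mul i (phi i)) => // y s; congr (_ * _).
  by apply: eq_bigr => j /negPf ji; rewrite ffunE ji.
rewrite -[leRHS]pexp_cst; apply: le_pexp => y.
by rewrite -expr2 exprMn ler_wpM2r// sqr_ge0.
Qed.

Lemma pexp_markov (f : {ffun I -> S} -> R) (c : R) : 0 < c -> (forall y, 0 <= f y) ->
  pexp (fun y => (c < f y)%R%:R) <= pexp f / c.
Proof.
move=> c0 f0; rewrite ler_pdivlMr// mulrC -pexpZ; apply: le_pexp => y.
by case: ltP => [/ltW|]; rewrite ?mulr1 ?mulr0.
Qed.

End ProductExpectation.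

(** * The standard normal distribution function *)

Section NormalCdf.
Variable R : realType.
Local Notation mu := (@lebesgue_measure R).
Local Notation npdf := (@normal_pdf R 0 1).

Definition ncdf (x : R) : R := fine (normal_prob (0 : R) 1 [set` `]-oo, x]]).

Lemma ncdfE x : (ncdf x)%:E = normal_prob (0 : R) 1 [set` `]-oo, x]].
Proof. by rewrite /ncdf fineK// fin_num_measure//. Qed.

Lemma npdfE (x : R) : npdf x = normal_peak 1 * expR (- x ^+ 2 / 2).
Proof.
by rewrite /normal_pdf oner_eq0 /normal_fun subr0 expr1n.
Qed.

Lemma ncdf_ge0 x : 0 <= ncdf x. Proof. exact: fine_ge0. Qed.

Lemma ncdf_le1 x : ncdf x <= 1.
Proof. by rewrite -lee_fin ncdfE probability_le1. Qed.

Lemma ncdf_le x y : x <= y -> ncdf x <= ncdf y.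
Proof.
move=> xy; rewrite -lee_fin !ncdfE le_measure ?inE//.
exact: subitvPr.
Qed.

Lemma is_derive_ncdf (x : R) : is_derive x 1 ncdf (npdf x).
Proof.
have [] := @continuous_FTC1 R npdf -oo%O x (x + 1).
- by rewrite ltrDl.
- exact: integrableS (integrable_normal_pdf 0 1).
- by rewrite ltNyr.
- exact: continuous_normal_pdf.
rewrite derive1E => dF F'; exact: DeriveDef.
Qed.

Lemma is_derive_npdf (x : R) : is_derive x 1 npdf (- x * npdf x).
Proof.
have [c c2] : exists c : R, c = 2^-1 by exists 2^-1.
have -> : npdf = fun x => normal_peak 1 * expR (- c * x ^+ 2).
  by apply/funext => y; rewrite npdfE c2; congr (_ * expR _); field.
apply: is_derive_eq; rewrite /GRing.scale /= c2; by field.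
Qed.

Lemma ncdf_tails (e : R) : 0 < e ->
  exists2 x : R, 0 < x & forall y : R, x <= y -> ncdf (- y) <= e /\ 1 - e <= ncdf y.
Proof.
move=> e0; pose P := normal_prob (0 : R) 1.
have up : P [set` `]-oo, n%:R]] @[n --> \oo] --> 1%E.
  rewrite -(probability_setT P).
  have <- : \bigcup_n [set` `]-oo, (n%:R : R)]] = setT.
    rewrite -subTset => t _; exists (Num.truncn t).+1 => //=.
    by rewrite in_itv/= ltW// truncnS_gt.
  apply: nondecreasing_cvg_mu => //; first exact: bigcup_measurable.
  move=> n k nk; apply/subsetPset => x/=; rewrite !in_itv/= => /le_trans.
  by apply; rewrite ler_nat.
have down : P [set` `]-oo, (- n%:R)%R]] @[n --> \oo] --> 0%E.
  rewrite -(measure0 P).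
  have <- : \bigcap_n [set` `]-oo, (- n%:R : R)]] = set0.
    rewrite -subset0 => t /(_ (Num.bound `|t|) I).
    rewrite /= in_itv/= leNgt => /negP; apply; rewrite ltrNl.
    by rewrite (le_lt_trans _ (archi_boundP (normr_ge0 t)))// -normrN ler_norm.
  apply: nonincreasing_cvg_mu => //=.
  - by rewrite (le_lt_trans (probability_le1 _ _)) ?ltry.
  - exact: bigcap_measurable.
  - move=> m n mn; apply/subsetPset => x/=; rewrite !in_itv => /le_trans; apply.
    by rewrite lerN2 ler_nat.
have /fine_cvgP[_ /cvgrPdist_le/(_ _ e0) [N1 _ H1]] := up.
have /fine_cvgP[_ /cvgrPdist_le/(_ _ e0) [N2 _ H2]] := down.
pose N := (maxn N1 N2).+1.
have /H1/= h1 : (N1 <= N)%N by rewrite leqW// leq_maxl.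
have /H2/= h2 : (N2 <= N)%N by rewrite leqW// leq_maxr.
exists N%:R; rewrite ?ltr0n// => y Ny; split.
  apply: (@le_trans _ _ (ncdf (- N%:R))); first by rewrite ncdf_le// lerN2.
  move: h2; rewrite sub0r normrN ger0_norm//; exact: ncdf_ge0.
apply: (@le_trans _ _ (ncdf N%:R)); last exact: ncdf_le.
by move: h1; rewrite ler_norml => /andP[_]; rewrite lerBlDl -lerBlDr.
Qed.

(** The recursive product structure of [std_normal] makes its distribution
function a product; the normal law enters the proof only through it. *)
Lemma joint_cdf_std_normal l (t : 'cV[R]_l) :
  joint_cdf (std_normal R l) t = (\prod_i ncdf (t i 0))%:E.
Proof.
rewrite /joint_cdf; elim: l t => [|l ih] t.
  rewrite big_ord0 /= diracE.
  by rewrite mem_set// => -[].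
rewrite /= /pushforward big_ord_recl EFinM ncdfE.
have -> : @cons_pair R l @^-1` [set y | forall i, tnth y i <= t i 0] =
    [set` `]-oo, t ord0 0]] `*` [set y | forall i, tnth y i <= (\col_i t (lift ord0 i) 0) i 0].
  apply/seteqP; split => -[x y] /=.
    move=> h; split; first by rewrite in_itv /=; have := h ord0.
    by move=> i; have := h (lift ord0 i); rewrite mxE tnthS.
  move=> [h0 h] i; have [j ->|->] := unliftP ord0 i.
    by have := h j; rewrite mxE tnthS.
  by move: h0; rewrite in_itv.
rewrite product_measure1E//.
  congr (_ * _)%E; apply: etrans (ih _) _; congr (_%:E).
  by apply: eq_bigr => i _; rewrite mxE.
have -> : [set y : l.-tuple R | forall i, tnth y i <= (\col_i t (lift ord0 i) 0) i 0] =
   \bigcap_(i in [set: 'I_l]) ((@tnth l R)^~ i @^-1` [set` `]-oo, t (lift ord0 i) 0]]).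
  apply/seteqP; split => y /= h i; have := h i; rewrite mxE /= in_itv//=.
  exact.
apply: fin_bigcap_measurable => // i _.
rewrite -[X in measurable X]setTI.
exact: measurable_tnth.
Qed.
End NormalCdf.

(** * Taylor bounds *)

Section SecondOrder.
Variable R : realType.

Lemma mean_value_bound (f f1 : R -> R) (K x d : R) :
    (forall y : R, is_derive y 1 f (f1 y)) -> 
    (forall y, `|y - x| <= `|d| -> `|f1 y| <= K) ->
  `|f (x + d) - f x| <= K * `|d|.
Proof.
move=> df f1K.
have cf : forall a b, {within `[a, b], continuous f}.
  move=> a b; apply: continuous_subspaceT => y.
  by apply: differentiable_continuous; apply/derivable1_diffP; exact: ex_derive.
have [d0|d0] := leP 0 d.
  have [|c] := @MVT_segment R f f1 x (x + d) _ (fun y _ => df y) (cf _ _).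
    by rewrite lerDl.
  rewrite in_itv /= => /andP[c1 c2] ->.
  rewrite [x + d - x](_ : _ = d) ?normrM ?ler_wpM2r//; last by ring.
  by apply: f1K; rewrite (ger0_norm d0) ler_norml; apply/andP; split; lra.
have [|c] := @MVT_segment R f f1 (x + d) x _ (fun y _ => df y) (cf _ _).
  by rewrite gerDl ltW.
rewrite in_itv /= => /andP[c1 c2] E.
rewrite distrC E [x - (x + d)](_ : _ = - d) ?normrM ?normrN ?ler_wpM2r//; last by ring.
by apply: f1K; rewrite (ltr0_norm d0) ler_norml; apply/andP; split; lra.
Qed.

Lemma taylor_bound (f f1 : R -> R) (K x d : R) :
    (forall y : R, is_derive y 1 f (f1 y)) ->
    (forall y, `|y - x| <= `|d| -> `|f1 y - f1 x| <= K * `|y - x|) -> 0 <= K ->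
  `|f (x + d) - f x - d * f1 x| <= K * d ^+ 2.
Proof.
move=> df f1K K0.
have dg (y : R) : is_derive y 1 (fun y => f y - y * f1 x) (f1 y - f1 x).
  have := df y => dfy; apply: is_derive_eq.
  by rewrite /GRing.scale /= mulr0 add0r mulr1.
have := @mean_value_bound _ _ (K * `|d|) x d dg.
rewrite -real_normK ?num_real// expr2 mulrA.
have -> : f (x + d) - (x + d) * f1 x - (f x - x * f1 x) = f (x + d) - f x - d * f1 x.
  ring.
by apply=> y yd; rewrite (le_trans (f1K y yd))// ler_wpM2l.
Qed.

(** What remains of two bounded derivatives of [f]. In this form the property
passes to products over finitely many coordinates, see [prod_taylor]. *)
Definition taylor2 (K : R) (f f1 : R -> R) :=
  [/\ forall x, `|f x| <= K, forall x, `|f1 x| <= K,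
      forall x d, `|f (x + d) - f x| <= K * `|d|,
      forall x d, `|f1 (x + d) - f1 x| <= K * `|d| &
      forall x d, `|f (x + d) - f x - d * f1 x| <= K * d ^+ 2].

Lemma taylor2_derive (f f1 f2 : R -> R) (K : R) :
    (forall y : R, is_derive y 1 f (f1 y)) -> (forall y : R, is_derive y 1 f1 (f2 y)) ->
    (forall x, `|f x| <= K) -> (forall x, `|f1 x| <= K) -> (forall x, `|f2 x| <= K) ->
  taylor2 K f f1.
Proof.
move=> df df1 fK f1K f2K; split => //.
- by move=> x d; apply: mean_value_bound => // y _; exact: f1K.
- by move=> x d; apply: mean_value_bound => // y _; exact: f2K.
- move=> x d; apply: taylor_bound => //; last by rewrite (le_trans _ (fK 0)).
  move=> y _; rewrite [f1 y](_ : _ = f1 (x + (y - x))); last by rewrite addrC subrK.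
  by apply: mean_value_bound => // z _; exact: f2K.
Qed.

Lemma taylor2_affine (f f1 : R -> R) (K b t r : R) :
    0 <= K -> 1 <= b -> `|r| <= b -> taylor2 K f f1 ->
  taylor2 (K * b ^+ 2) (fun x => f (t - r * x)) (fun x => - r * f1 (t - r * x)).
Proof.
move=> K0 b1 rb [fK f1K fL f1L fT].
have b0 : 0 <= b by rewrite (le_trans _ b1).
have bb : b <= b ^+ 2 by rewrite expr2 ler_peMr.
have b21 : 1 <= b ^+ 2 by rewrite (le_trans b1).
have shift x d : t - r * (x + d) = t - r * x + - (r * d) by ring.
split.
- by move=> x; rewrite (le_trans (fK _))// ler_peMr.
- move=> x; rewrite normrM normrN mulrC ler_pM// (le_trans rb)//.
- move=> x d; rewrite shift (le_trans (fL _ _))// -mulrA ler_wpM2l//.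
  by rewrite normrN normrM ler_wpM2r// (le_trans rb).
- move=> x d; rewrite shift -mulrBr normrM normrN.
  rewrite (le_trans (ler_wpM2l _ (f1L _ _)))// normrN normrM.
  rewrite [leLHS](_ : _ = (`|r| * `|r|) * (K * `|d|)); last by ring.
  rewrite [leRHS](_ : _ = (b * b) * (K * `|d|)); last by ring.
  by rewrite ler_wpM2r ?mulr_ge0// ler_pM.
- move=> x d; rewrite shift.
  have -> : d * (- r * f1 (t - r * x)) = - (r * d) * f1 (t - r * x) by ring.
  rewrite (le_trans (fT _ _))// sqrrN exprMn mulrA ler_wpM2r ?sqr_ge0//.
  rewrite ler_wpM2l// -[r ^+ 2]real_normK ?num_real//.
  by rewrite ler_sqr ?nnegrE.
Qed.

(** The first three derivatives of the normal distribution function are the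
density times a polynomial of degree at most 2, hence bounded. *)
Lemma npdf_taylor2 : exists2 K : R, 1 <= K &
  taylor2 K (@ncdf R) (normal_pdf 0 1) /\
  taylor2 K (normal_pdf 0 1) (fun x => - x * normal_pdf (0 : R) 1 x).
Proof.
pose c : R := normal_peak 1.
have c0 : 0 <= c by exact: normal_peak_ge0.
have e0 (x : R) : 0 <= expR (- x ^+ 2 / 2) by exact: expR_ge0.
have x2 (x : R) : x ^+ 2 * expR (- x ^+ 2 / 2) <= 2.
  have := expR_ge1Dx (x ^+ 2 / 2).
  rewrite mulNr expRN; have := expR_gt0 (x ^+ 2 / 2).
  move: (expR _) => e ep he; rewrite ler_pdivrMr//; lra.
have e1 (x : R) : expR (- x ^+ 2 / 2) <= 1.
  by rewrite expR_le1 mulNr oppr_le0 divr_ge0 ?sqr_ge0.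
have x1 (x : R) : `|x| * expR (- x ^+ 2 / 2) <= 2.
  have := mulr_ge0 (e0 x) (sqr_ge0 (`|x| - 1)).
  have := x2 x; rewrite -{1}[x ^+ 2]real_normK ?num_real//.
  have := e1 x; have := e0 x; nra.
exists (1 + 3 * c); first by rewrite lerDl mulr_ge0.
have d0 y : `|normal_pdf (0:R) 1 y| <= 1 + 3 * c.
  rewrite npdfE -/c normrM ger0_norm// (ger0_norm (e0 y)).
  by have := ler_wpM2l c0 (e1 y); lra.
have d1 y : `|- y * normal_pdf (0:R) 1 y| <= 1 + 3 * c.
  rewrite npdfE -/c !normrM normrN (ger0_norm c0) (ger0_norm (e0 y)) mulrCA.
  by have := ler_wpM2l c0 (x1 y); lra.
have d2 (y : R) : `|(y ^+ 2 - 1) * normal_pdf (0 : R) 1 y| <= 1 + 3 * c.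
  rewrite npdfE -/c mulrCA normrM (ger0_norm c0) mulrBl mul1r.
  have : `|y ^+ 2 * expR (- y ^+ 2 / 2) - expR (- y ^+ 2 / 2)| <= 3.
    rewrite (le_trans (ler_normB _ _))// (ger0_norm (e0 y)).
    rewrite (ger0_norm (mulr_ge0 (sqr_ge0 y) (e0 y))).
    by have := x2 y; have := e1 y; lra.
  by move/(ler_wpM2l c0); lra.
have D2 (y : R) : is_derive y 1 (fun x => - x * normal_pdf (0 : R) 1 x)
    ((y ^+ 2 - 1) * normal_pdf (0 : R) 1 y).
  have := is_derive_npdf y => dn; apply: is_derive_eq.
  by rewrite /GRing.scale /=; ring.
split.
  apply: (taylor2_derive (@is_derive_ncdf R) (@is_derive_npdf R) _ d0 d1) => x.
  by rewrite ger0_norm ?ncdf_ge0// (le_trans (ncdf_le1 _))// lerDl mulr_ge0.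
exact: (taylor2_derive (@is_derive_npdf R) D2 d0 d1 d2).
Qed.

End SecondOrder.

Section ProductTaylor.
Variables (R : realType) (J : eqType).

Lemma ler_norm_prod (r : seq J) (u : J -> R) (K : R) :
  (forall b, `|u b| <= K) -> `|\prod_(b <- r) u b| <= K ^+ size r.
Proof.
move=> uK; elim: r => [|b r ih]; first by rewrite big_nil normr1.
by rewrite big_cons normrM exprS ler_pM.
Qed.

Lemma prod_lipschitz (r : seq J) (u v : J -> R) (K del : R) :
    1 <= K -> 0 <= del -> (forall b, `|u b| <= K) -> (forall b, `|v b| <= K) ->
    (forall b, `|u b - v b| <= K * del) ->
  `|\prod_(b <- r) u b - \prod_(b <- r) v b| <= (size r)%:R * K ^+ size r * del.
Proof.
move=> K1 del0 uK vK uv; have K0 : 0 <= K by rewrite (le_trans _ K1).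
elim: r => [|b r ih]; first by rewrite !big_nil subrr normr0 !mul0r.
rewrite !big_cons.
set U := \prod_(b <- r) u b; set V := \prod_(b <- r) v b.
have -> : u b * U - v b * V = (u b - v b) * U + v b * (U - V) by ring.
rewrite (le_trans (ler_normD _ _))// !normrM /=.
have h1 : `|u b - v b| * `|U| <= K * del * K ^+ size r.
  by rewrite ler_pM// ler_norm_prod.
have h2 : `|v b| * `|U - V| <= K * ((size r)%:R * K ^+ size r * del).
  by rewrite ler_pM.
rewrite (le_trans (lerD h1 h2))// -natr1 [K ^+ _.+1]exprSr.
by rewrite le_eqVlt; apply/orP; left; apply/eqP; ring.
Qed.

(** With [u] the perturbed factors, [v] the original ones and [e] the linear parts
of the increments, splitting off one factor [u b] leaves the error
(u b - v b) (U - V) + (u b - v b - e b) V + v b (U - V - E), where U, V, E belong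
to the remaining factors. The first of these terms is of second order by
[prod_lipschitz] and grows with the number of factors, which gives the square of
[size r]. *)
Lemma prod_taylor (r : seq J) (u v e : J -> R) (K del : R) :
    uniq r -> 1 <= K -> 0 <= del ->
    (forall b, `|u b| <= K) -> (forall b, `|v b| <= K) ->
    (forall b, `|u b - v b| <= K * del) ->
    (forall b, `|u b - v b - e b| <= K * del ^+ 2) ->
  `|\prod_(b <- r) u b - \prod_(b <- r) v b
    - \sum_(c <- r) \prod_(b <- r) (if b == c then e b else v b)|
  <= (size r)%:R ^+ 2 * K ^+ size r * del ^+ 2.
Proof.
move=> + K1 del0 uK vK uv uve; have K0 : 0 <= K by rewrite (le_trans _ K1).
elim: r => [|b r ih].
  by rewrite !big_nil subrr subr0 normr0 expr2 !mul0r.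
rewrite cons_uniq => /andP[br ur]; have {}ih := ih ur.
rewrite !big_cons eqxx.
set U := \prod_(b <- r) u b; set V := \prod_(b <- r) v b.
have -> : \prod_(j <- r) (if j == b then e j else v j) = V.
  by apply: eq_big_seq => j jr; case: eqP jr br => // -> ->.
have -> : \sum_(j <- r) \prod_(b0 <- b :: r) (if b0 == j then e b0 else v b0) =
    v b * \sum_(j <- r) \prod_(b0 <- r) (if b0 == j then e b0 else v b0).
  rewrite mulr_sumr; apply: eq_big_seq => j jr; rewrite big_cons.
  by case: eqP jr br => // -> ->.
move: ih; set E := \sum_(j <- r) _ => ih.
have -> : u b * U - v b * V - (e b * V + v b * E) =
  (u b - v b) * (U - V) + (u b - v b - e b) * V + v b * (U - V - E) by ring.
rewrite (le_trans (ler_normD _ _))//.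
have h0 := ler_normD ((u b - v b) * (U - V)) ((u b - v b - e b) * V).
rewrite !normrM in h0 *.
have h1 : `|u b - v b| * `|U - V| <= (K * del) * ((size r)%:R * K ^+ size r * del).
  by rewrite ler_pM// prod_lipschitz.
have h2 : `|u b - v b - e b| * `|V| <= (K * del ^+ 2) * K ^+ size r.
  by rewrite ler_pM// ler_norm_prod.
have h3 : `|v b| * `|U - V - E| <= K * ((size r)%:R ^+ 2 * K ^+ size r * del ^+ 2).
  by rewrite ler_pM.
apply: le_trans (lerD (le_trans h0 (lerD h1 h2)) h3) _.
rewrite /= -natr1 [K ^+ _.+1]exprSr.
rewrite -subr_ge0.
set s : R := (size r)%:R; set k := K ^+ size r.
have -> : (s + 1) ^+ 2 * (k * K) * del ^+ 2 -
  (K * del * (s * k * del) + K * del ^+ 2 * k + K * (s ^+ 2 * k * del ^+ 2)) =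
  s * (k * K) * del ^+ 2 by ring.
by rewrite !mulr_ge0 ?sqr_ge0// exprn_ge0.
Qed.

Lemma is_derive_prod (r : seq J) (f : J -> R -> R) (df : J -> R) (x : R) :
    uniq r -> (forall b, is_derive x 1 (f b) (df b)) ->
  is_derive x 1 (fun y => \prod_(b <- r) f b y)
    (\sum_(c <- r) \prod_(b <- r) (if b == c then df b else f b x)).
Proof.
move=> + dfb; elim: r => [|b r ih].
  move=> _; rewrite big_nil.
  have -> : (fun y => \prod_(b <- [::]) f b y) = cst 1 by apply/funext => y; rewrite big_nil.
  exact: is_derive_cst.
rewrite cons_uniq => /andP[br ur]; have {}ih := ih ur.
have -> : (fun y => \prod_(b <- b :: r) f b y) = f b * (fun y => \prod_(b <- r) f b y).
  by apply/funext => y; rewrite big_cons.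
have db := dfb b; apply: is_derive_eq; rewrite /GRing.scale /=.
rewrite big_cons big_cons eqxx addrC; congr (_ + _).
  rewrite mulrC; congr (_ * _).
  by apply: eq_big_seq => j jr; case: eqP jr br => // -> ->.
rewrite mulr_sumr; apply: eq_big_seq => j jr; rewrite big_cons.
by case: eqP jr br => // -> ->.
Qed.

End ProductTaylor.

(** * Stein's identity and the central limit theorem *)

Section SteinBound.
Variables (R : realType) (I S : finType) (q : I -> S -> R) (l : nat).
Hypotheses (q_ge0 : forall i s, 0 <= q i s) (q_sum1 : forall i, \sum_s q i s = 1).
Variables (xi : I -> S -> 'I_l -> R) (eta : R).
Hypothesis (eta0 : 0 <= eta).
Hypothesis xi_mean : forall i a, \sum_s q i s * xi i s a = 0.
Hypothesis xi_le : forall i s a, `|xi i s a| <= eta.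
Hypothesis xi_cov : forall a b,
  \sum_i \sum_s q i s * (xi i s a * xi i s b) = (a == b)%:R.
Local Notation E := (pexp q).

Definition wsum (a : 'I_l) (y : {ffun I -> S}) : R := \sum_i xi i (y i) a.

Let del i s := \sum_b `|xi i s b|.

Let del_ge0 i s : 0 <= del i s. Proof. exact: sumr_ge0. Qed.

Let xi_del i s b : `|xi i s b| <= del i s.
Proof. by rewrite /del (bigD1 b)//= lerDl sumr_ge0. Qed.

Let del_le i s : del i s <= l%:R * eta.
Proof.
rewrite (le_trans (ler_sum _ (fun b _ => xi_le i s b)))//.
by rewrite sumr_const card_ord mulr_natl.
Qed.

Let ed i := \sum_s q i s * del i s ^+ 2.

Let ed_ge0 i : 0 <= ed i.
Proof. by apply: sumr_ge0 => s _; rewrite mulr_ge0 ?sqr_ge0. Qed.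

Let sum_ed : \sum_i ed i <= l%:R ^+ 2.
Proof.
have del2 i s : del i s ^+ 2 <= l%:R * \sum_b xi i s b * xi i s b.
  rewrite expr2 mulr_suml.
  have -> : l%:R * \sum_b xi i s b * xi i s b =
      \sum_(b < l) \sum_(c < l) (2^-1 * (xi i s b ^+ 2 + xi i s c ^+ 2)).
    transitivity (\sum_(b < l) 2^-1 * (l%:R * xi i s b ^+ 2 + \sum_c xi i s c ^+ 2)).
      rewrite -mulr_sumr big_split /= sumr_const card_ord -mulr_natl -mulr_sumr.
      have -> : \sum_b xi i s b * xi i s b = \sum_b xi i s b ^+ 2.
        by apply: eq_bigr => b _; rewrite expr2.
      by field.
    apply: eq_bigr => b _; rewrite -mulr_sumr; congr (_ * _).
    by rewrite big_split /= sumr_const card_ord mulr_natl.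
  apply: ler_sum => b _; rewrite mulr_sumr; apply: ler_sum => c _.
  rewrite -[xi i s b ^+ 2]real_normK ?num_real// -[xi i s c ^+ 2]real_normK ?num_real//.
  by have := sqr_ge0 (`|xi i s b| - `|xi i s c|); nra.
apply: (@le_trans _ _ (\sum_i \sum_s q i s * (l%:R * \sum_b xi i s b * xi i s b))).
  by apply: ler_sum => i _; apply: ler_sum => s _; rewrite ler_wpM2l.
have -> : \sum_i \sum_s q i s * (l%:R * \sum_b xi i s b * xi i s b) =
  l%:R * \sum_b \sum_i \sum_s q i s * (xi i s b * xi i s b).
  rewrite [in RHS]exchange_big mulr_sumr; apply: eq_bigr => i _.
  rewrite [in RHS]exchange_big mulr_sumr; apply: eq_bigr => s _.
  by rewrite -mulr_sumr mulrCA.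
under eq_bigr do rewrite xi_cov eqxx.
by rewrite sumr_const card_ord expr2.
Qed.

Variables (h h1 : 'I_l -> R -> R) (K : R).
Hypotheses (K1 : 1 <= K) (hh1 : forall b, taylor2 K (h b) (h1 b)).

Let K0 : 0 <= K. Proof. exact: le_trans K1. Qed.

Let g (x : 'I_l -> R) := \prod_b h b (x b).
Let dg (a : 'I_l) (x : 'I_l -> R) := \prod_b (if b == a then h1 b (x b) else h b (x b)).
Let kap := l%:R ^+ 2 * K ^+ l.

Let size_enum : size (index_enum 'I_l) = l.
Proof. by rewrite -[RHS]card_ord cardT enumT. Qed.

Let l_le_sqr : (l%:R : R) <= l%:R ^+ 2.
Proof. by rewrite -natrX ler_nat; case: (l) => // k; rewrite -mulnn leq_pmulr. Qed.

Let g_taylor x d e : 0 <= e -> (forall b, `|d b| <= e) ->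
  `|g (fun b => x b + d b) - g x - \sum_c d c * dg c x| <= kap * e ^+ 2.
Proof.
move=> e0 de; rewrite /g /dg.
have := @prod_taylor R 'I_l (index_enum _) (fun b => h b (x b + d b))
  (fun b => h b (x b)) (fun b => d b * h1 b (x b)) K e (index_enum_uniq _) K1 e0.
rewrite size_enum; under [X in _ - _ - X]eq_bigr => c _.
  have -> : \prod_b (if b == c then d b * h1 b (x b) else h b (x b)) =
      d c * \prod_b (if b == c then h1 b (x b) else h b (x b)).
    rewrite (bigD1 c)//= [in RHS](bigD1 c)//= !eqxx mulrA; congr (_ * _).
    by apply: eq_bigr => b /negPf ->.
over.
apply=> b; have [hK h1K hL h1L hT] := hh1 b => //.
- by rewrite (le_trans (hL _ _))// ler_wpM2l.
- rewrite (le_trans (hT _ _))// ler_wpM2l// -[d b ^+ 2]real_normK ?num_real//.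
  by rewrite ler_sqr ?nnegrE.
Qed.

Let dg_lip a x d e : 0 <= e -> (forall b, `|d b| <= e) ->
  `|dg a (fun b => x b + d b) - dg a x| <= kap * e.
Proof.
move=> e0 de; rewrite /dg.
have := @prod_lipschitz R 'I_l (index_enum _)
  (fun b => if b == a then h1 b (x b + d b) else h b (x b + d b))
  (fun b => if b == a then h1 b (x b) else h b (x b)) K e K1 e0.
rewrite size_enum => H; apply: le_trans (H _ _ _) _.
- by move=> b; have [? ? _ _ _] := hh1 b; case: eqP.
- by move=> b; have [? ? _ _ _] := hh1 b; case: eqP.
- move=> b; have [_ _ hL h1L _] := hh1 b; case: eqP => _.
    by rewrite (le_trans (h1L _ _))// ler_wpM2l.
  by rewrite (le_trans (hL _ _))// ler_wpM2l.
- by rewrite ler_wpM2r// ler_wpM2r// exprn_ge0.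
Qed.

(** For a standard normal vector W, Stein's identity E W_a g(W) = E d_a g(W) is
exact. For a sum of independent centred vectors with total covariance 1, expand
[g] around the sum [V i] without the i-th term: the constant term vanishes by
centring, the linear term reproduces the covariance of the i-th term, and the
rest is of third order in that term, hence at most [eta] times its variance. *)
Lemma stein_bound a :
  `|E (fun y => wsum a y * \prod_b h b (wsum b y)) -
    E (fun y => \prod_b (if b == a then h1 b (wsum b y) else h b (wsum b y)))|
  <= (1 + l%:R) * kap * l%:R ^+ 2 * eta.
Proof.
pose W y b := wsum b y.
pose cov i b := \sum_s q i s * (xi i s a * xi i s b).
pose V i y b := W y b - xi i (y i) b.
have W_resample i y s b : W (resample y i s) b = V i y b + xi i s b.
  rewrite /V /W /wsum (bigD1 i)//= [in RHS](bigD1 i)//= ffunE eqxx.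
  rewrite [xi i (y i) b + _]addrC addrK addrC; congr (_ + _).
  by apply: eq_bigr => j /negPf ji; rewrite ffunE ji.
have WV i y b : W y b = V i y b + xi i (y i) b by rewrite /V subrK.
have -> : E (fun y => wsum a y * \prod_b h b (wsum b y)) =
    \sum_i E (fun y => \sum_s q i s * (xi i s a * g (W (resample y i s)))).
  under eq_pexp do rewrite mulr_suml.
  rewrite pexp_sum; apply: eq_bigr => i _; rewrite (pexp_resample q_sum1 i).
  by apply: eq_pexp => y; apply: eq_bigr => s _; rewrite ffunE eqxx.
(* The total covariance is inserted as the identity matrix. *)
have -> : E (fun y => \prod_b (if b == a then h1 b (wsum b y) else h b (wsum b y)))
    = \sum_i E (fun y => \sum_b cov i b * dg b (W y)).
  transitivity (E (fun y => \sum_b (\sum_i cov i b) * dg b (W y))).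
    have covE b : \sum_i cov i b = (a == b)%:R by exact: xi_cov.
    apply: eq_pexp => y; rewrite [RHS](bigD1 a)//= covE eqxx mul1r [X in _ + X]big1 ?addr0//.
    by move=> b /negPf ba; rewrite covE eq_sym ba mul0r.
  rewrite -pexp_sum; apply: eq_pexp => y; rewrite exchange_big /=.
  by apply: eq_bigr => b _; rewrite mulr_suml.
rewrite -sumrB (le_trans (ler_norm_sum _ _ _))//.
suff H i : `|E (fun y => \sum_s q i s * (xi i s a * g (W (resample y i s)))) -
     E (fun y => \sum_b cov i b * dg b (W y))| <= (1 + l%:R) * kap * eta * ed i.
  rewrite (le_trans (ler_sum _ (fun i _ => H i)))// -mulr_sumr.
  rewrite [leRHS](_ : _ = (1 + l%:R) * kap * eta * l%:R ^+ 2); last by ring.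
  by rewrite ler_wpM2l// !mulr_ge0 ?addr_ge0 ?exprn_ge0.
rewrite -pexpB (le_trans (ler_norm_pexp q_ge0 _))//.
rewrite -[leRHS](pexp_cst q_sum1); apply: le_pexp => // y.
have gS s : g (W (resample y i s)) = g (fun b => V i y b + xi i s b).
  by congr g; apply/funext => b; rewrite W_resample.
have dgS b : dg b (W y) = dg b (fun b => V i y b + xi i (y i) b).
  by congr (dg b); apply/funext => c; exact: WV.
have -> : \sum_s q i s * (xi i s a * g (W (resample y i s))) - \sum_b cov i b * dg b (W y)
  = \sum_s q i s * (xi i s a * (g (W (resample y i s)) - g (V i y)
                              - \sum_c xi i s c * dg c (V i y)))
    + \sum_b cov i b * (dg b (V i y) - dg b (W y)).
  under [in RHS]eq_bigr do rewrite !mulrBr.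
  rewrite !sumrB.
  under [X in _ - X - _ + _]eq_bigr do rewrite mulrA.
  rewrite -mulr_suml xi_mean mul0r subr0.
  under [X in _ = _ + X]eq_bigr do rewrite mulrBr.
  rewrite sumrB.
  have -> : \sum_s q i s * (xi i s a * \sum_c xi i s c * dg c (V i y)) =
     \sum_b cov i b * dg b (V i y).
    under eq_bigr do rewrite mulr_sumr mulr_sumr.
    rewrite exchange_big; apply: eq_bigr => b _; rewrite mulr_suml.
    by apply: eq_bigr => s _; rewrite !mulrA.
  by rewrite addrA subrK.
rewrite (le_trans (ler_normD _ _))//.
have h1' : `|\sum_s q i s * (xi i s a * (g (W (resample y i s)) - g (V i y)
     - \sum_c xi i s c * dg c (V i y)))| <= kap * eta * ed i.
  rewrite (le_trans (ler_norm_sum _ _ _))// mulr_sumr; apply: ler_sum => s _.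
  rewrite normrM (ger0_norm (q_ge0 _ _)) mulrCA ler_wpM2l// normrM gS.
  rewrite mulrAC mulrC ler_pM// g_taylor//.
have h2' : `|\sum_b cov i b * (dg b (V i y) - dg b (W y))|
    <= l%:R * kap * eta * ed i.
  have covb : \sum_b `|cov i b| <= ed i.
    apply: (@le_trans _ _ (\sum_b \sum_s q i s * (`|xi i s a| * `|xi i s b|))).
      apply: ler_sum => b _; rewrite (le_trans (ler_norm_sum _ _ _))//.
      by apply: ler_sum => s _; rewrite !normrM (ger0_norm (q_ge0 _ _)).
    rewrite exchange_big; apply: ler_sum => s _ /=.
    rewrite -mulr_sumr ler_wpM2l// -mulr_sumr expr2.
    by apply: ler_wpM2r; [exact: del_ge0|exact: xi_del].
  apply: (@le_trans _ _ (\sum_b `|cov i b| * (kap * (l%:R * eta)))).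
    rewrite (le_trans (ler_norm_sum _ _ _))//; apply: ler_sum => b _.
    rewrite normrM ler_wpM2l// distrC dgS dg_lip// ?mulr_ge0// => c.
    by rewrite (le_trans (xi_del _ _ _)).
  rewrite -mulr_suml [leRHS](_ : _ = ed i * (kap * (l%:R * eta))); last by ring.
  by rewrite ler_wpM2r// !mulr_ge0// exprn_ge0.
by rewrite (le_trans (lerD h1' h2'))// le_eqVlt; apply/orP; left; apply/eqP; ring.
Qed.
End SteinBound.

Section Hyperbolic.
Variable R : realType.
Definition cosh (u : R) : R := (expR u + expR (- u)) / 2.
Definition sinh (u : R) : R := (expR u - expR (- u)) / 2.

Lemma is_derive_cosh (u : R) : is_derive u 1 cosh (sinh u).
Proof.
have [c c2] : exists c : R, c = 2^-1 by exists 2^-1.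
have -> : cosh = fun u => c * (expR u + expR (- u)) by apply/funext => x; rewrite c2 mulrC.
by apply: is_derive_eq; rewrite /GRing.scale /= /sinh c2; field.
Qed.

Lemma is_derive_sinh (u : R) : is_derive u 1 sinh (cosh u).
Proof.
have [c c2] : exists c : R, c = 2^-1 by exists 2^-1.
have -> : sinh = fun u => c * (expR u - expR (- u)) by apply/funext => x; rewrite c2 mulrC.
by apply: is_derive_eq; rewrite /GRing.scale /= /cosh c2; field.
Qed.

Lemma cosh2_sinh2 u : cosh u ^+ 2 - sinh u ^+ 2 = 1.
Proof.
rewrite /cosh /sinh; have := expRxMexpNx_1 u; move: (expR u) (expR (- u)) => a b ab.
by rewrite [LHS](_ : _ = a * b) //; field.
Qed.

Lemma cosh_ge1 u : 1 <= cosh u.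
Proof.
rewrite /cosh; have := expRxMexpNx_1 u; have := expR_gt0 u; have := expR_gt0 (- u).
move: (expR u) (expR (- u)) => a b b0 a0 ab.
by rewrite ler_pdivlMr//; have := sqr_ge0 (a - b); nra.
Qed.

Lemma sinh_le (u v : R) : `|v| <= `|u| -> `|sinh v| <= expR `|u|.
Proof.
move=> vu; have e1 : expR v <= expR `|u|.
  by rewrite ler_expR (le_trans (ler_norm _)).
have e2 : expR (- v) <= expR `|u|.
  by rewrite ler_expR (le_trans _ vu)// -normrN ler_norm.
rewrite /sinh ler_norml; have := expR_gt0 v; have := expR_gt0 (- v).
by move=> h1 h2; apply/andP; split; lra.
Qed.

Lemma is_derive_bigsum (J : Type) (r : seq J) (f : J -> R -> R) (df : J -> R) (x : R) :
  (forall j, is_derive x 1 (f j) (df j)) ->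
  is_derive x 1 (fun y => \sum_(j <- r) f j y) (\sum_(j <- r) df j).
Proof.
move=> dfj; elim: r => [|j r ih].
  rewrite big_nil.
  have -> : (fun y => \sum_(j <- [::]) f j y) = cst 0 by apply/funext => y; rewrite big_nil.
  exact: is_derive_cst.
have -> : (fun y => \sum_(b <- j :: r) f b y) = f j + (fun y => \sum_(b <- r) f b y).
  by apply/funext => y; rewrite big_cons.
by have dj := dfj j; rewrite big_cons; exact: is_deriveD.
Qed.

End Hyperbolic.

(** The path from u to 0 replaces W by a normal vector. With
z_a = tau_a cosh u - sinh u W_a one has dz_a/du = (sinh u z_a - W_a) / cosh u, and
the normal density phi satisfies phi' = - id * phi. Therefore the derivative of
E prod_a Phi(z_a) is - 1 / cosh u times the sum over c of the Stein defects
E W_c g_c(W) - E d_c g_c(W), where g_c = phi(z_c) prod_(b != c) Phi(z_b). *)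
Lemma smooth_clt (R : realType) (l : nat) (u : R) : exists2 C : R, 0 <= C &
  forall (I S : finType) (q : I -> S -> R) (xi : I -> S -> 'I_l -> R) (eta : R)
    (tau : 'I_l -> R),
  (forall i s, 0 <= q i s) -> (forall i, \sum_s q i s = 1) -> 0 <= eta ->
  (forall i a, \sum_s q i s * xi i s a = 0) ->
  (forall i s a, `|xi i s a| <= eta) ->
  (forall a b, \sum_i \sum_s q i s * (xi i s a * xi i s b) = (a == b)%:R) ->
  `|pexp q (fun y => \prod_a ncdf (tau a * cosh u - sinh u * wsum xi a y))
    - \prod_a ncdf (tau a)| <= C * eta.
Proof.
have [K K1 [PhiK phiK]] := @npdf_taylor2 R.
have K0 : 0 <= K by exact: le_trans K1.
pose B := expR `|u|.
have B1 : 1 <= B by rewrite -expR0 ler_expR.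
pose K' := K * B ^+ 2.
have K'1 : 1 <= K' by rewrite -[leLHS]mulr1 /K' ler_pM ?exprn_ege1.
pose C0 := (1 + l%:R) * (l%:R ^+ 2 * K' ^+ l) * l%:R ^+ 2.
have C00 : 0 <= C0.
  by rewrite !mulr_ge0 ?addr_ge0 ?sqr_ge0// exprn_ge0// (le_trans _ K'1).
exists (l%:R * C0 * `|u|); first by rewrite mulr_ge0 ?(mulr_ge0 _ C00).
move=> I S q xi eta tau q0 q1 eta0 xi0 xi_le xi_cov.
pose W a y := wsum xi a y.
pose z a y v := tau a * cosh v - sinh v * W a y.
pose F v := pexp q (fun y => \prod_a ncdf (z a y v)).
pose dz a y v := tau a * sinh v - cosh v * W a y.
pose dF v := pexp q (fun y => \sum_c \prod_b
   (if b == c then normal_pdf 0 1 (z b y v) * dz b y v else ncdf (z b y v))).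
have dFE (v : R) : is_derive v 1 F (dF v).
  apply: is_derive_bigsum => y.
  have -> : (fun y0 : R => (\prod_i q i (y i)) * \prod_a ncdf (z a y y0)) =
    (\prod_i q i (y i)) \*: (fun y0 : R => \prod_a ncdf (z a y y0)) by [].
  apply: is_deriveZ; apply: is_derive_prod; first exact: index_enum_uniq.
  move=> b.
  have dzb : is_derive v 1 (z b y) (dz b y v).
    have d1 := is_derive_cosh v; have d2 := is_derive_sinh v.
    have -> : z b y = (tau b \*: (@cosh R : R -> R) - (W b y) \*: (@sinh R : R -> R)).
      by apply/funext => x; rewrite /z [sinh x * _]mulrC.
    apply: is_derive_eq.
    by rewrite /dz /GRing.scale /= [cosh v * _]mulrC.
  have dn := is_derive_ncdf (z b y v).
  exact: is_derive1_comp.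
have F0 : F 0 = \prod_a ncdf (tau a).
  rewrite /F -[RHS](pexp_cst q1); apply: eq_pexp => y; apply: eq_bigr => a _.
  rewrite /z /cosh /sinh oppr0 expR0 subrr !mul0r subr0; congr ncdf.
  by field.
have -> : pexp q (fun y => \prod_a ncdf (tau a * cosh u - sinh u * wsum xi a y)) = F (0 + u).
  by rewrite add0r.
rewrite -F0 [leRHS](_ : _ = (l%:R * C0 * eta) * `|u|); last by ring.
apply: (mean_value_bound dFE) => v; rewrite subr0 => vu.
pose h c b x := if b == c then normal_pdf (0 : R) 1 (tau b * cosh v - sinh v * x)
  else ncdf (tau b * cosh v - sinh v * x).
pose h1 c b x := - sinh v * (if b == c then
    - (tau b * cosh v - sinh v * x) * normal_pdf (0 : R) 1 (tau b * cosh v - sinh v * x)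
  else normal_pdf (0 : R) 1 (tau b * cosh v - sinh v * x)).
have hh1 c b : taylor2 K' (h c b) (h1 c b).
  have shB : `|sinh v| <= B by exact: sinh_le.
  rewrite /h /h1; case: eqP => _.
    exact: (taylor2_affine (tau b * cosh v) K0 B1 shB phiK).
  exact: (taylor2_affine (tau b * cosh v) K0 B1 shB PhiK).
have chv0 : 0 < cosh v by rewrite (lt_le_trans _ (cosh_ge1 v)).
have -> : dF v = - (cosh v)^-1 * \sum_c
   (pexp q (fun y => wsum xi c y * \prod_b h c b (wsum xi b y))
   - pexp q (fun y => \prod_b (if b == c then h1 c b (wsum xi b y)
       else h c b (wsum xi b y)))).
  rewrite /dF pexp_sum mulr_sumr; apply: eq_bigr => c _.
  rewrite -pexpB -pexpZ; apply: eq_pexp => y.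
  rewrite (bigD1 c)//= [\prod_b h c b _](bigD1 c)//= [X in _ - X](bigD1 c)//= !eqxx.
  set P1 := \prod_(i | i != c) _; set P2 := \prod_(i | i != c) _.
  set P3 := \prod_(i | i != c) _.
  have -> : P2 = P1 by apply: eq_bigr => b /negPf bc; rewrite bc /h bc.
  have -> : P3 = P1 by apply: eq_bigr => b /negPf bc; rewrite bc /h bc.
  rewrite /h /h1 eqxx -/(W c y) -/(z c y v) /dz.
  set Z := z c y v; set n := normal_pdf 0 1 Z.
  apply: (mulfI (lt0r_neq0 chv0)).
  rewrite [in RHS]mulNr [in RHS]mulrN mulVKf ?lt0r_neq0//.
  apply/eqP; rewrite -subr_eq0.
  set X := (X in X == 0).
  have -> : X = n * P1 * W c y * (1 - (cosh v ^+ 2 - sinh v ^+ 2)) by rewrite /X /Z /z; ring.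
  by rewrite cosh2_sinh2 subrr mulr0.
rewrite normrM normrN -[leRHS]mul1r; apply: ler_pM => //.
  by rewrite normfV gtr0_norm// invf_le1// cosh_ge1.
rewrite (le_trans (ler_norm_sum _ _ _))//.
have H c := stein_bound q0 q1 eta0 xi0 xi_le xi_cov K'1 (hh1 c) c.
rewrite (le_trans (ler_sum _ (fun c _ => H c)))//.
by rewrite sumr_const card_ord -[leLHS]mulr_natl -[leRHS]mulrA.
Qed.

(** The smoothed statement is applied with
tau_a = (sinh u (t_a + sg rho) + sg x) / cosh u for sg = 1 and sg = -1. For sg = 1
the argument of Phi is at least [x] when W_a <= t_a + rho, so Phi is nearly 1
there; for sg = -1 it is at most [- x] when W_a > t_a - rho, so Phi is nearly 0
there. As u grows, tau_a tends to t_a + sg rho. *)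
Lemma cdf_clt (R : realType) (l : nat) (t : 'I_l -> R) (e : R) : 0 < e ->
  exists eta0 rho : R, [/\ 0 < eta0, 0 < rho &
  forall (I S : finType) (q : I -> S -> R) (xi : I -> S -> 'I_l -> R) (eta : R),
  (forall i s, 0 <= q i s) -> (forall i, \sum_s q i s = 1) ->
  0 <= eta -> eta <= eta0 ->
  (forall i a, \sum_s q i s * xi i s a = 0) ->
  (forall i s a, `|xi i s a| <= eta) ->
  (forall a b, \sum_i \sum_s q i s * (xi i s a * xi i s b) = (a == b)%:R) ->
  pexp q (fun y => [forall a, wsum xi a y <= t a + rho]%:R)
    <= \prod_a ncdf (t a) + e /\
  \prod_a ncdf (t a) - e
    <= pexp q (fun y => [forall a, wsum xi a y <= t a - rho]%:R)].
Proof.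
move=> e0.
have [K K1 [[PhiK _ PhiL _ _] _]] := @npdf_taylor2 R.
have K0 : 0 <= K by exact: le_trans K1.
have size_enum : size (index_enum 'I_l) = l by rewrite -[RHS]card_ord cardT enumT.
pose Lam : R := l%:R * K ^+ l + 1.
have Lam0 : 0 < Lam by rewrite ltr_wpDl// mulr_ge0// exprn_ge0.
have ncdf_abs (x : R) : `|ncdf x| <= 1 by rewrite ger0_norm ?ncdf_ge0// ncdf_le1.
have Lip (f g : 'I_l -> R) (del : R) : 0 <= del -> (forall a, `|f a - g a| <= del) ->
    `|\prod_a ncdf (f a) - \prod_a ncdf (g a)| <= Lam * del.
  move=> del0 fg.
  have := @prod_lipschitz R 'I_l (index_enum _) (fun a => ncdf (f a))
    (fun a => ncdf (g a)) K del K1 del0.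
  rewrite size_enum => H; apply: le_trans (H _ _ _) _ => [b|b|b|] //.
    rewrite [ncdf (f b)](_ : _ = ncdf (g b + (f b - g b))); last by rewrite addrC subrK.
    by rewrite (le_trans (PhiL _ _))// ler_wpM2l.
  by rewrite ler_wpM2r// /Lam lerDl.
pose e' := e / (4 * (l%:R + 1)).
have e'0 : 0 < e' by rewrite divr_gt0// mulr_gt0// ltr_wpDl.
have e'E : (l%:R + 1) * e' = e / 4.
  by rewrite /e'; field; rewrite gt_eqF// ltr_wpDl.
have [x x0 xP] := ncdf_tails e'0.
pose T := \sum_a `|t a|.
have T0 : 0 <= T by exact: sumr_ge0.
(* Large enough for the Lipschitz constant times (T + x) / cosh u to be at most
   e / 8, using cosh u >= u / 2. *)
pose u := 16 * Lam * (T + x) / e.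
have u0 : 0 < u by rewrite divr_gt0// !mulr_gt0// ltr_wpDl.
pose c := cosh u; pose s := sinh u.
have c1 : 1 <= c by exact: cosh_ge1.
have c0 : 0 < c by rewrite (lt_le_trans _ c1).
have cu : u / 2 <= c.
  rewrite /c /cosh ler_pM2r//; have := expR_ge1Dx u; have := expR_gt0 (- u); lra.
have s0 : 0 < s.
  by rewrite /s /sinh divr_gt0// subr_gt0 ltr_expR; lra.
have sc : s <= c.
  by rewrite /s /c /sinh /cosh ler_pM2r//; have := expR_gt0 (- u); lra.
have cs1 : c - s <= 1.
  rewrite /s /c /sinh /cosh -mulrBl.
  have -> : (expR u + expR (- u) - (expR u - expR (- u))) / 2 = expR (- u) by field.
  by rewrite expR_le1 oppr_le0 ltW.
have Tc : Lam * ((T + x) / c) <= e / 8.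
  rewrite mulrA ler_pdivrMr//.
  apply: (@le_trans _ _ (e / 8 * (u / 2))); last by rewrite ler_wpM2l// divr_ge0// ltW.
  rewrite /u le_eqVlt; apply/orP; left; apply/eqP; field.
  by rewrite gt_eqF.
pose rho := e / (8 * Lam).
have rho0 : 0 < rho by rewrite divr_gt0// mulr_gt0.
have rhoE : Lam * rho = e / 8 by rewrite /rho; field; rewrite gt_eqF.
clearbody rho e'.
have [C C0 clt] := smooth_clt l u.
exists (e / (4 * (C + 1))), rho.
have C10 : 0 < C + 1 by rewrite ltr_wpDl.
split => //; first by rewrite divr_gt0// mulr_gt0.
move=> I S q xi eta q0 q1 eta_ge0 eta_le xi0 xi_le xi_cov.
have Ceta : C * eta <= e / 4.
  rewrite (le_trans (ler_wpM2l C0 eta_le))//.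
  rewrite mulrA ler_pdivrMr ?mulr_gt0//.
  rewrite [leRHS](_ : _ = e * (C + 1)); last by field.
  by rewrite mulrC ler_wpM2l ?ltW// ltrDl.
have tauP (sg : R) (tau : 'I_l -> R) : `|sg| = 1 ->
    (forall a, tau a * c = s * (t a + sg * rho) + sg * x) ->
    `|\prod_a ncdf (tau a) - \prod_a ncdf (t a)| <= e / 4.
  move=> sg1 tauE.
  apply: (@le_trans _ _ (Lam * ((T + x) / c + rho))); last first.
    by rewrite mulrDr rhoE; lra.
  apply: Lip => [|a].
    by rewrite addr_ge0 ?divr_ge0 ?addr_ge0// ltW.
  have ta : `|t a| <= T by rewrite /T (bigD1 a)//= lerDl sumr_ge0.
  rewrite -(ler_pM2r c0) mulrDl divfK ?gt_eqF// -{1}(gtr0_norm c0) -normrM mulrBl tauE.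
  have -> : s * (t a + sg * rho) + sg * x - t a * c =
     - ((c - s) * t a) + (sg * (s * rho) + sg * x) by ring.
  rewrite (le_trans (ler_normD _ _))// normrN normrM (ger0_norm (x := c - s)) ?subr_ge0//.
  rewrite -mulrDr normrM sg1 mul1r [`|s * rho + x|]ger0_norm; last first.
    by rewrite addr_ge0 ?(ltW x0)// (mulr_ge0 (ltW s0) (ltW rho0)).
  have h1 : (c - s) * `|t a| <= 1 * T by rewrite ler_pM// subr_ge0.
  have h2 : s * rho <= rho * c by rewrite mulrC ler_wpM2l// ltW.
  lra.
split.
- pose tau a := (s * (t a + 1 * rho) + 1 * x) / c.
  have tauE a : tau a * c = s * (t a + 1 * rho) + 1 * x by rewrite divfK ?gt_eqF.
  have := tauP 1 tau (normr1 _) tauE; rewrite ler_norml => /andP[_ h1].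
  have := clt I S q xi eta tau q0 q1 eta_ge0 xi0 xi_le xi_cov.
  rewrite ler_norml => /andP[_ h2].
  suff : pexp q (fun y => [forall a, wsum xi a y <= t a + rho]%:R) <=
     pexp q (fun y => \prod_a ncdf (tau a * cosh u - sinh u * wsum xi a y)) + l%:R * e'.
    by rewrite mulrDl mul1r in e'E; lra.
  rewrite -[l%:R * e'](pexp_cst q1) -pexpD; apply: le_pexp => // y.
  case: forallP => [Wt|_]; last first.
    apply: addr_ge0; last by rewrite (mulr_ge0 _ (ltW e'0)).
    by apply: prodr_ge0 => a _; exact: ncdf_ge0.
  have zx a : `|1 - ncdf (tau a * cosh u - sinh u * wsum xi a y)| <= 1 * e'.
    have zax : x <= tau a * cosh u - sinh u * wsum xi a y.
      rewrite -/c -/s tauE !mul1r -addrA addrC -addrA lerDl -mulrN addrC -mulrDr.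
      by apply: mulr_ge0; [exact: ltW|rewrite subr_ge0].
    have [_ h] := xP _ zax; rewrite mul1r ger0_norm ?subr_ge0 ?ncdf_le1//.
    by rewrite lerBlDl -lerBlDr.
  have := @prod_lipschitz R 'I_l (index_enum _) (fun=> 1)
    (fun a => ncdf (tau a * cosh u - sinh u * wsum xi a y)) 1 e' (lexx _) (ltW e'0)
    _ _ zx.
  rewrite size_enum big1_eq expr1n mulr1 => H.
  have {}H := H _ (fun b => ncdf_abs _).
  have : `|1 - \prod_a ncdf (tau a * cosh u - sinh u * wsum xi a y)| <= l%:R * e'.
    by apply: H => b; rewrite normr1.
  by rewrite ler_norml => /andP[_]; rewrite lerBlDl.
- pose tau a := (s * (t a + -1 * rho) + -1 * x) / c.
  have tauE a : tau a * c = s * (t a + -1 * rho) + -1 * x by rewrite divfK ?gt_eqF.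
  have := tauP (-1) tau (normrN1 _) tauE; rewrite ler_norml => /andP[h1 _].
  have := clt I S q xi eta tau q0 q1 eta_ge0 xi0 xi_le xi_cov.
  rewrite ler_norml => /andP[h2 _].
  suff : pexp q (fun y => \prod_a ncdf (tau a * cosh u - sinh u * wsum xi a y)) <=
     pexp q (fun y => [forall a, wsum xi a y <= t a - rho]%:R) + e'.
    have : e' <= (l%:R + 1) * e' by rewrite ler_peMl ?(ltW e'0)// lerDr.
    by rewrite e'E; lra.
  rewrite -[e' in leRHS](pexp_cst q1) -pexpD; apply: le_pexp => // y.
  have prod_le1 (r : seq 'I_l) (P : pred 'I_l) :
      \prod_(a <- r | P a) ncdf (tau a * cosh u - sinh u * wsum xi a y) <= 1.
    apply: numdomain.Num.Theory.prodr_ile1 => a _; rewrite ncdf_ge0 ncdf_le1//.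
  case: forallP => [_|/forallP]; first by rewrite (le_trans (prod_le1 _ _))// lerDl ltW.
  rewrite negb_forall => /existsP[a]; rewrite -ltNge => Wa.
  rewrite add0r (bigD1 a)//= -[leRHS]mulr1 ler_pM ?ncdf_ge0//.
    by rewrite prodr_ge0// => b _; exact: ncdf_ge0.
  have [h _] := xP x (lexx x); apply: le_trans h; apply: ncdf_le.
  rewrite -/c -/s tauE -subr_ge0.
  have : 0 <= s * (wsum xi a y - (t a - rho)) by apply: mulr_ge0; rewrite ltW// subr_gt0.
  lra.
Qed.

(** * Logistic responses *)

Section Logistic.
Variable R : realType.
Implicit Types (th u y : R).

(** The standard deviation of a binary response with mean [logistic th]. *)
Definition binsd th : R := Num.sqrt (logistic th * (1 - logistic th)).
(** The Pearson residual of the response [y]. *)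
Definition pearson th y : R := (binsd th)^-1 * (y - logistic th).

Local Notation w th := (expR (th / 2)).
Local Notation v th := (expR (- (th / 2))).

Lemma half_expR_mul th : w th * v th = 1. Proof. exact: expRxMexpNx_1. Qed.

Lemma half_expR_sum_gt0 th : 0 < w th + v th.
Proof. by rewrite addr_gt0// expR_gt0. Qed.

Lemma logistic_half th : logistic th = w th / (w th + v th).
Proof.
have wv := half_expR_mul th; have s0 := half_expR_sum_gt0 th.
rewrite /logistic; have -> : expR th = w th ^+ 2 by rewrite expr2 -expRD; congr expR; field.
have -> : 1 + w th ^+ 2 = w th * (w th + v th) by rewrite mulrDr wv expr2 addrC.
by field; rewrite !gt_eqF ?expR_gt0.
Qed.

Lemma logistic_compl th : 1 - logistic th = v th / (w th + v th).
Proof.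
by rewrite logistic_half; field; rewrite gt_eqF// half_expR_sum_gt0.
Qed.

Lemma binsdE th : binsd th = (w th + v th)^-1.
Proof.
rewrite /binsd logistic_compl logistic_half mulrACA half_expR_mul mul1r -expr2.
by rewrite sqrtr_sqr ger0_norm// invr_ge0 ltW// half_expR_sum_gt0.
Qed.

Lemma binsd_gt0 th : 0 < binsd th.
Proof. by rewrite binsdE invr_gt0 half_expR_sum_gt0. Qed.

Lemma pearsonE th y : pearson th y = y * v th - (1 - y) * w th.
Proof.
rewrite /pearson binsdE invrK logistic_half; field.
by rewrite gt_eqF// half_expR_sum_gt0.
Qed.

Definition binsd1 th : R := - ((w th - v th) / 2) * binsd th ^+ 2.

Lemma binsd_taylor2 : taylor2 1 binsd binsd1.
Proof.
have [c c2] : exists c : R, c = 2^-1 by exists 2^-1.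
have wE : (fun th : R => w th) = (fun th : R => expR (c * th)).
  by apply/funext => x; rewrite c2 mulrC.
have vE : (fun th : R => v th) = (fun th : R => expR (- c * th)).
  by apply/funext => x; rewrite c2 mulNr [_ * x]mulrC.
have dw (th : R) : is_derive th 1 (fun th : R => w th) (w th / 2).
  rewrite wE; apply: is_derive_eq.
  by rewrite /GRing.scale /= c2 mulr1 mulrC [2^-1 * th]mulrC mulrC.
have dv (th : R) : is_derive th 1 (fun th : R => v th) (- (v th / 2)).
  rewrite vE; apply: is_derive_eq.
  by rewrite /GRing.scale /= c2 mulr1 mulNr [2^-1 * th]mulrC mulrN.
have binsdE' : binsd = (fun th : R => ((w th + v th)^-1 : R)).
  by apply/funext => th; exact: binsdE.
have dsdv (th : R) : is_derive th 1 binsd (binsd1 th).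
  have d1 := dw th; have d2 := dv th.
  have s0 : w th + v th != 0 by rewrite gt_eqF// half_expR_sum_gt0.
  rewrite binsdE'; apply: is_derive_eq.
  rewrite /binsd1 binsdE /GRing.scale /=.
  by field.
pose binsd2 th := binsd th * (- 4^-1 + ((w th - v th) * binsd th) ^+ 2 / 2).
have dsdv1 (th : R) : is_derive th 1 binsd1 (binsd2 th).
  have d1 := dw th; have d2 := dv th; have d3 := dsdv th.
  have -> : binsd1 = fun th : R => (c * (v th - w th)) * binsd th ^+ 2.
    by apply/funext => x; rewrite /binsd1 c2; field.
  apply: is_derive_eq; rewrite /GRing.scale /= /binsd2 /binsd1.
  have s0 : w th + v th != 0 by rewrite gt_eqF// half_expR_sum_gt0.
  rewrite binsdE c2; by field.
have sd0 th : 0 < binsd th by exact: binsd_gt0.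
have sd1 th : binsd th <= 2^-1.
  rewrite binsdE lef_pV2 ?posrE ?half_expR_sum_gt0//.
  have := half_expR_mul th; have := expR_gt0 (th / 2); have := expR_gt0 (- (th / 2)).
  move: (w th) (v th) => a b b0 a0 ab.
  by have := sqr_ge0 (a - b); nra.
have ratio th : `|(w th - v th) * binsd th| <= 1.
  rewrite binsdE normrM normfV (gtr0_norm (half_expR_sum_gt0 th)).
  rewrite ler_pdivrMr ?half_expR_sum_gt0// mul1r ler_norml.
  by have := expR_gt0 (th / 2); have := expR_gt0 (- (th / 2)); move=> ? ?; apply/andP; split; lra.
apply: (taylor2_derive dsdv dsdv1) => th.
- by rewrite (gtr0_norm (sd0 th)) (le_trans (sd1 th))//; lra.
- have -> : binsd1 th = - (((w th - v th) * binsd th) * (binsd th / 2)) by rewrite /binsd1; ring.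
  have := sd0 th => sp; have s2 := sd1 th.
  have sp2 : 0 <= binsd th / 2 by lra.
  by rewrite normrN normrM -[leRHS]mul1r ler_pM// (ger0_norm sp2); lra.
- have sp := sd0 th; have s2 := sd1 th; have rt := ratio th.
  rewrite /binsd2 normrM (gtr0_norm sp).
  have h : ((w th - v th) * binsd th) ^+ 2 <= 1.
    by rewrite -real_normK ?num_real// -[leRHS](expr1n _ 2) ler_sqr ?nnegrE.
  have h0 := sqr_ge0 ((w th - v th) * binsd th).
  have hn : `|- 4^-1 + ((w th - v th) * binsd th) ^+ 2 / 2| <= 1.
    by rewrite ler_norml; apply/andP; split; lra.
  by rewrite -[leRHS]mul1r; apply: ler_pM => //; lra.
Qed.

Definition pearson1 th y : R := - (y * v th + (1 - y) * w th) / 2.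

Lemma expR_taylor (x : R) : `|x| <= 1 -> `|expR x - 1 - x| <= expR 1 * x ^+ 2.
Proof.
move=> x1.
have e1 (z : R) : `|z| <= 1 -> `|expR z| <= expR 1.
  by move=> z1; rewrite ger0_norm ?expR_ge0// ler_expR (le_trans (ler_norm _)).
have := @taylor_bound R expR expR (expR 1) 0 x (fun y => is_derive_expR y).
rewrite add0r expR0 mulr1; apply; last exact: expR_ge0.
move=> y yx; rewrite subr0; have := @mean_value_bound R expR expR (expR 1) 0 y
   (fun y => is_derive_expR y); rewrite add0r expR0; apply.
move=> z zy; apply: e1; move: zy yx; rewrite !subr0 => zy yx.
by rewrite (le_trans zy)// (le_trans yx).
Qed.

(** For a binary response the residual is a pure exponential, e^(-th/2) if y = 1
and - e^(th/2) if y = 0, so its Taylor remainder is that of the exponential. *)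
Lemma pearson_taylor th u y (D : R) : y = 0 \/ y = 1 -> `|u| <= 1 ->
    w th <= D -> v th <= D ->
  [/\ `|pearson th y| <= D, `|pearson1 th y| <= D &
      `|pearson (th + u) y - pearson th y - u * pearson1 th y| <= D * expR 1 * u ^+ 2].
Proof.
move=> y01 u1 wD vD.
have w0 := expR_gt0 (th / 2); have v0 := expR_gt0 (- (th / 2)).
have D0 : 0 < D by lra.
have u2 : `|u / 2| <= 1.
  by rewrite normrM normfV (ger0_norm (ler0n R 2)); lra.
have tw := expR_taylor u2.
have tv : `|expR (- (u / 2)) - 1 - - (u / 2)| <= expR 1 * (u / 2) ^+ 2.
  by rewrite -[(u / 2) ^+ 2]sqrrN; apply: expR_taylor; rewrite normrN.
have half x : 0 <= x -> x * (u / 2) ^+ 2 <= x * u ^+ 2.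
  by move=> x0; rewrite ler_wpM2l// exprMn; have := sqr_ge0 u; lra.
rewrite !pearsonE /pearson1.
have -> : (th + u) / 2 = th / 2 + u / 2 by field.
rewrite [- (th / 2 + u / 2)]opprD !expRD.
case: y01 => ->; split.
- by rewrite mul0r subr0 mul1r sub0r normrN gtr0_norm.
- have -> : - (0 * v th + (1 - 0) * w th) / 2 = - (w th / 2) by field.
  by rewrite normrN gtr0_norm; lra.
- have -> : 0 * (v th * expR (- (u / 2))) - (1 - 0) * (w th * expR (u / 2)) -
    (0 * v th - (1 - 0) * w th) - u * (- (0 * v th + (1 - 0) * w th) / 2) =
    - (w th * (expR (u / 2) - 1 - u / 2)) by field.
  rewrite normrN normrM (gtr0_norm w0) -mulrA; apply: ler_pM; rewrite ?(ltW w0)//.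
  by rewrite (le_trans tw)// half// expR_ge0.
- by rewrite mul1r subrr mul0r subr0 gtr0_norm.
- have -> : - (1 * v th + (1 - 1) * w th) / 2 = - (v th / 2) by field.
  by rewrite normrN gtr0_norm; lra.
- have -> : 1 * (v th * expR (- (u / 2))) - (1 - 1) * (w th * expR (u / 2)) -
    (1 * v th - (1 - 1) * w th) - u * (- (1 * v th + (1 - 1) * w th) / 2) =
    (v th * (expR (- (u / 2)) - 1 - - (u / 2))) by field.
  rewrite normrM (gtr0_norm v0) -mulrA; apply: ler_pM; rewrite ?(ltW v0)//.
  by rewrite (le_trans tv)// half// expR_ge0.
Qed.

Lemma score_term_taylor th1 th2 u1 u2 y (D : R) : y = 0 \/ y = 1 -> 1 <= D ->
    `|u2| <= 1 -> w th2 <= D -> v th2 <= D ->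
  `|binsd (th1 + u1) * pearson (th2 + u2) y -
    (binsd th1 * pearson th2 y + binsd1 th1 * pearson th2 y * u1 + binsd th1 * pearson1 th2 y * u2)|
  <= 2 * D * expR 1 * (u1 ^+ 2 + u2 ^+ 2).
Proof.
move=> y01 D1 u21 wD vD.
have [rD r1D rT] := pearson_taylor y01 u21 wD vD.
have [a1 a1' aL _ aT] := binsd_taylor2.
have D0 : 0 <= D by lra.
have E1 : 1 <= expR 1 :> R by rewrite -[leLHS]expR0 ler_expR.
have -> : binsd (th1 + u1) * pearson (th2 + u2) y -
    (binsd th1 * pearson th2 y + binsd1 th1 * pearson th2 y * u1 + binsd th1 * pearson1 th2 y * u2)
  = binsd (th1 + u1) * (pearson (th2 + u2) y - pearson th2 y - u2 * pearson1 th2 y)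
   + (binsd (th1 + u1) - binsd th1) * (pearson1 th2 y * u2)
   + (binsd (th1 + u1) - binsd th1 - u1 * binsd1 th1) * pearson th2 y by ring.
have h1 : `|binsd (th1 + u1) * (pearson (th2 + u2) y - pearson th2 y - u2 * pearson1 th2 y)|
   <= 1 * (D * expR 1 * u2 ^+ 2) by rewrite normrM ler_pM.
have h2 : `|(binsd (th1 + u1) - binsd th1) * (pearson1 th2 y * u2)| <= (1 * `|u1|) * (D * `|u2|).
  by rewrite normrM ler_pM// normrM ler_wpM2r.
have h3 : `|(binsd (th1 + u1) - binsd th1 - u1 * binsd1 th1) * pearson th2 y| <= (1 * u1 ^+ 2) * D.
  by rewrite normrM ler_pM.
have DE : D <= D * expR 1 by rewrite ler_peMr.
rewrite (le_trans (ler_normD _ _))//.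
apply: (le_trans (lerD (ler_normD _ _) (lexx _))).
apply: (le_trans (lerD (lerD h1 h2) h3)).
rewrite -[u1 ^+ 2]real_normK ?num_real// -[u2 ^+ 2]real_normK ?num_real//.
move: (normr_ge0 u1) (normr_ge0 u2) (sqr_ge0 (`|u1| - `|u2|)).
move: `|u1| `|u2| => x1 x2 x10 x20 sq.
have x12 : x1 * (D * x2) <= D * (x1 ^+ 2 + x2 ^+ 2) / 2.
  by have := mulr_ge0 D0 sq; lra.
have t1 : D * x1 ^+ 2 <= D * expR 1 * x1 ^+ 2 by rewrite ler_wpM2r// sqr_ge0.
have t2 : D * x2 ^+ 2 <= D * expR 1 * x2 ^+ 2 by rewrite ler_wpM2r// sqr_ge0.
have t3 : 0 <= D * x1 ^+ 2 by rewrite mulr_ge0// sqr_ge0.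
have t4 : 0 <= D * x2 ^+ 2 by rewrite mulr_ge0// sqr_ge0.
lra.
Qed.

Lemma pearson_mean th : logistic th * pearson th 1 + (1 - logistic th) * pearson th 0 = 0.
Proof.
rewrite !pearsonE logistic_half; field.
by rewrite gt_eqF// half_expR_sum_gt0.
Qed.

(** On average the derivative of the residual is [- binsd th]; this is the part
that produces the matrix H in the linearisation. *)
Lemma pearson1_mean th : logistic th * (pearson1 th 1 + binsd th)
  + (1 - logistic th) * (pearson1 th 0 + binsd th) = 0.
Proof.
rewrite /pearson1 binsdE; have wv := half_expR_mul th.
have s0 : w th + v th != 0 by rewrite gt_eqF// half_expR_sum_gt0.
have -> : (w th + v th)^-1 = (w th * v th) / (w th + v th) by rewrite wv mul1r.
by rewrite logistic_half; field.
Qed.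

(** The odds of the response are e^th, so bounds on its mean bound e^(th/2) and
e^(-th/2). *)
Lemma half_expR_le th (b1 b2 : R) : 0 < b1 -> b2 < 1 ->
  b1 <= logistic th -> logistic th <= b2 ->
  w th <= b1^-1 + (1 - b2)^-1 /\ v th <= b1^-1 + (1 - b2)^-1.
Proof.
move=> b10 b21; rewrite logistic_half.
have wv := half_expR_mul th; have s0 := half_expR_sum_gt0 th.
have w0 := expR_gt0 (th / 2); have v0 := expR_gt0 (- (th / 2)).
rewrite ler_pdivlMr// ler_pdivrMr// => h1 h2.
have c0 : 0 < 1 - b2 by rewrite subr_gt0.
have [i1 i2] : 0 < b1^-1 /\ 0 < (1 - b2)^-1 by rewrite !invr_gt0.
have e1 : b1 * b1^-1 = 1 by rewrite divff// gt_eqF.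
have e2 : (1 - b2) * (1 - b2)^-1 = 1 by rewrite divff// gt_eqF.
move: (w th) (v th) b1^-1 (1 - b2)^-1 => a b i j in wv s0 w0 v0 h1 h2 i1 i2 e1 e2 *.
have a2 : a ^+ 2 <= j by nra.
have b2' : b ^+ 2 <= i by nra.
have i1' : 1 <= i by nra.
have j1' : 1 <= j by nra.
split; nra.
Qed.

End Logistic.

(** * Linearisation of the estimating equation *)

Lemma sumr_const2 (R : realType) (m : nat) (c : R) :
  \sum_(j < m) \sum_(k < m) c = m%:R ^+ 2 * c.
Proof.
by rewrite !sumr_const !card_ord -mulrnA -[LHS]mulr_natl natrM expr2.
Qed.

Section Linearization.
Variables (R : realType) (n m p : nat) (X : 'I_n -> 'M[R]_(m, p)).

(** Paired with a row vector, the score is a sum of scalars: A^(1/2) contributes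
[binsd], and A^(-1/2) (Y - pi) consists of Pearson residuals. *)
Lemma score_scalarE (y : 'I_n -> 'cV[R]_m) (Rhat : 'M[R]_m) (b : 'cV[R]_p) (vr : 'rV[R]_p) :
  (vr *m gee_S X y Rhat b) 0 0 = \sum_i \sum_j \sum_k
    (vr *m (X i)^T) 0 j * binsd ((X i *m b) j 0) * invmx Rhat j k
    * pearson ((X i *m b) k 0) (y i k 0).
Proof.
rewrite /gee_S mulmx_sumr summxE; apply: eq_bigr => i _.
rewrite -!mulmxA mulmxA mxE; apply: eq_bigr => j _.
rewrite mul_diag_mx !mxE !mulr_sumr; apply: eq_bigr => k _.
by rewrite mul_diag_mx !mxE /pearson /binsd /gee_var !mxE !mulrA.
Qed.

Lemma hessian_scalarE (Rbar : 'M[R]_m) (b del : 'cV[R]_p) (vr : 'rV[R]_p) :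
  (vr *m gee_H X Rbar b *m del) 0 0 = \sum_i \sum_j \sum_k
    (vr *m (X i)^T) 0 j * binsd ((X i *m b) j 0) * invmx Rbar j k
    * (binsd ((X i *m b) k 0) * (X i *m del) k 0).
Proof.
rewrite /gee_H mulmx_sumr mulmx_suml summxE; apply: eq_bigr => i _.
rewrite -!mulmxA mulmxA mxE; apply: eq_bigr => j _.
rewrite mul_diag_mx !mxE !mulr_sumr; apply: eq_bigr => k _.
by rewrite mul_diag_mx !mxE /binsd /gee_var !mxE !mulrA.
Qed.

Variables (y : 'I_n -> 'cV[R]_m) (b0 b : 'cV[R]_p) (Rhat Rbar : 'M[R]_m).
Variable vr : 'rV[R]_p.
Local Notation th i j := ((X i *m b0) j 0).
Local Notation u i j := ((X i *m (b - b0)) j 0).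
Local Notation al i j := ((vr *m (X i)^T) 0 j).

(** The right-hand sides [t1] to [t5] bound, for each pair (j, k): the leading
sum, the two sums with the first derivatives of [binsd] and of [pearson], the
Hessian term, and the Taylor remainder. In the second first-order sum the mean
[- binsd] of [pearson1] has been moved to the Hessian term, so that what is left
is centred. *)
Lemma linearization (e1 g t1 t2 t3 t4 t5 : R) :
  gee_S X y Rhat b = 0 ->
  (forall j k, `|invmx Rhat j k - invmx Rbar j k| <= e1) ->
  (forall j k, `|invmx Rbar j k| <= g) ->
  (forall j k, `|\sum_i al i j * binsd (th i j) * pearson (th i k) (y i k 0)| <= t1) ->
  (forall j k, `|\sum_i al i j * binsd1 (th i j) * pearson (th i k) (y i k 0) * u i j| <= t2) ->
  (forall j k, `|\sum_i al i j * binsd (th i j)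
      * (pearson1 (th i k) (y i k 0) + binsd (th i k)) * u i k| <= t3) ->
  (forall j k, `|\sum_i al i j * binsd (th i j) * binsd (th i k) * u i k| <= t4) ->
  (forall j k, `|\sum_i al i j * (binsd (th i j + u i j) * pearson (th i k + u i k) (y i k 0) -
    (binsd (th i j) * pearson (th i k) (y i k 0) + binsd1 (th i j) * pearson (th i k) (y i k 0) * u i j
     + binsd (th i j) * pearson1 (th i k) (y i k 0) * u i k))| <= t5) ->
  `|(vr *m gee_S X y Rbar b0) 0 0 - (vr *m gee_H X Rbar b0 *m (b - b0)) 0 0|
  <= m%:R ^+ 2 * (e1 * (t1 + t4) + (g + e1) * (t2 + t3 + t5)).
Proof.
move=> S0 GE Gg T1 T2 T3 T4 T5.
have : (vr *m gee_S X y Rhat b) 0 0 = 0 by rewrite S0 mulmx0 mxE.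
rewrite !score_scalarE hessian_scalarE => S0'.
have swap (F : 'I_n -> 'I_m -> 'I_m -> R) :
    \sum_i \sum_j \sum_k F i j k = \sum_j \sum_k \sum_i F i j k.
  rewrite exchange_big /=; apply: eq_bigr => j _.
  by rewrite exchange_big.
(* Subtract the estimating equation and compare for each pair (j, k). *)
rewrite -[X in `|X|]subr0 -[X in `|_ - X|]S0' !swap -!sumrB.
rewrite -sumr_const2.
rewrite (le_trans (ler_norm_sum _ _ _))//; apply: ler_sum => j _.
rewrite /= -!sumrB (le_trans (ler_norm_sum _ _ _))//; apply: ler_sum => k _.
have thb i l : (X i *m b) l 0 = th i l + u i l.
  by rewrite -[b in LHS](subrK b0) mulmxDr mxE addrC.
set s1 := \sum_i al i j * binsd (th i j) * pearson (th i k) (y i k 0).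
set s2 := \sum_i al i j * binsd1 (th i j) * pearson (th i k) (y i k 0) * u i j.
set s3 := \sum_i al i j * binsd (th i j) * (pearson1 (th i k) (y i k 0) + binsd (th i k)) * u i k.
set s4 := \sum_i al i j * binsd (th i j) * binsd (th i k) * u i k.
set s5 := \sum_i al i j * (binsd (th i j + u i j) * pearson (th i k + u i k) (y i k 0) -
    (binsd (th i j) * pearson (th i k) (y i k 0) + binsd1 (th i j) * pearson (th i k) (y i k 0) * u i j
     + binsd (th i j) * pearson1 (th i k) (y i k 0) * u i k)).
have := T1 j k; have := T2 j k; have := T3 j k; have := T4 j k; have := T5 j k.
rewrite -/s1 -/s2 -/s3 -/s4 -/s5 => h5 h4 h3 h2 h1.
have := GE j k; have := Gg j k.
set Gh := invmx Rhat j k; set G := invmx Rbar j k => hG hGh.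
have -> : \sum_i al i j * binsd (th i j) * G * pearson (th i k) (y i k 0) = G * s1.
  by rewrite mulr_sumr; apply: eq_bigr => i _; ring.
have -> : \sum_i al i j * binsd (th i j) * G * (binsd (th i k) * u i k) = G * s4.
  by rewrite mulr_sumr; apply: eq_bigr => i _; ring.
have -> : \sum_i al i j * binsd ((X i *m b) j 0) * Gh * pearson ((X i *m b) k 0) (y i k 0)
   = Gh * (s1 + s2 + (s3 - s4) + s5).
  rewrite /s1 /s2 /s3 /s4 /s5 -sumrB -!big_split /= mulr_sumr.
  by apply: eq_bigr => i _; rewrite !thb; ring.
have -> : G * s1 - G * s4 - Gh * (s1 + s2 + (s3 - s4) + s5) =
   (Gh - G) * (s4 - s1) + - (G + (Gh - G)) * (s2 + s3 + s5) by ring.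
rewrite (le_trans (ler_normD _ _))// !normrM normrN.
rewrite lerD//; apply: ler_pM => //.
- by rewrite (le_trans (ler_normB _ _))// [leRHS]addrC lerD.
- by rewrite (le_trans (ler_normD _ _))// lerD.
- by rewrite (le_trans (ler_normD _ _))// lerD// (le_trans (ler_normD _ _))// lerD.
Qed.

End Linearization.

(** * Bounds on the matrices of the sandwich formula *)

Section LinearAlgebra.
Variable R : realType.

Definition sqnorm (k : nat) (v : 'cV[R]_k) : R := \sum_i v i 0 ^+ 2.

Lemma sqnormE k (v : 'cV[R]_k) : sqnorm v = (v^T *m v) 0 0.
Proof. by rewrite mxE; apply: eq_bigr => i _; rewrite mxE expr2. Qed.

Lemma sqnorm_ge0 k (v : 'cV[R]_k) : 0 <= sqnorm v.
Proof. by apply: sumr_ge0 => i _; rewrite sqr_ge0. Qed.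

Lemma sqnorm_eq0 k (v : 'cV[R]_k) : (sqnorm v == 0) = (v == 0).
Proof.
apply/idP/eqP => [|->]; last first.
  by rewrite /sqnorm big1// => i _; rewrite mxE expr2 mul0r.
rewrite /sqnorm psumr_eq0 => [/allP v0|i _]; last exact: sqr_ge0.
apply/colP => i; rewrite mxE; apply/eqP.
by have := v0 i (mem_index_enum i); rewrite /= sqrf_eq0.
Qed.

Lemma sqnorm_mul_bounds k (A : 'M[R]_k) (v : 'cV[R]_k) : A^T = A -> 0 <= lambda_min A ->
  lambda_min A ^+ 2 * sqnorm v <= sqnorm (A *m v) <= lambda_max A ^+ 2 * sqnorm v.
Proof.
case: k A v => [|k] A v As A0.
  by rewrite /sqnorm !big_ord0 !mulr0 lexx.
have [mu [w [mu_eig w0 horner_w _]]] := symmetric_spectral As.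
have := horner_w 1 v; rewrite rmorph1 mulmx1 -sqnormE => ->.
have := horner_w ('X * 'X) v; rewrite rmorphM /= horner_mx_X => E2.
have -> : sqnorm (A *m v) = \sum_i ('X * 'X).[mu i] * w v i.
  by rewrite -E2 sqnormE trmx_mul As !mulmxA.
have [lb ub] := symmetric_eigenvalues_bounded As.
have min_mu i : lambda_min A <= mu i by apply: ge_inf => //; exact: mu_eig.
have mu_max i : mu i <= lambda_max A by apply: ub_le_sup => //; exact: mu_eig.
have mu0 i : 0 <= mu i by exact: le_trans (min_mu i).
apply/andP; split; rewrite mulr_sumr; apply: ler_sum => i _;
  rewrite hornerC hornerM hornerX -expr2 mul1r ler_wpM2r// ler_sqr ?nnegrE//.
exact: le_trans (mu_max i).
Qed.

Lemma unitmx_of_posdef k (A : 'M[R]_k) :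
  (forall v : 'cV[R]_k, v != 0 -> 0 < (v^T *m A *m v) 0 0) -> A \in unitmx.
Proof.
move=> Apos; rewrite -row_free_unit -kermx_eq0; apply/eqP/row_matrixP => i.
rewrite row0; apply/eqP; apply: contraT => vn0.
have kA : row i (kermx A) *m A = 0 by rewrite -row_mul mulmx_ker row0.
have := Apos (row i (kermx A))^T.
rewrite trmxK kA mul0mx mxE ltxx; apply.
by rewrite trmx_eq0.
Qed.

Lemma cauchy_schwarz (I : finType) (f g : I -> R) :
  (\sum_i f i * g i) ^+ 2 <= (\sum_i f i ^+ 2) * (\sum_i g i ^+ 2).
Proof.
have : 0 <= \sum_i \sum_j (f i * g j - f j * g i) ^+ 2.
  by apply: sumr_ge0 => i _; apply: sumr_ge0 => j _; exact: sqr_ge0.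
have -> : \sum_i \sum_j (f i * g j - f j * g i) ^+ 2 =
    (\sum_i f i ^+ 2) * (\sum_i g i ^+ 2) *+ 2 - (\sum_i f i * g i) ^+ 2 *+ 2.
  rewrite expr2 !big_distrlr /= -!sumrMnl.
  transitivity (\sum_i \sum_j (f i ^+ 2 * g j ^+ 2 + f j ^+ 2 * g i ^+ 2
      - (f i * g i * (f j * g j)) *+ 2)).
    by apply: eq_bigr => i _; apply: eq_bigr => j _; ring.
  under eq_bigr do rewrite sumrB big_split /=.
  rewrite sumrB big_split /=; congr (_ - _).
    rewrite [X in _ + X]exchange_big /= -big_split /=.
    by apply: eq_bigr => i _; rewrite mulr2n.
  by apply: eq_bigr => i _; rewrite -sumrMnl.
by rewrite subr_ge0 lerMn2r.
Qed.

Lemma lambda_min_le_max k (A : 'M[R]_k) : (0 < k)%N -> A^T = A ->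
  lambda_min A <= lambda_max A.
Proof.
case: k A => // k A _ As.
pose v : 'cV[R]_k.+1 := delta_mx 0 0.
have v1 : sqnorm v = 1.
  rewrite /sqnorm (bigD1 0)//= big1 ?addr0.
    by rewrite mxE eqxx expr1n.
  by move=> i /negPf i0; rewrite mxE i0 expr2 mul0r.
have := le_trans (lambda_min_le v As) (le_lambda_max v As).
by rewrite -/(sqnorm v) v1 !mulr1.
Qed.

Lemma gram_bounds n m p (X : 'I_n -> 'M[R]_(m, p)) (b3 b4 : R) (v : 'cV[R]_p) :
  (0 < n)%N ->
  b3 <= lambda_min (n%:R^-1 *: \sum_i ((X i)^T *m X i)) ->
  lambda_max (n%:R^-1 *: \sum_i ((X i)^T *m X i)) <= b4 ->
  b3 * n%:R * sqnorm v <= \sum_i sqnorm (X i *m v) <= b4 * n%:R * sqnorm v.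
Proof.
move=> n0; set Q := _ *: _ => h3 h4.
have Qs : Q^T = Q.
  rewrite /Q linearZ /= raddf_sum; congr (_ *: _); apply: eq_bigr => i _.
  by rewrite /= trmx_mul trmxK.
have QE : \sum_i sqnorm (X i *m v) = (v^T *m Q *m v) 0 0 * n%:R.
  rewrite /Q -scalemxAr -scalemxAl mxE mulrAC mulVf ?mul1r; last by rewrite pnatr_eq0 -lt0n.
  rewrite mulmx_sumr mulmx_suml summxE; apply: eq_bigr => i _.
  by rewrite sqnormE trmx_mul !mulmxA.
have nR : 0 <= n%:R :> R by [].
rewrite QE ![_ * n%:R * _]mulrAC !ler_wpM2r//.
  by rewrite (le_trans (le_lambda_max v Qs))// -/(sqnorm v) ler_wpM2r ?sqnorm_ge0.
by rewrite (le_trans _ (lambda_min_le v Qs))// -/(sqnorm v) ler_wpM2r ?sqnorm_ge0.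
Qed.

Section WorkingInverse.
Variables (m : nat) (Rbar : 'M[R]_m) (s1 s2 : R).
Hypotheses (m0 : (0 < m)%N) (Rpos : posdef Rbar) (s10 : 0 < s1)
  (hs1 : s1 <= lambda_min Rbar) (hs2 : lambda_max Rbar <= s2).
Local Notation G := (invmx Rbar).

Lemma posdef_unitmx : Rbar \in unitmx.
Proof. by apply: unitmx_of_posdef; case: Rpos. Qed.

Lemma invmx_sym : G^T = G.
Proof. by rewrite trmx_inv; case: Rpos => ->. Qed.

Lemma lambda_max_gt0 : 0 < lambda_max Rbar.
Proof.
rewrite (lt_le_trans s10)// (le_trans hs1)// lambda_min_le_max//.
by case: Rpos.
Qed.

Lemma sqnorm_invmx_le (w : 'cV[R]_m) : s1 ^+ 2 * sqnorm (G *m w) <= sqnorm w.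
Proof.
have lam0 : 0 <= lambda_min Rbar by rewrite (le_trans (ltW s10)).
have /andP[+ _] := sqnorm_mul_bounds (G *m w) Rpos.1 lam0.
rewrite mulKVmx ?posdef_unitmx//; apply: le_trans.
by rewrite ler_wpM2r ?sqnorm_ge0// ler_sqr ?nnegrE// ltW.
Qed.

Lemma sqnorm_le_invmx (w : 'cV[R]_m) : sqnorm w <= s2 ^+ 2 * sqnorm (G *m w).
Proof.
have lam0 : 0 <= lambda_min Rbar by rewrite (le_trans (ltW s10)).
have /andP[_] := sqnorm_mul_bounds (G *m w) Rpos.1 lam0.
rewrite mulKVmx ?posdef_unitmx// => /le_trans; apply.
have := lambda_max_gt0 => l0.
by rewrite ler_wpM2r ?sqnorm_ge0// ler_sqr ?nnegrE ?(ltW l0)// (le_trans (ltW l0)).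
Qed.

Lemma invmx_entry_le j k : `|G j k| <= s1^-1.
Proof.
rewrite -ler_sqr ?nnegrE ?invr_ge0 ?(ltW s10)// real_normK ?num_real//.
have := sqnorm_invmx_le (delta_mx k 0).
have -> : sqnorm (delta_mx k 0 : 'cV[R]_m) = 1.
  rewrite /sqnorm (bigD1 k)//= big1 ?addr0; first by rewrite mxE !eqxx expr1n.
  by move=> i /negPf ik; rewrite mxE ik expr2 mul0r.
rewrite mulrC -ler_pdivlMr ?exprn_gt0// mul1r -exprVn; apply: le_trans.
rewrite /sqnorm (bigD1 j)//= -colE mxE lerDl sumr_ge0// => i _; exact: sqr_ge0.
Qed.

End WorkingInverse.

Section GeeMatrices.
Variables (n m p : nat) (X : 'I_n -> 'M[R]_(m, p)) (b0 : 'cV[R]_p).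
Variables (R0 Rbar : 'M[R]_m) (s1 s2 r1 b3 c0 : R).
Hypotheses (n0 : (0 < n)%N) (m0 : (0 < m)%N) (Rpos : posdef Rbar) (s10 : 0 < s1)
  (hs1 : s1 <= lambda_min Rbar) (hs2 : lambda_max Rbar <= s2).
Hypotheses (R0s : R0^T = R0) (r10 : 0 < r1) (hr1 : r1 <= lambda_min R0).
Hypotheses (b30 : 0 < b3) (c00 : 0 < c0)
  (hc0 : forall i j, c0 <= binsd ((X i *m b0) j 0)).
Hypothesis gram : forall v, b3 * n%:R * sqnorm v <= \sum_i sqnorm (X i *m v).
Local Notation G := (invmx Rbar).
Local Notation H := (gee_H X Rbar b0).
Local Notation M := (gee_M X R0 Rbar b0).
Local Notation A i := (gee_Ahalf (X i) b0).

Lemma gee_Ahalf_sym i : (A i)^T = A i. Proof. exact: tr_diag_mx. Qed.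

Lemma sqnorm_Ahalf i (z : 'cV[R]_m) : c0 ^+ 2 * sqnorm z <= sqnorm (A i *m z).
Proof.
rewrite /sqnorm mulr_sumr; apply: ler_sum => j _.
rewrite mul_diag_mx !mxE exprMn ler_wpM2r ?sqr_ge0//.
have h := hc0 i j; rewrite ler_sqr ?nnegrE ?(ltW c00)//.
  by move: h; rewrite /binsd /gee_var !mxE.
Qed.

Lemma gee_H_sym : H^T = H.
Proof.
rewrite /gee_H raddf_sum; apply: eq_bigr => i _ /=.
by rewrite !trmx_mul trmxK gee_Ahalf_sym (invmx_sym Rpos) !mulmxA.
Qed.

Lemma gee_H_form (v : 'cV[R]_p) :
  (v^T *m H *m v) 0 0 =
  \sum_i ((G *m (A i *m (X i *m v)))^T *m Rbar *m (G *m (A i *m (X i *m v)))) 0 0.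
Proof.
rewrite /gee_H mulmx_sumr mulmx_suml summxE; apply: eq_bigr => i _.
rewrite !trmx_mul (invmx_sym Rpos) gee_Ahalf_sym.
by rewrite -!mulmxA [Rbar *m _]mulmxA mulmxV ?posdef_unitmx// mul1mx.
Qed.

Lemma gee_M_form (v1 v2 : 'rV[R]_p) :
  (v1 *m M *m v2^T) 0 0 =
  \sum_i ((v1 *m (X i)^T *m A i *m G) *m R0 *m (v2 *m (X i)^T *m A i *m G)^T) 0 0.
Proof.
rewrite /gee_M mulmx_sumr mulmx_suml summxE; apply: eq_bigr => i _.
by rewrite !trmx_mul (invmx_sym Rpos) gee_Ahalf_sym trmxK !mulmxA.
Qed.

Let sum_lb (v : 'cV[R]_p) :
  c0 ^+ 2 * (b3 * n%:R * sqnorm v) <= s2 ^+ 2 * \sum_i sqnorm (G *m (A i *m (X i *m v))).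
Proof.
rewrite (le_trans (ler_wpM2l (sqr_ge0 _) (gram v)))// !mulr_sumr.
apply: ler_sum => i _; apply: le_trans (sqnorm_Ahalf _ _) _.
exact: (sqnorm_le_invmx m0 Rpos s10 hs1 hs2).
Qed.

Lemma gee_H_unit : H \in unitmx.
Proof.
apply: unitmx_of_posdef => v v0.
have v_gt0 : 0 < sqnorm v by rewrite lt_def sqnorm_eq0 v0 sqnorm_ge0.
have lb := sum_lb v.
have pos : 0 < c0 ^+ 2 * (b3 * n%:R * sqnorm v).
  by rewrite !mulr_gt0 ?exprn_gt0// ltr0n.
have S0 : 0 < \sum_i sqnorm (G *m (A i *m (X i *m v))).
  rewrite ltNge; apply/negP => S0; have := lt_le_trans pos lb; rewrite ltNge => /negP; apply.
  by rewrite mulr_ge0_le0 ?sqr_ge0.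
apply: (@lt_le_trans _ _ (s1 * \sum_i sqnorm (G *m (A i *m (X i *m v))))).
  by rewrite mulr_gt0.
rewrite gee_H_form mulr_sumr; apply: ler_sum => i _.
set z := G *m _; rewrite (le_trans _ (lambda_min_le z Rpos.1))//.
by rewrite -/(sqnorm z) ler_wpM2r ?sqnorm_ge0.
Qed.

(** The quadratic form of M is a sum of forms of [R0] at the vectors
G A_i X_i v^T, and each of [R0], [G], [A i] and the Gram matrix is bounded
below. *)
Lemma gee_M_lower (v : 'rV[R]_p) :
  r1 * (c0 ^+ 2 * (b3 * n%:R * sqnorm v^T)) <= s2 ^+ 2 * (v *m M *m v^T) 0 0.
Proof.
have := ler_wpM2l (ltW r10) (sum_lb v^T).
move/le_trans; apply; rewrite mulrCA ler_wpM2l ?sqr_ge0// gee_M_form mulr_sumr.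
apply: ler_sum => i _.
have -> : (v *m (X i)^T *m A i *m G) = (G *m (A i *m (X i *m v^T)))^T.
  by rewrite !trmx_mul trmxK (invmx_sym Rpos) gee_Ahalf_sym.
rewrite trmxK; set z := G *m _; rewrite (le_trans _ (lambda_min_le z R0s))//.
by rewrite -/(sqnorm z) ler_wpM2r ?sqnorm_ge0.
Qed.

Lemma gee_M_psd : possemidef M.
Proof.
split.
  rewrite /gee_M raddf_sum; apply: eq_bigr => i _ /=.
  by rewrite !trmx_mul trmxK gee_Ahalf_sym (invmx_sym Rpos) R0s !mulmxA.
move=> v; rewrite -{2}[v]trmxK gee_M_form; apply: sumr_ge0 => i _.
set z := _ *m G; rewrite -{1}[z]trmxK (le_trans _ (lambda_min_le z^T R0s))//.
apply: mulr_ge0; [exact: le_trans (ltW r10) hr1|exact: sqnorm_ge0].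
Qed.

(** [V] is W H^-1, where W is the studentising matrix. *)
Lemma studentized (l : nat) (L : 'M[R]_(l, p)) :
  let LSL := L *m gee_Sigma X R0 Rbar b0 *m L^T in
  LSL \in unitmx ->
  exists V : 'M[R]_(l, p),
    invmx (sqrtmx LSL) *m L = V *m H /\ V *m M *m V^T = 1%:M.
Proof.
move=> LSL LSLu.
pose U := L *m invmx H.
have Hs : (invmx H)^T = invmx H by rewrite trmx_inv gee_H_sym.
have LSLE : LSL = U *m M *m U^T.
  by rewrite /LSL /gee_Sigma /U trmx_mul Hs !mulmxA.
have psd : possemidef LSL.
  rewrite LSLE; have [Ms M0] := gee_M_psd; split.
    by rewrite [LHS]trmx_mul [(U *m M)^T]trmx_mul trmxK Ms mulmxA.
  move=> v; have := M0 (U^T *m v).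
  by rewrite [(U^T *m v)^T]trmx_mul trmxK !mulmxA.
have [[Bs B0] BB] := sqrtmxP psd; set B := sqrtmx LSL in Bs B0 BB *.
have Bu : B \in unitmx.
  by move: LSLu; rewrite -BB unitmx_mul => /andP[].
exists (invmx B *m U); split.
  by rewrite /U -!mulmxA mulVmx ?gee_H_unit// mulmx1.
have -> : (invmx B *m U)^T = U^T *m invmx B by rewrite [LHS]trmx_mul trmx_inv Bs.
have -> : invmx B *m U *m M *m (U^T *m invmx B) = invmx B *m (U *m M *m U^T) *m invmx B.
  by clearbody U; rewrite !mulmxA.
by rewrite -LSLE -BB mulmxA mulVmx// mul1mx mulmxV.
Qed.

End GeeMatrices.

End LinearAlgebra.

(** * The law of the binary responses *)

Section FiniteRange.
Variables (R : realType) (d : measure_display) (T : measurableType d)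
  (P : probability T R) (S : finType) (g : T -> S).
Hypothesis mg : forall s, measurable [set w | g w = s].

Lemma measurable_fiber_pred (A : pred S) : measurable [set w | A (g w)].
Proof.
have -> : [set w | A (g w)] = \bigcup_(s in [set s | A s]) [set w | g w = s].
  apply/seteqP; split => w /=; first by move=> Aw; exists (g w).
  by case=> s As ->.
exact: fin_bigcup_measurable.
Qed.

Lemma fin_expectation (F : S -> R) :
  'E_P[fun w => F (g w)]%E = (\sum_s fine (P [set w | g w = s]) * F s)%:E.
Proof.
rewrite unlock.
have FE w : (F (g w))%:E = (\sum_s (F s)%:E * (\1_[set w | g w = s] w)%:E)%E.
  rewrite (bigD1 (g w))//= big1.
    by rewrite adde0 indicE mem_set//= mule1.
  by move=> s sg; rewrite indicE memNset ?mule0//= => gs; rewrite gs eqxx in sg.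
under eq_integral do rewrite FE.
have iI s : P.-integrable setT (fun w => (\1_[set w | g w = s] w)%:E).
  exact: (integrable_indic P (mg s)).
rewrite integral_sum//; last by move=> s; exact: integrableZl.
rewrite -sumEFin; apply: eq_bigr => s _.
rewrite integralZl// integral_indic// setIT EFinM muleC; congr (_ * _)%E.
by rewrite fineK// fin_num_measure.
Qed.

Lemma fin_law_sum1 : \sum_s fine (P [set w | g w = s]) = 1.
Proof.
apply: EFin_inj; have := fin_expectation (fun=> 1).
under eq_bigr do rewrite mulr1; move=> <-.
exact: expectation_cst.
Qed.

Lemma fin_law_pred (A : pred S) :
  P [set w | A (g w)] = (\sum_s fine (P [set w | g w = s]) * (A s)%:R)%:E.
Proof.
rewrite -fin_expectation -expectation_indic; last exact: measurable_fiber_pred.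
congr ('E_P[_]%E); apply/funext => w; rewrite indicE.
by case: (boolP (A (g w))) => Aw; [rewrite mem_set|rewrite memNset//=; exact/negP].
Qed.

Lemma fin_covariance (F1 F2 : S -> R) :
  let q s := fine (P [set w | g w = s]) in
  let mean F := \sum_s q s * F s in
  covariance P (fun w => F1 (g w)) (fun w => F2 (g w)) =
    (\sum_s q s * ((F1 s - mean F1) * (F2 s - mean F2)))%:E.
Proof.
move=> q mean; rewrite unlock !fin_expectation /=.
rewrite -[RHS](fin_expectation (fun s => (F1 s - mean F1) * (F2 s - mean F2))).
by congr ('E_P[_]%E).
Qed.

End FiniteRange.

Section BinaryClusters.
Variables (R : realType) (d : measure_display) (T : measurableType d)
  (P : probability T R) (n m p : nat) (Y : 'I_n -> T -> 'cV[R]_m).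
Hypotheses (Ymeas : forall i, measurable_mx (Y i))
  (Ybin : forall i w j, Y i w j 0 = 0 \/ Y i w j 0 = 1)
  (Yind : independent_vectors P Y).

(** The responses as elements of finite types, where their law is a finite
table. *)
Definition bits i w : {ffun 'I_m -> bool} := [ffun j => Y i w j 0 == 1].
Definition allbits w : {ffun 'I_n -> {ffun 'I_m -> bool}} := [ffun i => bits i w].
Definition blaw i s : R := fine (P [set w | bits i w = s]).

Lemma bitsE i w j : Y i w j 0 = (bits i w j)%:R.
Proof.
rewrite ffunE; have [->|->] := Ybin i w j; last by rewrite eqxx.
by rewrite eq_sym oner_eq0.
Qed.

Let bits_fiberE i s : [set w | bits i w = s] =
  [set w | [set t : m.-tuple R | forall j, tnth t j = (s j)%:R] (tuple_of_cV (Y i w))].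
Proof.
apply/seteqP; split => w /=.
  by move=> <- j; rewrite tnth_mktuple bitsE.
move=> h; apply/ffunP => j; have := h j; rewrite tnth_mktuple bitsE.
by case: (bits i w j) (s j) => [] [] //= /eqP; rewrite ?oner_eq0// eq_sym oner_eq0.
Qed.

Lemma measurable_bits i s : measurable [set w | bits i w = s].
Proof.
have -> : [set w | bits i w = s] =
    \bigcap_(j in [set: 'I_m]) ((fun w => Y i w j 0) @^-1` [set (s j)%:R]).
  rewrite bits_fiberE; apply/seteqP; split => w /= h j.
    by move=> _; have := h j; rewrite tnth_mktuple.
  by rewrite tnth_mktuple; exact: h.
apply: fin_bigcap_measurable => // j _.
by rewrite -[X in measurable X]setTI; apply: Ymeas.
Qed.

Lemma measurable_allbits y : measurable [set w | allbits w = y].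
Proof.
have -> : [set w | allbits w = y] = \bigcap_(i in [set: 'I_n]) [set w | bits i w = y i].
  apply/seteqP; split => w /=; first by move=> <- i _ /=; rewrite ffunE.
  by move=> h; apply/ffunP => i; rewrite ffunE; exact: h.
by apply: fin_bigcap_measurable => // i _; exact: measurable_bits.
Qed.

Lemma blaw_ge0 i s : 0 <= blaw i s. Proof. exact: fine_ge0. Qed.

Lemma blaw_sum1 i : \sum_s blaw i s = 1.
Proof. by apply: fin_law_sum1; exact: measurable_bits. Qed.

(** This is where the independence of the clusters is used. *)
Lemma allbits_law y : fine (P [set w | allbits w = y]) = \prod_i blaw i (y i).
Proof.
have mB i : measurable [set t : m.-tuple R | forall j, tnth t j = (y i j)%:R].
  have -> : [set t : m.-tuple R | forall j, tnth t j = (y i j)%:R] =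
     \bigcap_(j in [set: 'I_m]) ((@tnth m R)^~ j @^-1` [set (y i j)%:R]).
    by apply/seteqP; split => t /= h j; have := h j => //; apply.
  apply: fin_bigcap_measurable => // j _.
  by rewrite -[X in measurable X]setTI; exact: measurable_tnth.
have := Yind [set: 'I_n]%SET mB.
have -> : [set w | allbits w = y] =
    [set w | forall i, i \in [set: 'I_n]%SET ->
      [set t : m.-tuple R | forall j, tnth t j = (y i j)%:R] (tuple_of_cV (Y i w))].
  apply/seteqP; split => w /=.
    move=> <- i _ j; rewrite tnth_mktuple bitsE.
    by rewrite [in RHS]ffunE.
  move=> h; apply/ffunP => i; rewrite ffunE.
  have := h i (finset.in_setT i).
  by move: (bits_fiberE i (y i)) => /seteqP[_ +]; exact.
move=> ->; apply: EFin_inj.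
set Pr := (X in fine X); suff -> : Pr = (\prod_i blaw i (y i))%:E by [].
rewrite /Pr -prodEFin; apply: eq_big => [i|i _]; first by rewrite finset.in_setT.
by rewrite -bits_fiberE /blaw fineK// fin_num_measure//; exact: measurable_bits.
Qed.

Lemma allbits_pred (A : pred {ffun 'I_n -> {ffun 'I_m -> bool}}) :
  P [set w | A (allbits w)] = (pexp blaw (fun y => (A y)%:R))%:E.
Proof.
rewrite (fin_law_pred P measurable_allbits); congr (_%:E).
by apply: eq_bigr => y _; rewrite allbits_law.
Qed.

Variables (X : 'I_n -> 'M[R]_(m, p)) (b0 : 'cV[R]_p) (R0 : 'M[R]_m).
Hypothesis Ymean : forall i j,
  ('E_P[fun w => (Y i w j 0)%R] = ((gee_pi (X i) b0 j 0)%R)%:E)%E.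
Hypothesis Ycorr : forall i, corrmx P (Y i) = R0.
Local Notation th i j := ((X i *m b0) j 0).

Let YE i j : (fun w => Y i w j 0) = (fun w => (fun s : {ffun 'I_m -> bool} => (s j)%:R) (bits i w)).
Proof. by apply/funext => w; rewrite bitsE. Qed.

Lemma blaw_mean i j : \sum_s blaw i s * (s j)%:R = logistic (th i j).
Proof.
have := Ymean i j; rewrite YE (fin_expectation P (measurable_bits i) (fun s => (s j)%:R)).
by rewrite mxE; exact: EFin_inj.
Qed.

(** A function of one binary response is affine in it. *)
Lemma blaw_affine i j (f0 f1 : R) : 
  \sum_s blaw i s * (if s j then f1 else f0) =
    logistic (th i j) * f1 + (1 - logistic (th i j)) * f0.
Proof.
rewrite -blaw_mean -{2}(blaw_sum1 i) mulr_suml -sumrB mulr_suml -big_split /=.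
by apply: eq_bigr => s _; case: (s j); rewrite /=; ring.
Qed.

Lemma blaw_res_mean i j : \sum_s blaw i s * pearson (th i j) (s j)%:R = 0.
Proof.
rewrite -[RHS](pearson_mean (th i j)) -blaw_affine.
by apply: eq_bigr => s _; case: (s j).
Qed.

Lemma blaw_res1_mean i j :
  \sum_s blaw i s * (pearson1 (th i j) (s j)%:R + binsd (th i j)) = 0.
Proof.
rewrite -[RHS](pearson1_mean (th i j)) -blaw_affine.
by apply: eq_bigr => s _; case: (s j).
Qed.

(** The residuals are the standardised responses, so their covariance is the
correlation of the responses. *)
Lemma blaw_res_cov i j k :
  \sum_s blaw i s * (pearson (th i j) (s j)%:R * pearson (th i k) (s k)%:R) = R0 j k.
Proof.
have cov j1 j2 : covariance P (fun w => Y i w j1 0) (fun w => Y i w j2 0) =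
   (\sum_s blaw i s * (((s j1)%:R - logistic (th i j1)) * ((s j2)%:R - logistic (th i j2))))%:E.
  rewrite !YE (fin_covariance P (measurable_bits i) (fun s => (s j1)%:R) (fun s => (s j2)%:R)).
  by rewrite -!blaw_mean.
rewrite -(Ycorr i) [RHS]mxE /correlation cov.
have var j1 : Num.sqrt (fine (variance P (fun w => Y i w j1 0))) = binsd (th i j1).
  rewrite /variance cov /= /binsd; congr Num.sqrt.
  transitivity (\sum_s blaw i s *
      (if s j1 then (1 - logistic (th i j1)) ^+ 2 else (0 - logistic (th i j1)) ^+ 2)).
    by apply: eq_bigr => s _; rewrite -expr2; case: (s j1).
  by rewrite blaw_affine; ring.
rewrite !var /= mulr_suml; apply: eq_bigr => s _.
rewrite /pearson; field.
by rewrite !gt_eqF ?binsd_gt0.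
Qed.

End BinaryClusters.

(** * Leading term and remainder for a given sample size *)

Section FixedSize.
Variables (R : realType) (n m p l : nat).
Variables (X : 'I_n -> 'M[R]_(m, p)) (b0 : 'cV[R]_p) (R0 Rbar : 'M[R]_m) (V : 'M[R]_(l, p)).
Variable q : 'I_n -> {ffun 'I_m -> bool} -> R.
Local Notation th i j := ((X i *m b0) j 0).
Local Notation G := (invmx Rbar).
Local Notation E := (pexp q).
Local Notation al a i j := ((row a V *m (X i)^T) 0 j).
Hypotheses (q_ge0 : forall i s, 0 <= q i s) (q_sum1 : forall i, \sum_s q i s = 1).
Hypothesis q_res : forall i j, \sum_s q i s * pearson (th i j) (s j)%:R = 0.
Hypothesis q_res1 : forall i j,
  \sum_s q i s * (pearson1 (th i j) (s j)%:R + binsd (th i j)) = 0.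
Hypothesis Rpos : posdef Rbar.
Hypothesis q_cov : forall i j k,
  \sum_s q i s * (pearson (th i j) (s j)%:R * pearson (th i k) (s k)%:R) = R0 j k.

Definition response (y : {ffun 'I_n -> {ffun 'I_m -> bool}}) (i : 'I_n) : 'cV[R]_m :=
  \col_j (y i j)%:R.

(** The contribution of cluster [i] to coordinate [a] of V S(beta0). *)
Definition lead (i : 'I_n) (s : {ffun 'I_m -> bool}) (a : 'I_l) : R :=
  \sum_j \sum_k al a i j * binsd (th i j) * G j k * pearson (th i k) (s k)%:R.

Lemma wsum_lead a y :
  wsum lead a y = (row a V *m gee_S X (response y) Rbar b0) 0 0.
Proof.
rewrite score_scalarE; apply: eq_bigr => i _; apply: eq_bigr => j _.
by apply: eq_bigr => k _; rewrite [response y i k 0]mxE.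
Qed.

Let leadE i s a : lead i s a =
  \sum_k (row a V *m (X i)^T *m gee_Ahalf (X i) b0 *m G) 0 k * pearson (th i k) (s k)%:R.
Proof.
rewrite /lead exchange_big; apply: eq_bigr => k _.
rewrite [X in _ = X * _]mxE mulr_suml; apply: eq_bigr => j _; rewrite mul_mx_diag !mxE.
by rewrite /binsd /gee_var !mxE.
Qed.

Lemma lead_mean i a : \sum_s q i s * lead i s a = 0.
Proof.
under eq_bigr do rewrite leadE mulr_sumr.
rewrite exchange_big big1// => k _.
under eq_bigr do rewrite mulrCA.
by rewrite -mulr_sumr q_res mulr0.
Qed.

Lemma lead_cov a b : V *m gee_M X R0 Rbar b0 *m V^T = 1%:M ->
  \sum_i \sum_s q i s * (lead i s a * lead i s b) = (a == b)%:R.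
Proof.
move=> /matrixP/(_ a b); rewrite [RHS]mxE => <-.
transitivity ((row a V *m gee_M X R0 Rbar b0 *m (row b V)^T) 0 0); last first.
  by rewrite tr_row -row_mul [LHS]mxE [RHS]mxE; apply: eq_bigr => k _; rewrite !mxE.
rewrite gee_M_form//.
apply: eq_bigr => i _.
set ca := row a V *m _ *m _ *m _; set cb := row b V *m _ *m _ *m _.
under eq_bigr do rewrite !leadE big_distrlr /= mulr_sumr.
rewrite exchange_big /= mxE.
transitivity (\sum_j \sum_k ca 0 j * R0 j k * cb 0 k).
  apply: eq_bigr => j _; under eq_bigr do rewrite mulr_sumr.
  rewrite exchange_big; apply: eq_bigr => k _.
  rewrite -(q_cov i) mulr_sumr mulr_suml; apply: eq_bigr => s _.
  by rewrite -/ca -/cb; ring.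
rewrite exchange_big; apply: eq_bigr => k _.
rewrite [X in _ = X * _]mxE mulr_suml; apply: eq_bigr => j _.
by rewrite [cb^T k 0]mxE.
Qed.

Variables (D kap cx b4 g : R).
Hypotheses (D1 : 1 <= D) (kap0 : 0 <= kap) (cx0 : 0 <= cx) (b40 : 0 <= b4) (g0 : 0 <= g).
Hypotheses (n0 : (0 < n)%N) (p0 : (0 < p)%N).
Hypothesis thD : forall i j, expR (th i j / 2) <= D /\ expR (- (th i j / 2)) <= D.
Hypothesis V_le : forall a, sqnorm (row a V)^T <= kap / n%:R.
Hypothesis x_le : forall i j, \sum_r X i j r ^+ 2 <= cx ^+ 2 * p%:R.
Hypothesis gram_le : forall v, \sum_i sqnorm (X i *m v) <= b4 * n%:R * sqnorm v.
Hypothesis G_le : forall j k, `|G j k| <= g.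

Let nR : 0 < n%:R :> R. Proof. by rewrite ltr0n. Qed.
Let pR : 1 <= p%:R :> R. Proof. by rewrite ler1n. Qed.
Let D0 : 0 <= D. Proof. by rewrite (le_trans _ D1). Qed.

Let alE a i j : al a i j = (X i *m (row a V)^T) j 0.
Proof.
have -> : X i *m (row a V)^T = (row a V *m (X i)^T)^T by rewrite trmx_mul trmxK.
by rewrite [RHS]mxE.
Qed.

Lemma sum_al_le a j : \sum_i al a i j ^+ 2 <= b4 * kap.
Proof.
apply: (@le_trans _ _ (\sum_i sqnorm (X i *m (row a V)^T))).
  apply: ler_sum => i _; rewrite alE /sqnorm (bigD1 j)//= lerDl.
  by apply: sumr_ge0 => k _; exact: sqr_ge0.
rewrite (le_trans (gram_le _))// -mulrA ler_wpM2l//.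
by rewrite mulrC -ler_pdivlMr.
Qed.

Lemma mul_row_le i j (v : 'cV[R]_p) :
  (X i *m v) j 0 ^+ 2 <= cx ^+ 2 * p%:R * sqnorm v.
Proof.
rewrite mxE (le_trans (cauchy_schwarz _ _))// ler_wpM2r ?sqnorm_ge0//.
Qed.

Let rho : R := Num.sqrt (p%:R / n%:R).
Let sigma : R := Num.sqrt (n%:R^-1 * p%:R ^+ 3).

Let rho0 : 0 <= rho. Proof. exact: sqrtr_ge0. Qed.
Let rho2 : rho ^+ 2 = p%:R / n%:R.
Proof. by rewrite sqr_sqrtr// divr_ge0. Qed.

Lemma al_le a i j : `|al a i j| <= Num.sqrt kap * cx * rho.
Proof.
have k0 := sqrtr_ge0 kap.
rewrite -ler_sqr ?nnegrE ?mulr_ge0// real_normK ?num_real// alE.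
rewrite (le_trans (mul_row_le _ _ _))// !exprMn rho2 sqr_sqrtr//.
rewrite [leRHS](_ : _ = cx ^+ 2 * p%:R * (kap / n%:R)); last by ring.
by rewrite ler_wpM2l ?mulr_ge0 ?sqr_ge0.
Qed.

Let res_le i j (b : bool) : `|pearson (th i j) b%:R| <= D /\ `|pearson1 (th i j) b%:R| <= D.
Proof.
have [h1 h2] := thD i j.
have y01 : (b%:R : R) = 0 \/ (b%:R : R) = 1 by case: b; [right|left].
have u1 : `|0 : R| <= 1 by rewrite normr0.
by have [] := pearson_taylor y01 u1 h1 h2.
Qed.

Let binsd_le i j : `|binsd (th i j)| <= 1 /\ `|binsd1 (th i j)| <= 1.
Proof. by have [h1 h2 _ _ _] := binsd_taylor2 R. Qed.

Lemma lead_le i s a :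
  `|lead i s a| <= m%:R ^+ 2 * (Num.sqrt kap * cx * g * D) * rho.
Proof.
rewrite (le_trans (ler_norm_sum _ _ _))//.
rewrite -mulrA -sumr_const2.
apply: ler_sum => j _; rewrite (le_trans (ler_norm_sum _ _ _))//.
apply: ler_sum => k _; have := (res_le i k (s k)).1.
move: (pearson (th i k) _) => z zD; rewrite !normrM.
rewrite [leRHS](_ : _ = Num.sqrt kap * cx * rho * 1 * g * D); last by ring.
apply: ler_pM; rewrite ?mulr_ge0 ?normr_ge0//.
apply: ler_pM; rewrite ?mulr_ge0 ?normr_ge0//.
by apply: ler_pM; rewrite ?normr_ge0 ?al_le// (binsd_le i j).1.
Qed.

Let res_sqr_le i k (b : bool) : pearson (th i k) b%:R ^+ 2 <= (D + 1) ^+ 2 /\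
  (pearson1 (th i k) b%:R + binsd (th i k)) ^+ 2 <= (D + 1) ^+ 2.
Proof.
have [h1 h2] := res_le i k b; have [h3 _] := binsd_le i k.
have D10 : 0 <= D + 1 by rewrite addr_ge0.
split; rewrite -[leLHS]real_normK ?num_real// ler_sqr ?nnegrE//.
  by rewrite (le_trans h1)// lerDl.
by rewrite (le_trans (ler_normD _ _))// lerD.
Qed.

(** The squares of all centred sums that are multiplied by an estimation error in
[linearization]: the leading sums, which meet Rhat^-1 - Rbar^-1, and the two
vectors of first-order sums, which meet b - b0. The latter have a mean square
norm of order [p], whence the division by [p]. *)
Definition noise (y : {ffun 'I_n -> {ffun 'I_m -> bool}}) : R :=
  \sum_a \sum_j \sum_k (
    (\sum_i pearson (th i k) (y i k)%:R * (al a i j * binsd (th i j))) ^+ 2 +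
    \sum_r ((\sum_i pearson (th i k) (y i k)%:R * (al a i j * binsd1 (th i j) * X i j r)) ^+ 2 +
      (\sum_i (pearson1 (th i k) (y i k)%:R + binsd (th i k)) *
         (al a i j * binsd (th i j) * X i k r)) ^+ 2) / p%:R).

Definition noise_bound : R :=
  l%:R * (m%:R ^+ 2 * ((D + 1) ^+ 2 * (b4 * kap) * (1 + 2 * cx ^+ 2))).

Let term_ge0 a j k (y : {ffun 'I_n -> {ffun 'I_m -> bool}}) :
  0 <= (\sum_i pearson (th i k) (y i k)%:R * (al a i j * binsd (th i j))) ^+ 2 +
    \sum_r ((\sum_i pearson (th i k) (y i k)%:R * (al a i j * binsd1 (th i j) * X i j r)) ^+ 2 +
      (\sum_i (pearson1 (th i k) (y i k)%:R + binsd (th i k)) *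
         (al a i j * binsd (th i j) * X i k r)) ^+ 2) / p%:R.
Proof.
rewrite addr_ge0 ?sqr_ge0// sumr_ge0// => r _.
by rewrite divr_ge0 ?addr_ge0 ?sqr_ge0.
Qed.

Lemma noise_ge0 y : 0 <= noise y.
Proof.
by apply: sumr_ge0 => a _; apply: sumr_ge0 => j _; apply: sumr_ge0 => k _; exact: term_ge0.
Qed.

Lemma noise_mean : E noise <= noise_bound.
Proof.
rewrite /noise_bound /noise pexp_sum.
have -> : l%:R * (m%:R ^+ 2 * ((D + 1) ^+ 2 * (b4 * kap) * (1 + 2 * cx ^+ 2))) =
    \sum_(a < l) (m%:R ^+ 2 * ((D + 1) ^+ 2 * (b4 * kap) * (1 + 2 * cx ^+ 2))).
  by rewrite sumr_const card_ord mulr_natl.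
apply: ler_sum => a _; rewrite pexp_sum -sumr_const2; apply: ler_sum => j _.
rewrite pexp_sum; apply: ler_sum => k _.
have DD : 0 <= (D + 1) ^+ 2 by exact: sqr_ge0.
have al2 (c : 'I_n -> R) : (forall i, `|c i| <= 1) ->
    \sum_i (al a i j * c i) ^+ 2 <= b4 * kap.
  move=> c1; rewrite (le_trans _ (sum_al_le a j))//; apply: ler_sum => i _.
  rewrite exprMn -[leRHS]mulr1 ler_wpM2l ?sqr_ge0//.
  by rewrite -[leLHS]real_normK ?num_real// (@expr_le1 _ 2).
have alx2 (c : 'I_n -> R) k' : (forall i, `|c i| <= 1) ->
    \sum_r \sum_i (al a i j * c i * X i k' r) ^+ 2 <= b4 * kap * (cx ^+ 2 * p%:R).
  move=> c1; rewrite exchange_big /=.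
  apply: (@le_trans _ _ (\sum_i (al a i j * c i) ^+ 2 * (cx ^+ 2 * p%:R))).
    apply: ler_sum => i _; under eq_bigr do rewrite exprMn.
    by rewrite -mulr_sumr ler_wpM2l ?sqr_ge0.
  by rewrite -mulr_suml ler_wpM2r ?mulr_ge0 ?sqr_ge0// al2.
rewrite pexpD mulrDr mulr1; apply: lerD.
  apply: (le_trans (@pexp_sqr_sum _ _ _ _ q_ge0 q_sum1
    (fun i s => pearson (th i k) (s k)%:R)
    (fun i => al a i j * binsd (th i j)) _ (q_res ^~ k) (fun i s => (res_sqr_le i k (s k)).1))).
  by rewrite ler_wpM2l// al2// => i; exact: (binsd_le i j).1.
rewrite pexp_sum.
have -> : (D + 1) ^+ 2 * (b4 * kap) * (2 * cx ^+ 2) =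
   ((D + 1) ^+ 2 * (b4 * kap * (cx ^+ 2 * p%:R)) + (D + 1) ^+ 2 * (b4 * kap * (cx ^+ 2 * p%:R))) / p%:R.
  by field; rewrite gt_eqF// (lt_le_trans _ pR).
have h1 := alx2 (fun i => binsd1 (th i j)) j (fun i => (binsd_le i j).2).
have h2 := alx2 (fun i => binsd (th i j)) k (fun i => (binsd_le i j).1).
apply: le_trans (ler_wpM2r _ (lerD (ler_wpM2l DD h1) (ler_wpM2l DD h2))); last first.
  by rewrite invr_ge0.
rewrite !mulr_sumr -big_split /= mulr_suml; apply: ler_sum => r _.
under eq_pexp do rewrite mulrC.
rewrite pexpZ [leRHS]mulrC ler_wpM2l ?invr_ge0// pexpD lerD//.
  exact: (@pexp_sqr_sum _ _ _ _ q_ge0 q_sum1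
    (fun i s => pearson (th i k) (s k)%:R)
    (fun i => al a i j * binsd1 (th i j) * X i j r) _ (q_res ^~ k) (fun i s => (res_sqr_le i k (s k)).1)).
exact: (@pexp_sqr_sum _ _ _ _ q_ge0 q_sum1
    (fun i s => pearson1 (th i k) (s k)%:R + binsd (th i k))
    (fun i => al a i j * binsd (th i j) * X i k r) _ (q_res1 ^~ k) (fun i s => (res_sqr_le i k (s k)).2)).
Qed.

Variables (Rhat : 'M[R]_m) (b : 'cV[R]_p) (y : {ffun 'I_n -> {ffun 'I_m -> bool}}).
Variables (mb mr mq : R).
Hypotheses (mb0 : 0 <= mb) (mr0 : 0 <= mr) (mq0 : 0 <= mq).
Hypothesis S0 : gee_S X (response y) Rhat b = 0.
Hypothesis b_le : fnorm (b - b0) <= mb * rho.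
Hypothesis Rhat_le : fnorm (invmx Rhat - G) <= mr * rho.
Hypothesis noise_le : noise y <= mq.
Hypotheses (sigma1 : sigma <= 1) (sigma2 : cx * mb * sigma <= 1).

Definition remainder_constant : R :=
  m%:R ^+ 2 * (mr * (Num.sqrt mq + Num.sqrt (b4 * kap) * Num.sqrt b4 * mb)
    + (g + mr) * (Num.sqrt mq * mb + Num.sqrt mq * mb
       + 2 * D * expR 1 * Num.sqrt kap * cx * 2 * b4 * mb ^+ 2)).

Let rho_sigma : rho <= sigma.
Proof.
rewrite ler_wsqrtr// mulrC ler_wpM2l ?invr_ge0//.
by rewrite -[leLHS]expr1 ler_weXn2l.
Qed.

Let sqrtp_rho : Num.sqrt (p%:R) * rho <= sigma.
Proof.
rewrite -sqrtrM// ler_wsqrtr// mulrA mulrC ler_wpM2l ?invr_ge0//.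
by rewrite -expr2 ler_weXn2l.
Qed.

Let sqrtn_rho2 : Num.sqrt n%:R * rho ^+ 2 <= sigma.
Proof.
have -> : Num.sqrt n%:R * rho ^+ 2 = Num.sqrt (n%:R * (p%:R / n%:R) ^+ 2).
  by rewrite sqrtrM// sqrtr_sqr rho2 ger0_norm// divr_ge0.
rewrite ler_wsqrtr//.
have -> : n%:R * (p%:R / n%:R) ^+ 2 = n%:R^-1 * p%:R ^+ 2 :> R.
  by field; rewrite gt_eqF.
by rewrite ler_wpM2l ?invr_ge0// ler_weXn2l.
Qed.

Let n_rho3 : rho * (n%:R * rho ^+ 2) <= sigma.
Proof.
have -> : rho * (n%:R * rho ^+ 2) = Num.sqrt (p%:R / n%:R * p%:R ^+ 2).
  rewrite rho2 sqrtrM ?divr_ge0// sqrtr_sqr ger0_norm//; congr (_ * _).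
  by field; rewrite gt_eqF.
rewrite ler_wsqrtr// le_eqVlt; apply/orP; left; apply/eqP; field.
by rewrite gt_eqF.
Qed.

Local Notation u i j := ((X i *m (b - b0)) j 0).

Let sq_del : sqnorm (b - b0) <= (mb * rho) ^+ 2.
Proof.
have -> : sqnorm (b - b0) = fnorm (b - b0) ^+ 2.
  rewrite sqr_sqrtr; last by apply: sumr_ge0 => i _; apply: sumr_ge0 => j _; exact: sqr_ge0.
  by apply: eq_bigr => i _; rewrite big_ord1.
by rewrite ler_sqr ?nnegrE ?mulr_ge0// sqrtr_ge0.
Qed.

Let u_sum j : \sum_i u i j ^+ 2 <= b4 * n%:R * (mb * rho) ^+ 2.
Proof.
apply: (@le_trans _ _ (\sum_i sqnorm (X i *m (b - b0)))).
  apply: ler_sum => i _; rewrite /sqnorm (bigD1 j)//= lerDl.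
  by apply: sumr_ge0 => k _; exact: sqr_ge0.
rewrite (le_trans (gram_le _))// ler_wpM2l// mulr_ge0//.
Qed.

Let u_le1 i j : `|u i j| <= 1.
Proof.
rewrite -(@expr_le1 _ 2)// real_normK ?num_real//.
rewrite (le_trans (mul_row_le _ _ _))//.
apply: (@le_trans _ _ ((cx * mb * sigma) ^+ 2)); last first.
  by rewrite (@expr_le1 _ 2)// !mulr_ge0// sqrtr_ge0.
apply: (@le_trans _ _ (cx ^+ 2 * p%:R * (mb * rho) ^+ 2)).
  by rewrite ler_wpM2l ?mulr_ge0 ?sqr_ge0.
have -> : cx ^+ 2 * p%:R * (mb * rho) ^+ 2 = (cx * mb * (Num.sqrt p%:R * rho)) ^+ 2.
  by rewrite !exprMn (@sqr_sqrtr _ p%:R)//; ring.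
rewrite ler_sqr ?nnegrE ?mulr_ge0 ?sqrtr_ge0//.
by rewrite ler_wpM2l ?mulr_ge0.
Qed.

Let Rhat_entry j k : `|invmx Rhat j k - G j k| <= mr * rho.
Proof.
apply: le_trans Rhat_le; rewrite -sqrtr_sqr ler_wsqrtr//.
rewrite (bigD1 j)//= (bigD1 k)//= !mxE -addrA lerDl addr_ge0//.
  by apply: sumr_ge0 => i _; exact: sqr_ge0.
by apply: sumr_ge0 => i _; apply: sumr_ge0 => i' _; exact: sqr_ge0.
Qed.

Let noise_term a j k :
  (\sum_i pearson (th i k) (y i k)%:R * (al a i j * binsd (th i j))) ^+ 2 +
    \sum_r ((\sum_i pearson (th i k) (y i k)%:R * (al a i j * binsd1 (th i j) * X i j r)) ^+ 2 +
      (\sum_i (pearson1 (th i k) (y i k)%:R + binsd (th i k)) *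
         (al a i j * binsd (th i j) * X i k r)) ^+ 2) / p%:R <= mq.
Proof.
apply: le_trans noise_le; rewrite /noise.
have bigge (I : finType) (i0 : I) (f : I -> R) : (forall i, 0 <= f i) -> f i0 <= \sum_i f i.
  by move=> f0; rewrite (bigD1 i0)//= lerDl sumr_ge0.
apply: le_trans (bigge _ a _ _) => /=; last first.
  by move=> a'; apply: sumr_ge0 => j' _; apply: sumr_ge0 => k' _; exact: term_ge0.
apply: le_trans (bigge _ j _ _) => /=; last first.
  by move=> j'; apply: sumr_ge0 => k' _; exact: term_ge0.
by apply: le_trans (bigge _ k _ _) => //= k'; exact: term_ge0.
Qed.

(** In units of rho = sqrt (p / n) and up to constants, the entries of [V] paired
with a covariate are of size rho, the estimation errors are of size rho, the
noise vectors of size sqrt p, and the Gram matrix of size n. The five terms of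
[linearization] are then of size rho, sqrt p * rho, sqrt p * rho, sqrt n * rho^2
and n * rho^3, each of which is at most sigma = sqrt (p^3 / n). *)
Lemma remainder_le a :
  `|wsum lead a y - (row a V *m gee_H X Rbar b0 *m (b - b0)) 0 0|
  <= remainder_constant * sigma.
Proof.
have sg0 : 0 <= sigma by exact: sqrtr_ge0.
pose t1 := Num.sqrt mq.
pose t2 := Num.sqrt mq * (mb * (Num.sqrt p%:R * rho)).
pose t4 := Num.sqrt (b4 * kap) * (Num.sqrt (b4 * n%:R) * (mb * rho)).
pose t5 := (Num.sqrt kap * cx * rho) * (2 * D * expR 1 * (2 * (b4 * n%:R * (mb * rho) ^+ 2))).
rewrite wsum_lead.
have sqrt_le (s c : R) : 0 <= c -> s ^+ 2 <= c ^+ 2 -> `|s| <= c.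
  by move=> c0 sc; rewrite -ler_sqr ?nnegrE// real_normK ?num_real.
have T1 j k : `|\sum_i al a i j * binsd (th i j) * pearson (th i k) (response y i k 0)| <= t1.
  apply: sqrt_le; rewrite ?sqrtr_ge0// sqr_sqrtr//.
  rewrite (le_trans _ (noise_term a j k))//.
  under eq_bigr do rewrite mulrC [response y _ k 0]mxE.
  rewrite lerDl sumr_ge0// => r _.
  by rewrite divr_ge0 ?addr_ge0 ?sqr_ge0.
have dot_le (c : 'I_p -> R) : (\sum_r c r ^+ 2) / p%:R <= mq ->
    `|\sum_r c r * (b - b0) r 0| <= t2.
  rewrite ler_pdivrMr ?(lt_le_trans _ pR)// => cq.
  apply: sqrt_le; first by rewrite !mulr_ge0 ?sqrtr_ge0.
  rewrite (le_trans (cauchy_schwarz _ _))//.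
  apply: le_trans (ler_pM _ _ cq sq_del) _; rewrite ?sqnorm_ge0//.
    by apply: sumr_ge0 => r _; exact: sqr_ge0.
  rewrite le_eqVlt; apply/orP; left; apply/eqP.
  by rewrite /t2 !exprMn (@sqr_sqrtr _ mq)// (@sqr_sqrtr _ p%:R)//; ring.
have T2 j k : `|\sum_i al a i j * binsd1 (th i j) * pearson (th i k) (response y i k 0) * u i j| <= t2.
  have -> : \sum_i al a i j * binsd1 (th i j) * pearson (th i k) (response y i k 0) * u i j =
     \sum_r (\sum_i pearson (th i k) (y i k)%:R * (al a i j * binsd1 (th i j) * X i j r)) * (b - b0) r 0.
    under [RHS]eq_bigr do rewrite mulr_suml.
    rewrite exchange_big; apply: eq_bigr => i _.
    by rewrite [X in _ * X]mxE mulr_sumr [response y i k 0]mxE; apply: eq_bigr => r _; ring.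
  apply: dot_le; apply: le_trans (noise_term a j k); rewrite -[leLHS]add0r lerD ?sqr_ge0//.
  rewrite mulr_suml; apply: ler_sum => r _.
  by rewrite ler_wpM2r ?invr_ge0// lerDl sqr_ge0.
have T3 j k : `|\sum_i al a i j * binsd (th i j)
      * (pearson1 (th i k) (response y i k 0) + binsd (th i k)) * u i k| <= t2.
  have -> : \sum_i al a i j * binsd (th i j)
      * (pearson1 (th i k) (response y i k 0) + binsd (th i k)) * u i k =
     \sum_r (\sum_i (pearson1 (th i k) (y i k)%:R + binsd (th i k)) *
         (al a i j * binsd (th i j) * X i k r)) * (b - b0) r 0.
    under [RHS]eq_bigr do rewrite mulr_suml.
    rewrite exchange_big; apply: eq_bigr => i _.
    by rewrite [X in _ * X]mxE mulr_sumr [response y i k 0]mxE; apply: eq_bigr => r _; ring.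
  apply: dot_le; apply: le_trans (noise_term a j k); rewrite -[leLHS]add0r lerD ?sqr_ge0//.
  rewrite mulr_suml; apply: ler_sum => r _.
  by rewrite ler_wpM2r ?invr_ge0// lerDr sqr_ge0.
have T4 j k : `|\sum_i al a i j * binsd (th i j) * binsd (th i k) * u i k| <= t4.
  apply: sqrt_le; first by rewrite !mulr_ge0 ?sqrtr_ge0.
  rewrite (le_trans (cauchy_schwarz _ _))//.
  rewrite /t4 exprMn (@sqr_sqrtr _ (b4 * kap)) ?mulr_ge0// [X in _ <= _ * X]exprMn.
  rewrite (@sqr_sqrtr _ (b4 * n%:R)) ?mulr_ge0//.
  apply: ler_pM => //; try by apply: sumr_ge0 => i _; exact: sqr_ge0.
  rewrite (le_trans _ (sum_al_le a j))//; apply: ler_sum => i _.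
  rewrite -mulrA exprMn -[leRHS]mulr1 ler_wpM2l ?sqr_ge0//.
  rewrite -[leLHS]real_normK ?num_real// (@expr_le1 _ 2)//.
  by rewrite normrM -[leRHS]mul1r ler_pM// (binsd_le _ _).1.
have T5 j k : `|\sum_i al a i j * (binsd (th i j + u i j) * pearson (th i k + u i k) (response y i k 0) -
    (binsd (th i j) * pearson (th i k) (response y i k 0) + binsd1 (th i j) * pearson (th i k) (response y i k 0) * u i j
     + binsd (th i j) * pearson1 (th i k) (response y i k 0) * u i k))| <= t5.
  rewrite (le_trans (ler_norm_sum _ _ _))//.
  apply: (@le_trans _ _ (\sum_i (Num.sqrt kap * cx * rho) *
     (2 * D * expR 1 * (u i j ^+ 2 + u i k ^+ 2)))).
    apply: ler_sum => i _; rewrite normrM ler_pM ?al_le//.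
    have [h1 h2] := thD i k.
    apply: score_term_taylor => //; rewrite mxE.
    by case: (y i k); [right|left].
  rewrite -mulr_sumr -mulr_sumr big_split /= /t5 ler_wpM2l ?mulr_ge0 ?sqrtr_ge0//.
  rewrite ler_wpM2l ?mulr_ge0 ?expR_ge0//.
  by rewrite mulr_natl mulr2n lerD// u_sum.
rewrite (le_trans (linearization S0 Rhat_entry G_le T1 T2 T3 T4 T5))//.
rewrite /remainder_constant -[leRHS]mulrA ler_wpM2l ?sqr_ge0// [leRHS]mulrDl; apply: lerD.
  rewrite -[leLHS]mulrA -[leRHS]mulrA ler_wpM2l// [leLHS]mulrDr [leRHS]mulrDl; apply: lerD.
    by rewrite mulrC /t1 ler_wpM2l ?sqrtr_ge0.
  have -> : rho * t4 = Num.sqrt (b4 * kap) * Num.sqrt b4 * mb * (Num.sqrt n%:R * rho ^+ 2).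
    by rewrite /t4 (sqrtrM n%:R b40); ring.
  by rewrite ler_wpM2l// !mulr_ge0 ?sqrtr_ge0.
rewrite -[leRHS]mulrA; apply: ler_pM.
- by rewrite addr_ge0// mulr_ge0.
- by rewrite !addr_ge0 ?mulr_ge0 ?sqrtr_ge0 ?expR_ge0 ?sqr_ge0.
- rewrite lerD2l ler_piMr// (le_trans rho_sigma)//.
rewrite [leRHS]mulrDl [X in _ <= X + _]mulrDl; apply: lerD; first apply: lerD.
- by rewrite /t2 mulrA ler_wpM2l// mulr_ge0 ?sqrtr_ge0.
- by rewrite /t2 mulrA ler_wpM2l// mulr_ge0 ?sqrtr_ge0.
have -> : t5 = 2 * D * expR 1 * Num.sqrt kap * cx * 2 * b4 * mb ^+ 2 *
    (rho * (n%:R * rho ^+ 2)) by rewrite /t5; ring.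
by rewrite ler_wpM2l// !mulr_ge0 ?sqrtr_ge0 ?expR_ge0 ?sqr_ge0.
Qed.
End FixedSize.

(** * Measurability of the exceptional events *)

Section MeasurableScore.
Variables (R : realType) (d : measure_display) (T : measurableType d).

(** The inverse is discontinuous at 0; on either side of 0 it is a composition of
the exponential and the logarithm. *)
Lemma measurable_inv (f : T -> R) :
  measurable_fun setT f -> measurable_fun setT (fun w => (f w)^-1).
Proof.
move=> mf.
pose inv (x : R) := if 0 < x then expR (- ln x) else
  (if x < 0 then - expR (- ln (- x)) else 0).
have invE x : x^-1 = inv x.
  rewrite /inv; case: ltgtP => [x0|x0|<-]; last by rewrite invr0.
    by rewrite expRN lnK.
  by rewrite expRN lnK ?posrE ?oppr_gt0// invrN opprK.
have -> : (fun w => (f w)^-1) = inv \o f by apply/funext => w; exact: invE.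
apply: measurableT_comp mf.
have mN : measurable_fun setT (-%R : R -> R) by exact: oppr_measurable.
apply: measurable_fun_ifT.
- exact: measurable_fun_ltr.
- by do 2!apply: measurableT_comp => //; exact: measurable_ln.
- apply: measurable_fun_ifT.
  + exact: measurable_fun_ltr.
  + apply: measurableT_comp => //; apply: measurableT_comp => //.
    by apply: measurableT_comp => //; apply: measurableT_comp => //; exact: measurable_ln.
  + exact: measurable_cst.
Qed.

Lemma measurable_mxM a b c (A : T -> 'M[R]_(a, b)) (B : T -> 'M[R]_(b, c)) :
  measurable_mx A -> measurable_mx B -> measurable_mx (fun w => A w *m B w).
Proof.
move=> mA mB i j.
have -> : (fun w => (A w *m B w) i j) = fun w => \sum_k A w i k * B w k j.
  by apply/funext => w; rewrite mxE.
by apply: measurable_sum => k; apply: measurable_funM.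
Qed.

Lemma measurable_mx_cst a b (A : 'M[R]_(a, b)) : measurable_mx (fun _ : T => A).
Proof. by move=> i j; exact: measurable_cst. Qed.

Lemma measurable_mxB a b (A B : T -> 'M[R]_(a, b)) :
  measurable_mx A -> measurable_mx B -> measurable_mx (fun w => A w - B w).
Proof.
move=> mA mB i j.
have -> : (fun w => (A w - B w) i j) = fun w => A w i j - B w i j.
  by apply/funext => w; rewrite !mxE.
exact: measurable_funB.
Qed.

Lemma measurable_det k (A : T -> 'M[R]_k) : measurable_mx A ->
  measurable_fun setT (fun w => \det (A w)).
Proof.
move=> mA; apply: measurable_sum => s; apply: measurable_funM => //.
by apply: measurable_prod => i _; exact: mA.
Qed.

(** The cofactor formula holds where the determinant does not vanish; elsewhere
[invmx] is the identity function. *)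
Lemma measurable_invmx k (A : T -> 'M[R]_k) : measurable_mx A ->
  measurable_mx (fun w => invmx (A w)).
Proof.
move=> mA i j.
have -> : (fun w => invmx (A w) i j) = fun w =>
   if \det (A w) == 0 then A w i j else (\det (A w))^-1 * cofactor (A w) j i.
  apply/funext => w; rewrite /invmx unitmxE unitfE.
  by case: eqP => //= _; rewrite !mxE.
have mdet := measurable_det mA.
apply: measurable_fun_ifT.
- exact: measurable_fun_eqr.
- exact: mA.
- apply: measurable_funM; first exact: measurable_inv.
  apply: measurable_funM => //; apply: measurable_det => i' j'.
  have -> : (fun w => row' j (col' i (A w)) i' j') = fun w => A w (lift j i') (lift i j').
    by apply/funext => w; rewrite !mxE.
  exact: mA.
Qed.

Lemma measurable_fnorm a b (A : T -> 'M[R]_(a, b)) : measurable_mx A ->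
  measurable_fun setT (fun w => fnorm (A w)).
Proof.
move=> mA; apply: measurableT_comp.
  by apply: continuous_measurable_fun; exact: sqrt_continuous.
apply: measurable_sum => i; apply: measurable_sum => j.
by apply: measurable_funX; exact: mA.
Qed.

Lemma measurable_sdv (f : T -> R) :
  measurable_fun setT f -> measurable_fun setT (fun w => binsd (f w)).
Proof.
move=> mf; have -> : (fun w => binsd (f w)) = fun w => (expR (f w / 2) + expR (- (f w / 2)))^-1.
  by apply/funext => w; exact: binsdE.
apply: measurable_inv; apply: measurable_funD.
  by apply: measurableT_comp => //; exact: measurable_funM.
apply: measurableT_comp => //; apply: measurableT_comp => //; exact: measurable_funM.
Qed.

Lemma measurable_res (f g : T -> R) : measurable_fun setT f -> measurable_fun setT g ->
  measurable_fun setT (fun w => pearson (f w) (g w)).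
Proof.
move=> mf mg; have -> : (fun w => pearson (f w) (g w)) = fun w =>
    g w * expR (- (f w / 2)) - (1 - g w) * expR (f w / 2).
  by apply/funext => w; exact: pearsonE.
have mf2 : measurable_fun setT (fun w => f w / 2) by exact: measurable_funM.
apply: measurable_funB; apply: measurable_funM => //.
- by apply: measurableT_comp => //; exact: measurableT_comp.
- exact: measurable_funB.
- exact: measurableT_comp.
Qed.

Lemma measurable_score_root n m p (X : 'I_n -> 'M[R]_(m, p)) (Y : 'I_n -> T -> 'cV[R]_m)
    (Rhat : T -> 'M[R]_m) (b : T -> 'cV[R]_p) :
  (forall i, measurable_mx (Y i)) -> measurable_mx Rhat -> measurable_mx b ->
  measurable [set w | gee_S X (fun i => Y i w) (Rhat w) (b w) = 0].
Proof.
move=> mY mRhat mb.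
pose S w r := ((delta_mx 0 r : 'rV[R]_p) *m gee_S X (fun i => Y i w) (Rhat w) (b w)) 0 0 : R.
have SE w r : S w r = gee_S X (fun i => Y i w) (Rhat w) (b w) r 0.
  by rewrite /S -rowE mxE.
have mS r : measurable_fun setT (S ^~ r).
  have -> : S ^~ r = fun w => \sum_i \sum_j \sum_k
    ((delta_mx 0 r : 'rV[R]_p) *m (X i)^T) 0 j * binsd ((X i *m b w) j 0) * invmx (Rhat w) j k
    * pearson ((X i *m b w) k 0) (Y i w k 0).
    by apply/funext => w; rewrite /S score_scalarE.
  have mXb i : measurable_mx (fun w => X i *m b w).
    by apply: measurable_mxM => //; exact: measurable_mx_cst.
  apply: measurable_sum => i; apply: measurable_sum => j; apply: measurable_sum => k.
  apply: measurable_funM; last first.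
    by apply: measurable_res; [exact: mXb|exact: mY].
  apply: measurable_funM; last exact: measurable_invmx.
  apply: measurable_funM; first exact: measurable_cst.
  by apply: measurable_sdv; exact: mXb.
have -> : [set w | gee_S X (fun i => Y i w) (Rhat w) (b w) = 0] =
    \bigcap_(r in [set: 'I_p]) ((S ^~ r) @^-1` [set 0]).
  apply/seteqP; split => w /= h.
    by move=> r _ /=; rewrite SE h mxE.
  by apply/colP => r; rewrite mxE -SE; exact: h.
apply: fin_bigcap_measurable => // r _.
by rewrite -[X in measurable X]setTI; exact: mS.
Qed.

Lemma measurable_orthant k (Z : T -> 'cV[R]_k) (t : 'cV[R]_k) : measurable_mx Z ->
  measurable [set w | forall i, Z w i 0 <= t i 0].
Proof.
move=> mZ.
have -> : [set w | forall i, Z w i 0 <= t i 0] =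
    \bigcap_(i in [set: 'I_k]) ((fun w => Z w i 0) @^-1` [set` `]-oo, t i 0]]).
  apply/seteqP; split => w /= h i.
    by move=> _; rewrite /= in_itv /=; exact: h.
  by have := h i I; rewrite /= in_itv.
apply: fin_bigcap_measurable => // i _.
by rewrite -[X in measurable X]setTI; exact: mZ.
Qed.

Lemma measurable_gt (f : T -> R) c : measurable_fun setT f -> measurable [set w | c < `|f w|].
Proof.
move=> mf.
have -> : [set w | c < `|f w|] = (fun w => `|f w|) @^-1` [set` `]c, +oo[].
  by apply/seteqP; split => w /=; rewrite in_itv /= andbT.
rewrite -[X in measurable X]setTI.
suff : measurable_fun setT (fun w => `|f w|) by exact.
exact: measurableT_comp.
Qed.

End MeasurableScore.

Section Sandwich.
Variables (R : realType) (d : measure_display) (T : measurableType d) (P : probability T R).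

Lemma probability_sandwich (A U L B : set T) (u lo b : R) :
  measurable A -> measurable U -> measurable L -> measurable B ->
  A `<=` U `|` B -> L `<=` A `|` B ->
  (P U <= u%:E)%E -> (lo%:E <= P L)%E -> (P B <= b%:E)%E ->
  lo - b <= fine (P A) <= u + b.
Proof.
move=> mA mU mL mB AU LA PU PL PB.
have fin C : measurable C -> P C = (fine (P C))%:E by move=> mC; rewrite fineK// fin_num_measure.
have h1 : (P A <= P U + P B)%E.
  rewrite (le_trans (le_measure P _ _ AU)) ?inE//; first exact: measurableU.
  exact: measureU2.
have h2 : (P L <= P A + P B)%E.
  rewrite (le_trans (le_measure P _ _ LA)) ?inE//; first exact: measurableU.
  exact: measureU2.
move: h1 h2 PU PL PB; rewrite (fin A mA) (fin U mU) (fin L mL) (fin B mB) -!EFinD !lee_fin /=.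
by move=> *; apply/andP; split; lra.
Qed.

Lemma probability_setU4_le (A B C D : set T) (e : R) :
  measurable A -> measurable B -> measurable C -> measurable D ->
  (P A <= e%:E)%E -> (P B <= e%:E)%E -> (P C <= e%:E)%E -> (P D <= e%:E)%E ->
  (P (A `|` B `|` C `|` D) <= (4 * e)%:E)%E.
Proof.
move=> mA mB mC mD PA PB PC PD.
have mAB : measurable (A `|` B) by exact: measurableU.
have mABC : measurable (A `|` B `|` C) by exact: measurableU.
have -> : (4 * e = e + e + e + e)%R by ring.
rewrite !EFinD.
have h1 : (P (A `|` B `|` C `|` D) <= P (A `|` B `|` C) + P D)%E by exact: measureU2.
have h2 : (P (A `|` B `|` C) <= P (A `|` B) + P C)%E by exact: measureU2.
have h3 : (P (A `|` B) <= P A + P B)%E by exact: measureU2.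
apply: (le_trans h1); apply: leeD => //; apply: (le_trans h2); apply: leeD => //.
by apply: (le_trans h3); apply: leeD.
Qed.
End Sandwich.

(** * Asymptotic normality *)

Section OneSampleSize.
Variables (R : realType) (n m p l : nat) (d : measure_display) (T : measurableType d)
  (P : probability T R).
Variables (X : 'I_n -> 'M[R]_(m, p)) (Y : 'I_n -> T -> 'cV[R]_m) (b0 : 'cV[R]_p)
  (R0 Rbar : 'M[R]_m) (Rhat : T -> 'M[R]_m) (bh : T -> 'cV[R]_p) (L : 'M[R]_(l, p)).
Hypotheses (n0 : (0 < n)%N) (m0 : (0 < m)%N) (p0 : (0 < p)%N).
Hypotheses (Ymeas : forall i, measurable_mx (Y i))
  (Ybin : forall i w j, Y i w j 0 = 0 \/ Y i w j 0 = 1)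
  (Yind : independent_vectors P Y)
  (Ymean : forall i j,
     ('E_P[fun w => (Y i w j 0)%R] = ((gee_pi (X i) b0 j 0)%R)%:E)%E)
  (Ycorr : forall i, corrmx P (Y i) = R0)
  (Rhatmeas : measurable_mx Rhat) (bhmeas : measurable_mx bh).
Variables (b1 b2 b3 b4 r1 s1 s2 cx : R).
Hypotheses (b10 : 0 < b1) (b21 : b2 < 1)
  (pi_bounds : forall i j, b1 <= gee_pi (X i) b0 j 0 /\ gee_pi (X i) b0 j 0 <= b2)
  (b30 : 0 < b3) (b40 : 0 < b4)
  (gram_min : b3 <= lambda_min (n%:R^-1 *: \sum_i ((X i)^T *m X i)))
  (gram_max : lambda_max (n%:R^-1 *: \sum_i ((X i)^T *m X i)) <= b4)
  (r10 : 0 < r1) (R0_min : r1 <= lambda_min R0)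
  (Rpos : posdef Rbar) (s10 : 0 < s1)
  (Rbar_min : s1 <= lambda_min Rbar) (Rbar_max : lambda_max Rbar <= s2)
  (cx0 : 0 <= cx) (X_le : forall i j, fnorm (row j (X i)) <= cx * Num.sqrt p%:R).
Let LSL := L *m gee_Sigma X R0 Rbar b0 *m L^T.
Hypothesis LSL_unit : LSL \in unitmx.

(** An upper bound for e^(th/2) and e^(-th/2) when b1 <= logistic th <= b2. *)
Definition exp_bound : R := b1^-1 + (1 - b2)^-1 + 1.
(** An upper bound for n times the squared norm of any row of the matrix [V] of
[studentized]. *)
Definition direction_bound : R := s2 ^+ 2 / (r1 * (b1 * (1 - b2)) * b3).

Let D := exp_bound.
Let kap := direction_bound.
Let g := s1^-1.
Let rho : R := Num.sqrt (p%:R / n%:R).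
Let sigma : R := Num.sqrt (n%:R^-1 * p%:R ^+ 3).
Let Z w := invmx (sqrtmx LSL) *m L *m (bh w - b0).

Variables (t : 'cV[R]_l) (e eta0 rho0 mb mr mq : R).
Hypotheses (e0 : 0 < e) (mb0 : 0 < mb) (mr0 : 0 < mr) (mq0 : 0 < mq).
Hypothesis clt : forall (xi : 'I_n -> {ffun 'I_m -> bool} -> 'I_l -> R) (eta : R),
  0 <= eta -> eta <= eta0 ->
  (forall i a, \sum_s blaw P Y i s * xi i s a = 0) ->
  (forall i s a, `|xi i s a| <= eta) ->
  (forall a b, \sum_i \sum_s blaw P Y i s * (xi i s a * xi i s b) = (a == b)%:R) ->
  pexp (blaw P Y) (fun y => [forall a, (wsum xi a y <= t a 0 + rho0)%R]%:R)
    <= \prod_a ncdf (t a 0) + e /\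
  \prod_a ncdf (t a 0) - e
    <= pexp (blaw P Y) (fun y => [forall a, (wsum xi a y <= t a 0 - rho0)%R]%:R).
Hypotheses
  (root_prob : (P (~` [set w | (gee_S X (fun i => Y i w) (Rhat w) (bh w) = 0)%R]) <= e%:E)%E)
  (bh_prob : (P [set w | (mb * rho < `|fnorm (bh w - b0)|)%R] <= e%:E)%E)
  (Rhat_prob : (P [set w | (mr * rho < `|fnorm (invmx (Rhat w) - invmx Rbar)|)%R] <= e%:E)%E)
  (noise_small : noise_bound m l D kap cx b4 / mq <= e)
  (lead_small : m%:R ^+ 2 * (Num.sqrt kap * cx * g * D) * rho <= eta0)
  (rem_small : remainder_constant m D kap cx b4 g mb mr mq * sigma <= rho0)
  (sigma1 : sigma <= 1) (sigma2 : cx * mb * sigma <= 1).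

(** Outside an event of probability at most 4 e, each coordinate of the
studentised error is within [rho0] of the leading sum. Hence its distribution
function at [t] lies, up to 4 e, between those of the leading sum at [t - rho0]
and [t + rho0], and these differ from the normal one by at most e. *)
Lemma gee_cdf_bound :
  \prod_a ncdf (t a 0) - 5 * e <= fine (P [set w | forall i, Z w i 0 <= t i 0])
    <= \prod_a ncdf (t a 0) + 5 * e.
Proof.
pose q := blaw P Y.
have q_ge0 : forall i s, 0 <= q i s by exact: blaw_ge0.
have q_sum1 : forall i, \sum_s q i s = 1 by exact: blaw_sum1.
have q_res := blaw_res_mean Ymeas Ybin Ymean.
have q_res1 := blaw_res1_mean Ymeas Ybin Ymean.
have q_cov := blaw_res_cov Ymeas Ybin Ymean Ycorr.
have R0s : R0^T = R0.
  apply/matrixP => j k; rewrite mxE -!(q_cov (Ordinal n0)).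
  by apply: eq_bigr => s _; congr (_ * _); rewrite mulrC.
have gram v := gram_bounds v n0 gram_min gram_max.
have gram_lb v : b3 * n%:R * sqnorm v <= \sum_i sqnorm (X i *m v) by have /andP[] := gram v.
have gram_ub v : \sum_i sqnorm (X i *m v) <= b4 * n%:R * sqnorm v by have /andP[] := gram v.
have b21' : 0 < 1 - b2 by rewrite subr_gt0.
have bb0 : 0 < b1 * (1 - b2) by rewrite mulr_gt0.
pose c0 := Num.sqrt (b1 * (1 - b2)).
have c00 : 0 < c0 by rewrite sqrtr_gt0.
have piE i j : gee_pi (X i) b0 j 0 = logistic ((X i *m b0) j 0) by rewrite mxE.
have hc0 i j : c0 <= binsd ((X i *m b0) j 0).
  have [h1 h2] := pi_bounds i j; rewrite piE in h1 h2.
  by rewrite ler_wsqrtr// ler_pM ?(ltW b10) ?(ltW b21')// lerB.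
have thD i j : expR ((X i *m b0) j 0 / 2) <= D /\ expR (- ((X i *m b0) j 0 / 2)) <= D.
  have [h1 h2] := pi_bounds i j; rewrite piE in h1 h2.
  have [h3 h4] := half_expR_le b10 b21 h1 h2.
  by rewrite /D /exp_bound; split; [rewrite (le_trans h3)|rewrite (le_trans h4)] => //; rewrite lerDl.
have D1 : 1 <= D by rewrite /D /exp_bound lerDr addr_ge0// invr_ge0 ltW.
have G_le := invmx_entry_le Rpos s10 Rbar_min.
have g0 : 0 <= g by rewrite invr_ge0 ltW.
have [V [VH VMV]] := studentized n0 m0 Rpos s10 Rbar_min Rbar_max R0s r10 R0_min b30 c00
  hc0 gram_lb LSL_unit.
have kap0 : 0 <= kap.
  by rewrite divr_ge0 ?sqr_ge0// !mulr_ge0// ltW.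
have V_le a : sqnorm (row a V)^T <= kap / n%:R.
  have := gee_M_lower m0 Rpos s10 Rbar_min Rbar_max R0s r10 R0_min c00 hc0 gram_lb (row a V).
  have -> : (row a V *m gee_M X R0 Rbar b0 *m (row a V)^T) 0 0 = 1.
    transitivity ((V *m gee_M X R0 Rbar b0 *m V^T) a a); last by rewrite VMV mxE eqxx.
    by rewrite tr_row -row_mul [LHS]mxE [RHS]mxE; apply: eq_bigr => k _; rewrite !mxE.
  have c02 : c0 ^+ 2 = b1 * (1 - b2) by rewrite sqr_sqrtr// ltW.
  rewrite mulr1 c02 => h.
  rewrite /kap /direction_bound -mulrA -invfM ler_pdivlMr ?mulr_gt0 ?ltr0n//.
  by rewrite (le_trans _ h)// le_eqVlt; apply/orP; left; apply/eqP; ring.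
have x_le i j : \sum_r X i j r ^+ 2 <= cx ^+ 2 * p%:R.
  have -> : \sum_r X i j r ^+ 2 = fnorm (row j (X i)) ^+ 2.
    rewrite sqr_sqrtr; last by apply: sumr_ge0 => i' _; apply: sumr_ge0 => r _; exact: sqr_ge0.
    by rewrite big_ord1; apply: eq_bigr => r _; rewrite mxE.
  have -> : cx ^+ 2 * p%:R = (cx * Num.sqrt p%:R) ^+ 2 by rewrite exprMn sqr_sqrtr.
  by rewrite ler_sqr ?nnegrE ?mulr_ge0 ?sqrtr_ge0.
pose W := lead X b0 Rbar V.
have W_le := lead_le kap0 cx0 thD V_le x_le G_le.
have W_mean := lead_mean Rbar V q_res.
have W_cov a b := lead_cov Rpos q_cov a b VMV.
have eta_ge0 : 0 <= m%:R ^+ 2 * (Num.sqrt kap * cx * g * D) * rho.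
  by rewrite !mulr_ge0 ?sqr_ge0 ?sqrtr_ge0// (le_trans _ D1).
have [clt_ub clt_lb] := clt eta_ge0 lead_small W_mean W_le W_cov.
have noiseE := noise_mean q_ge0 q_sum1 q_res q_res1 D1 cx0 (ltW b40) n0 p0 thD V_le x_le gram_ub.
have respE w : response R (allbits Y w) = (fun i => Y i w).
  by apply/funext => i; apply/colP => j; rewrite mxE ffunE (bitsE Ybin).
pose B1 := ~` [set w | gee_S X (fun i => Y i w) (Rhat w) (bh w) = 0].
pose B2 := [set w | (mb * rho < `|fnorm (bh w - b0)|)%R].
pose B3 := [set w | (mr * rho < `|fnorm (invmx (Rhat w) - invmx Rbar)|)%R].
pose noisy y := mq < noise X b0 V y.
pose B4 := [set w | noisy (allbits Y w)].
have mB1 : measurable B1 by apply: measurableC; exact: measurable_score_root.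
have mB2 : measurable B2.
  by apply: measurable_gt; apply: measurable_fnorm; apply: measurable_mxB => //; exact: measurable_mx_cst.
have mB3 : measurable B3.
  apply: measurable_gt; apply: measurable_fnorm; apply: measurable_mxB.
    exact: measurable_invmx.
  exact: measurable_mx_cst.
have mbits (A : pred {ffun 'I_n -> {ffun 'I_m -> bool}}) : measurable [set w | A (allbits Y w)].
  exact: (measurable_fiber_pred (measurable_allbits Ymeas Ybin) A).
have mB4 : measurable B4 by exact: mbits.
have PB4 : (P B4 <= e%:E)%E.
  rewrite (allbits_pred Ymeas Ybin Yind noisy) lee_fin.
  have := pexp_markov q_ge0 mq0 (noise_ge0 X b0 V).
  move/le_trans; apply; rewrite (le_trans _ noise_small)// ler_wpM2r// invr_ge0 ltW//.
have PB := probability_setU4_le mB1 mB2 mB3 mB4 root_prob bh_prob Rhat_prob PB4.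
pose Up y := [forall a, wsum W a y <= t a 0 + rho0].
pose Lo y := [forall a, wsum W a y <= t a 0 - rho0].
have good w : ~ (B1 `|` B2 `|` B3 `|` B4) w -> forall a,
    `|wsum W a (allbits Y w) - Z w a 0| <= rho0.
  move=> nB a.
  have S0 : gee_S X (response R (allbits Y w)) (Rhat w) (bh w) = 0.
    by rewrite respE; apply: contrapT => h; apply: nB; left; left; left.
  have h2 : fnorm (bh w - b0) <= mb * rho.
    rewrite (le_trans (ler_norm _))// leNgt; apply/negP => h; apply: nB; left; left; right.
    exact: h.
  have h3 : fnorm (invmx (Rhat w) - invmx Rbar) <= mr * rho.
    rewrite (le_trans (ler_norm _))// leNgt; apply/negP => h; apply: nB; left; right.
    exact: h.
  have h4 : noise X b0 V (allbits Y w) <= mq.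
    by rewrite leNgt; apply/negP => h; apply: nB; right.
  have := remainder_le D1 kap0 cx0 (ltW b40) g0 n0 p0 thD V_le x_le gram_ub G_le
    (ltW mb0) (ltW mr0) (ltW mq0) S0 h2 h3 h4 sigma1 sigma2 a.
  move/le_trans => /(_ _ rem_small); apply: le_trans.
  rewrite /Z VH.
  have -> : (V *m gee_H X Rbar b0 *m (bh w - b0)) a 0 =
      (row a V *m gee_H X Rbar b0 *m (bh w - b0)) 0 0.
    by rewrite -!row_mul [RHS]mxE.
  exact: lexx.
have mZ : measurable_mx Z.
  apply: measurable_mxM; first exact: measurable_mx_cst.
  by apply: measurable_mxB => //; exact: measurable_mx_cst.
have := @probability_sandwich R d T P [set w | forall i, Z w i 0 <= t i 0]
  [set w | Up (allbits Y w)] [set w | Lo (allbits Y w)] (B1 `|` B2 `|` B3 `|` B4)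
  (\prod_a ncdf (t a 0) + e) (\prod_a ncdf (t a 0) - e) (4 * e).
have -> : \prod_a ncdf (t a 0) - e - 4 * e = \prod_a ncdf (t a 0) - 5 * e by ring.
have -> : \prod_a ncdf (t a 0) + e + 4 * e = \prod_a ncdf (t a 0) + 5 * e by ring.
apply => //.
- exact: measurable_orthant.
- by apply: measurableU => //; apply: measurableU => //; exact: measurableU.
- move=> w Zt; have [?|/good gw] := pselect ((B1 `|` B2 `|` B3 `|` B4) w); [by right|left].
  apply/forallP => a; have := gw a; rewrite ler_norml => /andP[_].
  by have := Zt a; lra.
- move=> w /= /forallP Wt; have [?|/good gw] := pselect ((B1 `|` B2 `|` B3 `|` B4) w); [by right|left].
  move=> a; have := gw a; rewrite ler_norml => /andP[+ _].
  by have := Wt a; lra.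
- by rewrite (allbits_pred Ymeas Ybin Yind Up) lee_fin.
- by rewrite (allbits_pred Ymeas Ybin Yind Lo) lee_fin.
Qed.

End OneSampleSize.

Unset Implicit Arguments.
Set Strict Implicit.
Set Printing Implicit Defensive.

Theorem corollary3p9 (R : realType) (m l : nat) (p : nat -> nat)
    (d : nat -> measure_display) (T : forall n, measurableType (d n))
    (P : forall n, probability (T n) R)
    (X : forall n, 'I_n -> 'M[R]_(m, p n))
    (Y : forall n, 'I_n -> T n -> 'cV[R]_m)
    (beta0 : forall n, 'cV[R]_(p n))
    (R0 Rbar : nat -> 'M[R]_m)
    (Rhat : forall n, T n -> 'M[R]_m)
    (betahat : forall n, T n -> 'cV[R]_(p n))
    (L : forall n, 'M[R]_(l, p n))
    (hm : (0 < m)%N) (hl : (0 < l)%N)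
    (hp : p n @[n --> \oo] --> \oo)
    (hYmeas : forall n i, measurable_mx (Y n i))
    (hYbin : forall n i w j, Y n i w j 0 = 0 \/ Y n i w j 0 = 1)
    (hYind : forall n, independent_vectors (P n) (Y n))
    (hYmean : forall n i j,
       ('E_(P n)[fun w => (Y n i w j 0)%R] = ((gee_pi (X n i) (beta0 n) j 0)%R)%:E)%E)
    (hYcorr : forall n i, corrmx (P n) (Y n i) = R0 n)
    (hRhatmeas : forall n, measurable_mx (Rhat n))
    (hRhatinv : with_prob_to1 P (fun n => [set w | Rhat n w \in unitmx]))
    (hA1 : (fun n => \big[Num.max/0]_(i < n) \big[Num.max/0]_(j < m)
              fnorm (row j (X n i)))
           =O_\oo (fun n => Num.sqrt (p n)%:R))
    (B : forall n, set 'cV[R]_(p n))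
    (hBcompact : forall n, compact (B n))
    (hBint : forall n, interior (B n) (beta0 n))
    (b1 b2 : R) (hb1 : 0 < b1) (hb2 : b2 < 1)
    (hA2 : \forall n \near \oo, forall i j,
       b1 <= gee_pi (X n i) (beta0 n) j 0 /\ gee_pi (X n i) (beta0 n) j 0 <= b2)
    (b3 b4 : R) (hb3 : 0 < b3) (hb4 : 0 < b4)
    (hA3 : \forall n \near \oo,
       b3 <= lambda_min (n%:R^-1 *: \sum_i ((X n i)^T *m X n i)) /\
       lambda_max (n%:R^-1 *: \sum_i ((X n i)^T *m X n i)) <= b4)
    (r1 r2 : R) (hr1 : 0 < r1)
    (hR0 : \forall n \near \oo,
       r1 <= lambda_min (R0 n) /\ lambda_max (R0 n) <= r2)
    (hRbarpos : forall n, posdef (Rbar n))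
    (s1 s2 : R) (hs1 : 0 < s1)
    (hRbar : \forall n \near \oo,
       s1 <= lambda_min (Rbar n) /\ lambda_max (Rbar n) <= s2)
    (hA4 : bigOp P (fun n w => fnorm (invmx (Rhat n w) - invmx (Rbar n)))
             (fun n => Num.sqrt ((p n)%:R / n%:R)))
    (hbetameas : forall n, measurable_mx (betahat n))
    (hbetaroot : with_prob_to1 P (fun n =>
       [set w | gee_S (X n) (fun i => Y n i w) (Rhat n w) (betahat n w) = 0]))
    (hbetarate : bigOp P (fun n w => fnorm (betahat n w - beta0 n))
             (fun n => Num.sqrt ((p n)%:R / n%:R)))
    (hL : \forall n \near \oo,
       L n *m gee_Sigma (X n) (R0 n) (Rbar n) (beta0 n) *m (L n)^T \in unitmx)
    (hrate : (fun n => n%:R^-1 * (p n)%:R ^+ 3 : R) =o_\oo (fun=> 1 : R)) :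
  cvg_in_distribution P
    (fun n w =>
       invmx (sqrtmx
         (L n *m gee_Sigma (X n) (R0 n) (Rbar n) (beta0 n) *m (L n)^T))
       *m L n *m (betahat n w - beta0 n))
    (std_normal R l).
Proof.
move=> t _; rewrite joint_cdf_std_normal.
pose sigma n : R := Num.sqrt (n%:R^-1 * (p n)%:R ^+ 3).
pose rho n : R := Num.sqrt ((p n)%:R / n%:R).
have sigma_small (c0 c : R) : 0 < c -> \forall n \near \oo, c0 * sigma n <= c.
  move=> cpos; pose k := c / (`|c0| + 1).
  have c01 : 0 < `|c0| + 1 by rewrite ltr_wpDl.
  have k0 : 0 < k by rewrite divr_gt0.
  have /eqoP/(_ (k ^+ 2)) := hrate; rewrite exprn_gt0// => /(_ isT).
  apply: filterS => n; rewrite normr1 mulr1 => hn.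
  have sk : sigma n <= k.
    rewrite -(ger0_norm (ltW k0)) -sqrtr_sqr ler_wsqrtr//.
    by rewrite (le_trans (ler_norm _)).
  rewrite (le_trans (ler_norm _))// normrM (ger0_norm (sqrtr_ge0 _)).
  rewrite (le_trans (ler_wpM2l (normr_ge0 _) sk))//.
  by rewrite /k mulrCA ler_piMr ?(ltW cpos)// ler_pdivrMr// mul1r lerDl.
have p_ge1 : \forall n \near \oo, (0 < p n)%N by exact: (hp _ (nbhs_infty_gt 0)).
have n_ge1 : \forall n \near \oo, (0 < n)%N by exact: nbhs_infty_gt.
have rho_sigma n : (0 < p n)%N -> rho n <= sigma n.
  move=> pn; rewrite ler_wsqrtr// mulrC ler_wpM2l ?invr_ge0//.
  by rewrite -[leLHS]expr1 ler_weXn2l// ler1n.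
have [cx cx0 X_le] : exists2 cx : R, 0 <= cx & \forall n \near \oo, forall i j,
    fnorm (row j (X n i)) <= cx * Num.sqrt (p n)%:R.
  have /eqO_exP[k k0 hk] := hA1.
  exists k; first exact: ltW.
  apply: filterS hk => n hn i j.
  rewrite -[Num.sqrt _]ger0_norm ?sqrtr_ge0// (le_trans _ hn)//.
  rewrite (le_trans _ (ler_norm _))//.
  apply: (@le_trans _ _ (\big[Num.max/0]_(j < m) fnorm (row j (X n i)))).
    exact: (le_bigmax _ (fun j => fnorm (row j (X n i)))).
  exact: (le_bigmax _ (fun i => \big[Num.max/0]_(j < m) fnorm (row j (X n i)))).
have mZ n : measurable_mx (fun w => invmx (sqrtmx
         (L n *m gee_Sigma (X n) (R0 n) (Rbar n) (beta0 n) *m (L n)^T))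
       *m L n *m (betahat n w - beta0 n)).
  apply: measurable_mxM; first exact: measurable_mx_cst.
  by apply: measurable_mxB => //; exact: measurable_mx_cst.
apply/fine_cvgP; split.
  by near=> n; rewrite fin_num_measure//; exact: measurable_orthant.
apply/cvgrPdist_le => e0 e00.
pose e := e0 / 5.
have e_gt0 : 0 < e by rewrite divr_gt0.
have [eta0 [rho0 [eta0_gt0 rho0_gt0 clt]]] := cdf_clt (fun a => t a 0) e_gt0.
have [mb mb0 bh_prob] := hbetarate _ e_gt0.
have [mr mr0 Rhat_prob] := hA4 _ e_gt0.
pose D := exp_bound b1 b2; pose kap := direction_bound b1 b2 b3 r1 s2.
pose nb := noise_bound m l D kap cx b4.
(* Markov's inequality: the noise exceeds mq with probability at most
   nb / mq <= e. *)
pose mq := `|nb| / e + 1.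
have mq0 : 0 < mq by rewrite ltr_wpDl// divr_ge0// ltW.
have nb_mq : nb / mq <= e.
  rewrite ler_pdivrMr// /mq mulrDr mulr1 mulrCA divff ?gt_eqF// mulr1.
  by rewrite (le_trans (ler_norm _))// lerDl ltW.
have root_prob : \forall n \near \oo, (P n (~` [set w |
    (gee_S (X n) (fun i => Y n i w) (Rhat n w) (betahat n w) = 0)%R]) <= e%:E)%E.
  have /fine_cvgP[_ /cvgrPdist_le/(_ _ e_gt0)] := hbetaroot.
  apply: filterS => n /= hn.
  have mS : measurable [set w | gee_S (X n) (fun i => Y n i w) (Rhat n w) (betahat n w) = 0].
    exact: measurable_score_root.
  rewrite probability_setC// -[X in (1 - X)%E]fineK ?fin_num_measure//.
  by rewrite -EFinB lee_fin (le_trans (ler_norm _)).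
have lead_small := sigma_small (m%:R ^+ 2 * (Num.sqrt kap * cx * s1^-1 * D)) _ eta0_gt0.
have rem_small := sigma_small (remainder_constant m D kap cx b4 s1^-1 mb mr mq) _ rho0_gt0.
have sigma1 := sigma_small 1 1 ltr01.
have sigma2 := sigma_small (cx * mb) 1 ltr01.
near=> n.
have pn : (0 < p n)%N by near: n.
have nn : (0 < n)%N by near: n.
have lead_n : m%:R ^+ 2 * (Num.sqrt kap * cx * s1^-1 * D) * rho n <= eta0.
  have : m%:R ^+ 2 * (Num.sqrt kap * cx * s1^-1 * D) * sigma n <= eta0 by near: n.
  apply: le_trans; rewrite ler_wpM2l ?rho_sigma//.
  rewrite !mulr_ge0 ?sqr_ge0 ?sqrtr_ge0 ?invr_ge0 ?(ltW hs1)//.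
  by rewrite /D /exp_bound !addr_ge0// invr_ge0 ltW// subr_gt0.
have s1n : sigma n <= 1 by rewrite -[leLHS]mul1r; near: n.
have s2n : cx * mb * sigma n <= 1 by near: n.
have remn : remainder_constant m D kap cx b4 s1^-1 mb mr mq * sigma n <= rho0 by near: n.
have A2n : forall i j, b1 <= gee_pi (X n i) (beta0 n) j 0 /\
  gee_pi (X n i) (beta0 n) j 0 <= b2 by near: n.
have [A3n A3n'] : b3 <= lambda_min (n%:R^-1 *: \sum_i ((X n i)^T *m X n i)) /\
       lambda_max (n%:R^-1 *: \sum_i ((X n i)^T *m X n i)) <= b4 by near: n.
have [R0n _] : r1 <= lambda_min (R0 n) /\ lambda_max (R0 n) <= r2 by near: n.
have [Rbn Rbn'] : s1 <= lambda_min (Rbar n) /\ lambda_max (Rbar n) <= s2 by near: n.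
have Xn : forall i j, fnorm (row j (X n i)) <= cx * Num.sqrt (p n)%:R by near: n.
have Ln : L n *m gee_Sigma (X n) (R0 n) (Rbar n) (beta0 n) *m (L n)^T \in unitmx by near: n.
have := @gee_cdf_bound R n m (p n) l (d n) (T n) (P n) (X n) (Y n) (beta0 n) (R0 n)
  (Rbar n) (Rhat n) (betahat n) (L n) nn hm pn (hYmeas n) (hYbin n) (hYind n) (hYmean n)
  (hYcorr n) (hRhatmeas n) (hbetameas n) b1 b2 b3 b4 r1 s1 s2 cx hb1 hb2 A2n hb3 hb4
  A3n A3n' hr1 R0n (hRbarpos n) hs1 Rbn Rbn' cx0 Xn Ln t e eta0 rho0 mb mr mq.
move=> bound; rewrite ler_distlC.
have -> : e0 = 5 * e by rewrite /e; field.
rewrite /=; apply: bound => //.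
- move=> xi eta eta_ge0 eta_le xi_mean xi_le xi_cov.
  apply: (clt _ _ _ xi eta _ _ eta_ge0 eta_le xi_mean xi_le xi_cov).
    exact: blaw_ge0.
  exact: blaw_sum1.
- by near: n.
- by near: n.
- by near: n.
Unshelve. all: by end_near.
Qed.
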